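(* Let $L_\bullet$ be a (possibly unbounded) self-adjoint operator on a Hilbert space $H_\bullet$, let $\psi_0\in H_\bullet$ be a unit vector which is cyclic for $L_\bullet$, and assume that the restriction $L_\bullet|_{\psi_0}$ of $L_\bullet$ to the dense orbit $\mathrm{span}\{L_\bullet^k\psi_0:k\ge0\}$ is essentially self-adjoint. Let $L_+=0\oplus L_+^\perp$ be the embedded principal $(\psi_0,\psi_0)$-minor of $L_\bullet$. Then $L_\bullet$ and $\psi_0$ determine a unique profile $f\in\mathbf{P}^\vee$ such that (1) the $T^{\uparrow}$-observable of $f$ is the Titchmarsh–Weyl function: for all $u\in\mathbb{C}\setminus\mathbb{R}$, $$T^{\uparrow}(u)|_f=\langle\psi_0|\frac{1}{u-L_\bullet}|\psi_0\rangle=\frac1u\det\nolimits_{H_\bullet}\big(\mathbf{1}+(L_\bullet-L_+)(u-L_\bullet)^{-1}\big);$$ (2) the transition measure $\tau_f^{\uparrow}$ is the spectral measure of $L_\bullet$ at $\psi_0$; (3) the shifted Rayleigh function $\xi_f$ is the spectral shift function $\xi(c|L_\bullet,L_+)$.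
   Context: **Profiles.** A profile is a $1$-Lipschitz function $f:\mathbb{R}\to\mathbb{R}$ whose derivative satisfies $f'(c)\to\pm1$ as $c\to\pm\infty$ in the sense that $\int_{-\infty}^0(1+f'(c))\frac{dc}{1+|c|}<\infty$ and $\int_0^\infty(1-f'(c))\frac{dc}{1+|c|}<\infty$; $\mathbf{P}^\vee$ is the set of profiles. Profiles with the same derivative a.e. (i.e. differing by an additive constant) are identified in uniqueness statements. Rayleigh function: $F_f=\frac12(1+f')$. Shifted Rayleigh function: $\xi_f=F_f-\mathbf{1}_{[0,\infty)}$. $T^{\uparrow}$-observable: $T^{\uparrow}(u)|_f=\frac1u\exp\big(-\int_{-\infty}^{\infty}\frac{\xi_f(c)dc}{u-c}\big)$, $u\in\mathbb{C}\setminus\mathbb{R}$. Transition measure: the unique probability measure $\tau_f^{\uparrow}$ on $\mathbb{R}$ with $\int\frac{d\tau_f^{\uparrow}(c)}{u-c}=T^{\uparrow}(u)|_f$ for all $u\in\mathbb{C}\setminus\mathbb{R}$; by Kerov's Markov–Kreĭn correspondence, $f\mapsto\tau_f^{\uparrow}$ is a bijection between profiles and probability measures on $\mathbb{R}$. **Operators.** Write $H_\bullet=H_0\oplus H_+$ with $H_0=\mathbb{C}\psi_0$, $H_+=H_0^\perp$ and let $\pi_+$ be the orthogonal projection onto $H_+$. The principal minor is $L_+^\perp=\pi_+L_\bullet\pi_+$ acting in $H_+$; the embedded principal minor is $L_+=0\oplus L_+^\perp$ acting in $H_\bullet$, so that $L_\bullet-L_+$ has finite rank. The spectral measure of $L_\bullet$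 at $\psi_0$ is the probability measure $\tau^{\uparrow}$ with $\int\frac{d\tau^{\uparrow}(c)}{u-c}=\langle\psi_0|(u-L_\bullet)^{-1}|\psi_0\rangle$. For self-adjoint $L_\bullet,L_+$ with $L_\bullet-L_+$ trace class, Kreĭn's spectral shift function $\xi(c|L_\bullet,L_+)$ is the (a.e. unique) integrable function with $\det_{H_\bullet}\big(\mathbf{1}+(L_\bullet-L_+)(u-L_\bullet)^{-1}\big)=\exp\big(-\int_{-\infty}^\infty\frac{\xi(c|L_\bullet,L_+)dc}{u-c}\big)$ for all $u\in\mathbb{C}\setminus\mathbb{R}$ (Fredholm determinant). *)

(* Defs.v *)
From HB Require Import structures.
From mathcomp Require Import all_boot all_order all_algebra.
From mathcomp Require Import all_classical all_reals all_analysis.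
From mathcomp Require Export complex.
Import Order.TTheory GRing.Theory Num.Theory.
Import numFieldNormedType.Exports.

Set Implicit Arguments.
Unset Strict Implicit.
Unset Printing Implicit Defensive.

Local Open Scope classical_set_scope.
Local Open Scope ring_scope.
Local Open Scope complex_scope.

Section Complex.
Context {R : realType}.

Definition expC (z : R[i]) : R[i] :=
  (expR (complex.Re z))%:C * (cos (complex.Im z) +i* sin (complex.Im z)).

Definition Cintegral (mu : {measure set (measurableTypeR R) -> \bar R})
    (g : R -> R[i]) : R[i] :=
  (\int[mu]_c complex.Re (g c)) +i* (\int[mu]_c complex.Im (g c)).

Definition nonreal (u : R[i]) : Prop := complex.Im u != 0.

End Complex.

Section Profiles.
Context {R : realType}.
Local Notation mu := (@lebesgue_measure R).

(* Where [f] has no derivative, [derive1 f] takes a default value.  A Lipschitz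
   function is differentiable almost everywhere, so that this value plays no
   role in the integrals below. *)
Definition profile (f : R -> R) : Prop :=
  [/\ 1.-lipschitz f,
      (\int[mu]_(c in `]-oo, 0%R]) (((1 + derive1 f c) / (1 + `|c|))%R)%:E < +oo)%E
    & (\int[mu]_(c in `[0%R, +oo[) (((1 - derive1 f c) / (1 + `|c|))%R)%:E < +oo)%E].

(* For profiles: [f] and [g] differ by an additive constant. *)
Definition profile_eq (f g : R -> R) : Prop :=
  {ae mu, forall c, derive1 f c = derive1 g c}.

Definition rayleigh (f : R -> R) (c : R) : R := (1 + derive1 f c) / 2.

Definition shifted_rayleigh (f : R -> R) (c : R) : R :=
  rayleigh f c - \1_`[0, +oo[ c.

Definition T_up (f : R -> R) (u : R[i]) : R[i] :=
  u^-1 * expC (- Cintegral mu (fun c => (shifted_rayleigh f c)%:C / (u - c%:C))).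

Definition stieltjes (tau : probability (measurableTypeR R) R) (u : R[i]) : R[i] :=
  Cintegral tau (fun c => (u - c%:C)^-1).

(* By Stieltjes inversion, at most one probability measure [tau] has this
   property; likewise for [is_spectral_measure] below. *)
Definition is_transition_measure (f : R -> R)
    (tau : probability (measurableTypeR R) R) : Prop :=
  forall u, nonreal u -> stieltjes tau u = T_up f u.

End Profiles.

(* A partially defined linear operator is a domain together with a total
   function whose values outside the domain are irrelevant. *)
Record operator (R : realType) (H : lmodType R[i]) := Operator {
  dom : set H;
  op :> H -> H;
  dom0 : dom 0;
  domP : forall a v w, dom v -> dom w -> dom (a *: v + w);
  opP : forall a v w, dom v -> dom w -> op (a *: v + w) = a *: op v + op w }.

Section Operators.
Context {R : realType} {H : completeNormedModType R[i]}.
Variable dot : {dot H for Num.conj}.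

(* [dot] is conjugate-linear in its second argument, while brackets are
   conjugate-linear in the first one. *)
Local Notation "⟨ v | w ⟩" := (dot w v) (v at level 49, w at level 49).

Definition hilbert_dot : Prop := forall v : H, `|v| ^+ 2 = ⟨v | v⟩.

Definition graph (L : operator H) : set (H * H) :=
  [set p | dom L p.1 /\ p.2 = L p.1].

Definition adjoint (G : set (H * H)) : set (H * H) :=
  [set p | forall q, G q -> ⟨p.1 | q.2⟩ = ⟨p.2 | q.1⟩].

Definition self_adjoint_graph (G : set (H * H)) : Prop :=
  dense (fst @` G) /\ adjoint G = G.

Definition self_adjoint (L : operator H) : Prop := self_adjoint_graph (graph L).

(* The closure is taken in [H * H] with the product topology. *)
Definition essentially_self_adjoint_graph (G : set (H * H)) : Prop :=
  self_adjoint_graph (closure G).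

Definition orbit_span (L : operator H) (psi : H) : set H :=
  [set v | exists n (a : nat -> R[i]), v = \sum_(k < n) a k *: iter k L psi].

Definition cyclic_vector (L : operator H) (psi : H) : Prop :=
  (forall k, dom L (iter k L psi)) /\ dense (orbit_span L psi).

Definition orbit_restriction (L : operator H) (psi : H) : set (H * H) :=
  graph L `&` [set p | orbit_span L psi p.1].

(* (u - L)^-1, as a total function on [H] *)
Definition resolvent (L : operator H) (u : R[i]) (v : H) : H :=
  xget 0 [set w | dom L w /\ u *: w - L w = v].

(* For a unit vector [psi], the orthogonal projection onto its orthogonal. *)
Definition proj_orth (psi v : H) : H := v - ⟨psi | v⟩ *: psi.

Lemma proj_orthP (psi : H) a v w :
  proj_orth psi (a *: v + w) = a *: proj_orth psi v + proj_orth psi w.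
Proof.
by rewrite /proj_orth linearPl scalerDl scalerBr scalerA addrACA opprD.
Qed.

Section EmbeddedMinor.
Variables (L : operator H) (psi : H).

Let minor_dom : set H := [set v | dom L (proj_orth psi v)].
Let minor_op (v : H) : H := proj_orth psi (L (proj_orth psi v)).

Let minor_dom0 : minor_dom 0.
Proof. by rewrite /minor_dom /= /proj_orth linear0l scale0r subrr; apply: dom0. Qed.

Let minor_domP a v w : minor_dom v -> minor_dom w -> minor_dom (a *: v + w).
Proof. by rewrite /minor_dom /= proj_orthP; apply: domP. Qed.

Let minor_opP a v w : minor_dom v -> minor_dom w ->
  minor_op (a *: v + w) = a *: minor_op v + minor_op w.
Proof. by move=> *; rewrite /minor_op proj_orthP opP// proj_orthP. Qed.

(* 0 (+) (pi_+ L pi_+), where pi_+ = proj_orth psi *)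
Definition embedded_minor : operator H :=
  Operator minor_dom0 minor_domP minor_opP.

End EmbeddedMinor.

Definition is_spectral_measure (L : operator H) (psi : H)
    (tau : probability (measurableTypeR R) R) : Prop :=
  forall u, nonreal u -> stieltjes tau u = ⟨psi | resolvent L u psi⟩.

(* K = \sum_k |a k><b k| with \sum_k |a k| |b k| <= r; the infimum of such [r]
   is the trace norm of [K]. *)
Definition trace_norm_le (K : H -> H) (r : R) : Prop :=
  exists a b : nat -> H,
    (forall n, \sum_(k < n) `|a k| * `|b k| <= r%:C) /\
    (forall v, series (fun k => ⟨b k | v⟩ *: a k) @ \oo --> K v).

Definition trace_class (K : H -> H) : Prop := exists r, trace_norm_le K r.

Definition finite_rank n (a b : 'I_n -> H) (v : H) : H :=
  \sum_i ⟨b i | v⟩ *: a i.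

(* The determinant of 1 + \sum_i |a i><b i|, by Sylvester's identity. *)
Definition finite_rank_det n (a b : 'I_n -> H) : R[i] :=
  \det (1%:M + \matrix_(i, j) ⟨b i | a j⟩).

(* [d] is the Fredholm determinant of 1 + K: the determinant is defined on
   perturbations of finite rank and extended by continuity with respect to the
   trace norm, so that [d] is the limit of the determinants of 1 + F for F of
   finite rank converging to [K] in trace norm. *)
Definition is_fredholm_det (K : H -> H) (d : R[i]) : Prop :=
  forall e : R, 0 < e -> exists n (a b : 'I_n -> H),
    trace_norm_le (fun v => K v - finite_rank a b v) e /\
    `|finite_rank_det a b - d| <= e%:C.

(* (A - B) (u - A)^-1 *)
Definition perturbation (A B : operator H) (u : R[i]) (v : H) : H :=
  A (resolvent A u v) - B (resolvent A u v).

Definition trace_class_difference (A B : operator H) : Prop :=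
  dom A = dom B /\
  exists2 K, trace_class K & forall v, dom A v -> A v - B v = K v.

(* These conditions determine [xi] up to equality almost everywhere. *)
Definition is_spectral_shift (A B : operator H) (xi : R -> R) : Prop :=
  [/\ self_adjoint A, self_adjoint B, trace_class_difference A B,
      (@lebesgue_measure R).-integrable setT (EFin \o xi)
    & forall u, nonreal u ->
        is_fredholm_det (perturbation A B u)
          (expC (- Cintegral (@lebesgue_measure R)
                     (fun c => (xi c)%:C / (u - c%:C))))].

Definition T_up_is_titchmarsh_weyl (L : operator H) (psi : H) (f : R -> R) : Prop :=
  forall u, nonreal u ->
    T_up f u = ⟨psi | resolvent L u psi⟩ /\
    exists2 d, is_fredholm_det (perturbation L (embedded_minor L psi) u) d &
      ⟨psi | resolvent L u psi⟩ = u^-1 * d.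

Definition transition_is_spectral_measure (L : operator H) (psi : H)
    (f : R -> R) : Prop :=
  exists2 tau, is_transition_measure f tau & is_spectral_measure L psi tau.

Definition shifted_rayleigh_is_spectral_shift (L : operator H) (psi : H)
    (f : R -> R) : Prop :=
  is_spectral_shift L (embedded_minor L psi) (shifted_rayleigh f).

End Operators.

(* Main.v *)
(* Write T(u) = <psi0 | (u - L)^-1 psi0>.  The perturbation L - L_+ has rank two,
   and the determinant of the resulting 2 x 2 matrix is u T(u).  Quadrature for
   the moments <psi0 | L^k psi0> gives finitely supported probability measures
   tau_n with second moment |L psi0|^2; since the orbit of psi0 is a core for L,
   their Stieltjes transforms T_n converge to T.  The zeros of T_n interlace its
   poles, so that u T_n(u) = exp (- int xi_n(c) / (u - c) dc) for a step function
   xi_n with 0 <= xi_n + 1_[0, oo[ <= 1, and the common second moment bounds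
   int |c| |xi_n(c)| dc uniformly in n.  Weak-* compactness then yields xi with
   u T(u) = exp (- int xi(c) / (u - c) dc), and Helly's selection theorem, applied
   to the quantile functions of tau_n, yields the spectral measure.  The profile
   is |x| + 2 int_{-oo}^x xi.  For uniqueness, the difference of two
   exponents lies in 2 pi i Z, is continuous along vertical lines and vanishes at
   infinity, hence is zero, and a function is determined almost everywhere by its
   Poisson integrals. *)
Require Import Defs.
From HB Require Import structures.
From mathcomp Require Import all_boot all_order all_algebra.
From mathcomp Require Import finmap.
From mathcomp Require Import all_classical all_reals all_analysis measurable_realfun.
From mathcomp Require Import polyrcf.
From mathcomp Require Import ring lra.
Import Order.TTheory GRing.Theory Num.Theory.
Import numFieldNormedType.Exports.
Set Implicit Arguments.
Unset Strict Implicit.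
Unset Printing Implicit Defensive.
Local Open Scope classical_set_scope.
Local Open Scope ring_scope.

(** * Self-adjoint operators and resolvents *)

(** Essential self-adjointness on the orbit enters at one point. The moments of an unbounded
    operator may belong to several measures; what singles out [T] is that (u - L)^-1 psi0 is a
    graph-norm limit of vectors p(L) psi0, and the residual psi0 - (u - L) p(L) psi0 controls the
    quadrature error. Both compactness arguments must prevent a loss at infinity: the kernel 1 / (u
    - c) is not Lebesgue integrable, so weak-* convergence of xi_n does not apply to it directly,
    and quantile functions have no common bound. The remedy in both cases is 1 - M / y^2 <= - y Im
    T_n(iy) with M = |L psi0|^2, finite because psi0 lies in the domain. For xi_n it becomes a bound
    on the first moment, since xi_n(c) and c have opposite signs and so the real part of log (iy
    T_n(iy)) is the integral of a function of one sign. The quantile functions are composed with the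
    arctangent, and the inequality then forbids the limit to charge the angles +-pi/2. The spectral
    measure is thus constructed, without a spectral theorem for unbounded operators. *)

Section Conjugation.
Context {R : realType}.
Implicit Types x y : R[i].

Lemma conjM x y : (x * y)^* = x^* * y^*. Proof. exact: rmorphM. Qed.

End Conjugation.

Section InnerProduct.
Context {R : realType} {H : completeNormedModType R[i]}.
Variable dot : {dot H for Num.conj}.
Hypothesis hdot : hilbert_dot dot.

Lemma dotDl u v w : dot (u + v) w = dot u w + dot v w.
Proof. exact: linearDl. Qed.

Lemma dotBl u v w : dot (u - v) w = dot u w - dot v w.
Proof. exact: linearBl. Qed.

Lemma dotNl v w : dot (- v) w = - dot v w. Proof. exact: linearNl. Qed.
Lemma dotNr v w : dot w (- v) = - dot w v. Proof. exact: linearNr. Qed.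

Lemma dotZl a v w : dot (a *: v) w = a * dot v w.
Proof. exact: linearZl_LR. Qed.

Lemma dotDr u v w : dot w (u + v) = dot w u + dot w v.
Proof. exact: linearDr. Qed.

Lemma dotBr u v w : dot w (u - v) = dot w u - dot w v.
Proof. exact: linearBr. Qed.

Lemma dotZr a v w : dot w (a *: v) = a^* * dot w v.
Proof. exact: linearZr_LR. Qed.

Lemma dot0r w : dot w 0 = 0. Proof. exact: linear0r. Qed.

Lemma dot_suml (I : Type) (r : seq I) (P : pred I) (F : I -> H) w :
  dot (\sum_(i <- r | P i) F i) w = \sum_(i <- r | P i) dot (F i) w.
Proof. exact: linear_sumlz. Qed.

Lemma dot_sumr (I : Type) (r : seq I) (P : pred I) (F : I -> H) w :
  dot w (\sum_(i <- r | P i) F i) = \sum_(i <- r | P i) dot w (F i).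
Proof. exact: linear_sumr. Qed.

Lemma dotC v w : dot v w = (dot w v)^*.
Proof. by rewrite hermC expr0 mul1r. Qed.

(** Cauchy-Schwarz, from the nonnegative squared norm of the component of [v] orthogonal to [w]. *)
Lemma dot_norm_le v w : `|dot v w| <= `|v| * `|w|.
Proof.
have [->|w0] := eqVneq w 0; first by rewrite dot0r normr0 mulr_ge0.
have nw0 : 0 < `|w| by rewrite normr_gt0.
rewrite -(@ler_pXn2r _ 2)// ?nnegrE ?mulr_ge0// exprMn.
have m0 : 0 < `|w| ^+ 2 by rewrite exprn_gt0.
have aC : (dot v w / `|w| ^+ 2)^* = (dot v w)^* / `|w| ^+ 2.
  by rewrite conjM; congr (_ * _); apply: conj_Creal; rewrite rpredV rpredX// normr_real.
have : 0 <= `|v - (dot v w / `|w| ^+ 2) *: w| ^+ 2 by rewrite exprn_ge0.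
rewrite hdot dotBl !dotBr !dotZl !dotZr aC.
rewrite [dot w v]dotC -!hdot.
have -> : `|v| ^+ 2 - (dot v w)^* / `|w| ^+ 2 * dot v w -
    (dot v w / `|w| ^+ 2 * (dot v w)^* - dot v w / `|w| ^+ 2 *
    ((dot v w)^* / `|w| ^+ 2 * `|w| ^+ 2)) =
    `|v| ^+ 2 - (dot v w * (dot v w)^*) / `|w| ^+ 2.
  by field; rewrite gt_eqF.
by rewrite -normCK subr_ge0 ler_pdivrMr.
Qed.

Lemma cvg_dotl (v : nat -> H) (a w : H) :
  v @ \oo --> a -> dot (v n) w @[n --> \oo] --> dot a w.
Proof.
move=> va; apply/cvgrPdist_le => e e0.
have e1 : 0 < e / (`|w| + 1) by rewrite divr_gt0// ltr_wpDl.
move/cvgrPdist_le : va => /(_ _ e1).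
apply: filterS => n h; rewrite -dotBl.
rewrite (le_trans (dot_norm_le _ _))//.
rewrite (le_trans (ler_wpM2r _ h))// mulrAC ler_pdivrMr ?ltr_wpDl//.
by rewrite ler_wpM2l ?lerDl// ltW.
Qed.

Lemma cvg_dotr (v : nat -> H) (a w : H) :
  v @ \oo --> a -> dot w (v n) @[n --> \oo] --> dot w a.
Proof.
move=> va; apply/cvgrPdist_le => e e0.
move/cvgrPdist_le : (@cvg_dotl v a w va) => /(_ _ e0).
by apply: filterS => n h; rewrite -dotBr dotC norm_conjC dotBl.
Qed.

Lemma parallelogram (v w : H) :
  `|v + w| ^+ 2 + `|v - w| ^+ 2 = (`|v| ^+ 2 + `|w| ^+ 2) *+ 2.
Proof.
by rewrite !hdot !dotDl !dotDr !dotNl !dotNr mulr2n; ring.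
Qed.

(** Radii of balls in [H] live in [R[i]]; a positive one is real, so real [e] suffice. *)
Lemma cvg_of_cauchy_seq (u : nat -> H) :
  (forall e : R, 0 < e -> exists N, forall n m, (N <= n)%N -> (N <= m)%N ->
    `|u n - u m| <= e%:C%C%C) -> cvg (u @ \oo).
Proof.
move=> h; apply/cauchy_cvgP/cauchy_exP => e e0.
have re : (complex.Re e)%:C%C = e by rewrite RRe_real// gtr0_real.
have e2 : 0 < complex.Re e / 2 by rewrite divr_gt0// -ltcR re.
have [N hN] := h _ e2.
exists (u N); exists N => // n /= Nn; rewrite -ball_normE/=.
rewrite (le_lt_trans (hN _ _ (leqnn N) Nn))// -[ltRHS]re ltcR.
by rewrite ltr_pdivrMr// ltr_pMr ?ltr1n// -ltcR re.
Qed.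

End InnerProduct.

Lemma numField_cvg_unique {K : numFieldType} (a : nat -> K) (l l' : K) :
  a @ \oo --> l -> a @ \oo --> l' -> l = l'.
Proof. exact: (cvg_unique (@norm_hausdorff _ K^o)). Qed.

Lemma nearC_natSinv_le {R : realType} (c e : R[i]) : 0 <= c -> 0 < e ->
  \forall n \near \oo, c * n.+1%:R^-1 <= e.
Proof.
move=> c0 e0.
have ce : (complex.Re c)%:C%C = c by rewrite RRe_real// ger0_real.
have re : (complex.Re e)%:C%C = e by rewrite RRe_real// gtr0_real.
have c0' : 0 <= complex.Re c by rewrite -lecR ce.
have e0' : 0 < complex.Re e by rewrite -ltcR re.
have d0 : 0 < complex.Re e / (complex.Re c + 1) by rewrite divr_gt0// ltr_wpDl.
near=> n.
have h : n.+1%:R^-1 < complex.Re e / (complex.Re c + 1).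
  by near: n; exact: (near_infty_natSinv_lt (PosNum d0)).
rewrite -ce -re -(rmorph_nat (real_complex R)) -fmorphV -rmorphM/= lecR.
rewrite (le_trans (ler_wpM2l c0' (ltW h)))// mulrCA ler_piMr ?(ltW e0')//.
by rewrite ler_pdivrMr ?ltr_wpDl// mul1r lerDl.
Unshelve. all: by end_near. Qed.

Section Projection.
Context {R : realType} {H : completeNormedModType R[i]}.
Variable dot : {dot H for Num.conj}.
Hypothesis hdot : hilbert_dot dot.

(** A minimizing sequence for the distance from [v] to [M] is Cauchy by the parallelogram law, and
    its limit inherits orthogonality from an estimate along the sequence. *)
Lemma projection (M : set H) (v : H) :
  M 0 -> (forall a x y, M x -> M y -> M (a *: x + y)) ->
  (forall (u : nat -> H) l, (forall n, M (u n)) -> u @ \oo --> l -> M l) ->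
  exists2 m, M m & forall q, M q -> dot (v - m) q = 0.
Proof.
move=> M0 Mlin Mcl.
pose D := [set x : R | exists2 m, M m & x = complex.Re (`|v - m| ^+ 2)].
have DE m : (complex.Re (`|v - m| ^+ 2))%:C%C = `|v - m| ^+ 2.
  by rewrite RRe_real// ger0_real// exprn_ge0.
have D0 : D !=set0 by eexists; exists 0.
have Dlb : has_lbound D.
  by exists 0 => _ [m _ ->]; rewrite -lecR DE exprn_ge0.
have hinf : has_inf D by split.
set d := inf D.
have dle m : M m -> d%:C%C <= `|v - m| ^+ 2.
  by move=> Mm; rewrite -DE lecR; apply: ge_inf => //; exists m.
have hm n : exists m, M m /\ `|v - m| ^+ 2 <= d%:C%C + n.+1%:R^-1.
  have n0 : (0 : R) < n.+1%:R^-1 by rewrite invr_gt0.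
  have [_ [m Mm ->] lt] := inf_adherent n0 hinf.
  exists m; split => //; rewrite -DE -(rmorph_nat (real_complex R)) -fmorphV.
  by rewrite -rmorphD/= lecR ltW.
have [m hm'] := choice hm; clear hm.
have Mm n := (hm' n).1; have mle n := (hm' n).2; clear hm'.
(* The midpoint of [m n] and [m k] lies in [M], so its squared distance to [v] is at least [d]. *)
have dm n k : `|m n - m k| ^+ 2 <= (n.+1%:R^-1 + k.+1%:R^-1) *+ 2.
  have vE : v - m k - (v - m n) = m n - m k by rewrite opprB addrC subrKA.
  have := parallelogram hdot (v - m k) (v - m n).
  rewrite vE addrC => /(canRL (addrK _)) ->.
  have -> : v - m k + (v - m n) = 2 *: (v - 2^-1 *: (m k + m n)).
    by rewrite scalerBr scalerA divff// scale1r scaler_nat mulr2n addrACA opprD.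
  rewrite normrZ exprMn normr_nat.
  have Mmid : M (2^-1 *: (m k + m n)).
    rewrite -[_ *: _]addr0; apply: (Mlin) => //.
    by rewrite -(scale1r (m k)); apply: (Mlin).
  rewrite lerBlDr.
  have -> : (n.+1%:R^-1 + k.+1%:R^-1) *+ 2 + 2 ^+ 2 * `|v - 2^-1 *: (m k + m n)| ^+ 2
    = (n.+1%:R^-1 + k.+1%:R^-1 + `|v - 2^-1 *: (m k + m n)| ^+ 2 *+ 2) *+ 2.
    by rewrite !mulr2n expr2; ring.
  rewrite lerMn2r orFb (le_trans (lerD (mle k) (mle n)))//.
  rewrite addrACA -mulr2n addrC [k.+1%:R^-1 + _]addrC lerD2l lerMn2r orFb.
  exact: dle.
have : cvg (m @ \oo).
  apply: cvg_of_cauchy_seq => e e0.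
  have e20 : (0 : R[i]) < (e ^+ 2)%:C%C by rewrite ltcR exprn_gt0.
  have [N _ hN] := @nearC_natSinv_le R 4 _ (ler0n _ _) e20.
  exists N => n k Nn Nk.
  rewrite -(@ler_pXn2r _ 2)// ?nnegrE ?lecR ?(ltW e0)//.
  rewrite (le_trans (dm n k))// -rmorphXn/= -(@ler_pMn2r _ 2)// [leRHS]mulr2n.
  rewrite (le_trans _ (lerD (hN n Nn) (hN k Nk)))// -mulrDr -mulrnA.
  by rewrite mulr_natl.
move/cvg_ex => [l ml].
exists l; first exact: Mcl ml.
move=> q Mq.
(* Moving [m n] along [q] by the optimal coefficient lowers the squared distance by |dot (v - m n)
   q|^2 / |q|^2, which cannot exceed the excess 1/(n+1) over [d]. *)
have h n : `|dot (v - m n) q| ^+ 2 <= `|q| ^+ 2 * n.+1%:R^-1.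
  have [->|q0] := eqVneq q 0; first by rewrite dot0r !normr0 !expr0n/= mulr_ge0.
  have m0 : 0 < `|q| ^+ 2 by rewrite exprn_gt0 ?normr_gt0.
  set a := dot (v - m n) q / `|q| ^+ 2.
  have aC : a^* = (dot (v - m n) q)^* / `|q| ^+ 2.
    rewrite conjM; congr (_ * _); apply: conj_Creal.
    by rewrite rpredV rpredX// normr_real.
  have Ma : M (a *: q + m n) by apply: (Mlin).
  have := le_trans (mle n) (lerD (dle _ Ma) (lexx n.+1%:R^-1)).
  have -> : v - (a *: q + m n) = v - m n - a *: q by rewrite opprD addrA addrAC.
  rewrite -lerBlDl [X in X <= _](_ : _ = `|dot (v - m n) q| ^+ 2 / `|q| ^+ 2).
    by rewrite ler_pdivrMr// mulrC.
  rewrite [ `|v - m n - _| ^+ 2]hdot (dotBl _ (v - m n)) !(dotBr _ (v - m n)).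
  rewrite !dotZl !dotZr aC (dotC _ q) -!hdot normCK /a.
  by field; rewrite normr_eq0.
have vml : (fun n => v - m n) @ \oo --> v - l by apply: cvgB => //; apply: cvg_cst.
have hl := @cvg_dotl _ _ dot hdot _ _ q vml.
apply: (numField_cvg_unique hl).
apply/cvgrPdist_le => e e0.
have := @nearC_natSinv_le R (`|q| ^+ 2) (e ^+ 2) (exprn_ge0 _ (normr_ge0 _)) (exprn_gt0 _ e0).
apply: filterS => n hn.
rewrite sub0r normrN -(@ler_pXn2r _ 2)// ?nnegrE ?(ltW e0)//.
exact: le_trans (h n) hn.
Qed.

End Projection.

Lemma nonreal_conj {R : realType} (u : R[i]) : nonreal u -> nonreal u^*.
Proof. by case: u => a b; rewrite /nonreal/= oppr_eq0. Qed.

Section SelfAdjoint.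
Context {R : realType} {H : completeNormedModType R[i]}.
Variable dot : {dot H for Num.conj}.
Hypothesis hdot : hilbert_dot dot.

Section Resolvent.
Variables (L : operator H).
Hypothesis L_sa : self_adjoint dot L.

Lemma domZ a v : dom L v -> dom L (a *: v).
Proof. by move=> dv; rewrite -[_ *: _]addr0; apply: domP => //; apply: dom0. Qed.

Lemma domB v w : dom L v -> dom L w -> dom L (v - w).
Proof. by move=> dv dw; rewrite addrC -scaleN1r; apply: domP. Qed.

Lemma op0 : L 0 = 0.
Proof.
have := @opP _ _ L 1 0 0 (dom0 L) (dom0 L).
by rewrite !scale1r addr0 => /eqP; rewrite -subr_eq subrr => /eqP.
Qed.

Lemma opZ a v : dom L v -> L (a *: v) = a *: L v.
Proof. by move=> dv; rewrite -[a *: v]addr0 opP// ?op0 ?addr0//; apply: dom0. Qed.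

Lemma opB v w : dom L v -> dom L w -> L (v - w) = L v - L w.
Proof. by move=> dv dw; rewrite addrC -scaleN1r opP// scaleN1r addrC. Qed.

Lemma sa_sym v w : dom L v -> dom L w -> dot (L v) w = dot v (L w).
Proof.
move=> dv dw; have [_ h] := L_sa.
have : graph L (w, L w) by [].
by rewrite -h => /(_ (v, L v) (conj dv erefl)).
Qed.

Lemma sa_graph x y : (forall v, dom L v -> dot (L v) x = dot v y) ->
  dom L x /\ y = L x.
Proof.
move=> h; have [_ hL] := L_sa.
suff : graph L (x, y) by [].
by rewrite -hL => -[v w] [/= dv ->]; apply: h.
Qed.

(** Adjoints are closed: symmetry against a fixed [w] in the domain passes to the limit. *)
Lemma sa_closed (v : nat -> H) x y : (forall n, dom L (v n)) ->
  v @ \oo --> x -> (fun n => L (v n)) @ \oo --> y -> dom L x /\ y = L x.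
Proof.
move=> dv vx Ly; apply: sa_graph => w dw.
apply: (@numField_cvg_unique _ (fun n => dot (L w) (v n))).
  exact: (cvg_dotr hdot).
under eq_fun do rewrite sa_sym//.
exact: (cvg_dotr hdot).
Qed.

Lemma sa_dot_real v : dom L v -> complex.Im (dot (L v) v) = 0.
Proof.
move=> dv; have : dot (L v) v = (dot (L v) v)^* by rewrite -dotC sa_sym.
by case: (dot _ _) => a b [] /=; lra.
Qed.

(** Since [dot (L v) v] is real, the imaginary part of [dot (u *: v - L v) v] is Im u |v|^2;
    Cauchy-Schwarz then removes one factor |v|. *)
Lemma sa_lower_bound u v : dom L v ->
  `|complex.Im u|%:C%C * `|v| <= `|u *: v - L v|.
Proof.
move=> dv; have [->|v0] := eqVneq v 0.
  by rewrite normr0 mulr0.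
have nv0 : 0 < `|v| by rewrite normr_gt0.
rewrite -(ler_pM2r nv0) (le_trans _ (dot_norm_le hdot _ _))//.
rewrite dotBl dotZl -hdot -mulrA -expr2.
have : (complex.Re (`|v| ^+ 2))%:C%C = `|v| ^+ 2.
  by rewrite RRe_real// ger0_real// exprn_ge0.
have : 0 <= complex.Re (`|v| ^+ 2) by rewrite -lecR RRe_real ?ger0_real ?exprn_ge0.
set t := complex.Re _ => t0 <-.
have := sa_dot_real dv; case: (dot _ _) => a b /= ->.
case: u => c d /=; rewrite -rmorphM/=.
have -> : (c +i* d)%C * t%:C%C - (a +i* 0)%C = ((c * t - a) +i* (d * t))%C.
  by simpc.
rewrite normc_def lecR/= -{1}(ger0_norm t0) -normrM -sqrtr_sqr.
by rewrite ler_sqrt ?lerDr ?addr_ge0 ?sqr_ge0.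
Qed.

Lemma sa_inj u v w : nonreal u -> dom L v -> dom L w ->
  u *: v - L v = u *: w - L w -> v = w.
Proof.
move=> u0 dv dw h.
have := sa_lower_bound u (domB dv dw).
rewrite opB// scalerBr.
have -> : u *: v - u *: w - (L v - L w) = (u *: v - L v) - (u *: w - L w).
  by rewrite !opprD !opprK addrACA.
rewrite h subrr normr0 => h0; apply/eqP; rewrite -subr_eq0 -normr_le0.
rewrite -(@pmulr_rle0 _ (`|complex.Im u|%:C%C))//.
by rewrite ltcR normr_gt0.
Qed.

(** The lower bound makes the range closed, and a vector orthogonal to the range is an eigenvector
    of [L] for the conjugate of [u], hence zero. *)
Lemma sa_surj u v : nonreal u -> exists2 w, dom L w & u *: w - L w = v.
Proof.
move=> u0; pose M := [set v | exists2 w, dom L w & u *: w - L w = v].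
have iu0 : (0 : R[i]) < `|complex.Im u|%:C%C by rewrite ltcR normr_gt0.
have M0 : M 0 by exists 0; [exact: dom0|rewrite scaler0 op0 subrr].
have Mlin a x y : M x -> M y -> M (a *: x + y).
  move=> [x' dx <-] [y' dy <-]; exists (a *: x' + y'); first exact: domP.
  by rewrite opP// scalerDr scalerBr opprD addrACA !scalerA mulrC.
have Mcl (z : nat -> H) l : (forall n, M (z n)) -> z @ \oo --> l -> M l.
  move=> /(_ _)/cid2 h zl; pose w n := sval (h n).
  have dw n : dom L (w n) by rewrite /w; case: (h n).
  have wz n : u *: w n - L (w n) = z n by rewrite /w; case: (h n).
  have : cvg (w @ \oo).
    apply: cvg_of_cauchy_seq => e e0.
    set d : R := e * `|complex.Im u| / 2.
    have d0 : (0 : R[i]) < d%:C%C by rewrite ltcR divr_gt0// mulr_gt0// normr_gt0.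
    move/cvgrPdist_le : zl => /(_ _ d0)[N _ hN]; exists N => n m Nn Nm.
    rewrite -(ler_pM2l iu0) (le_trans (sa_lower_bound u (domB (dw n) (dw m))))//.
    rewrite opB// scalerBr.
    have -> : u *: w n - u *: w m - (L (w n) - L (w m)) = (l - z m) - (l - z n).
      transitivity (z n - z m); last by rewrite opprB [RHS]addrC subrKA.
      by rewrite -!wz !opprD !opprK addrACA.
    rewrite (le_trans (ler_normB _ _))// (le_trans (lerD (hN m Nm) (hN n Nn)))//.
    by rewrite -rmorphD -rmorphM/= lecR /d -splitr mulrC.
  move/cvg_ex => [x wx].
  have Lw : (fun n => L (w n)) @ \oo --> u *: x - l.
    rewrite (_ : (fun n => L (w n)) = (fun n => u *: w n - z n)).
      by apply: cvgB => //; apply: cvgZr.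
    by apply/funext => n; rewrite -wz opprB addrC subrK.
  have [dx h'] := sa_closed dw wx Lw.
  by exists x => //; rewrite -h' opprB addrC subrK.
have [_ [m dm <-] h] := projection hdot v M0 Mlin Mcl.
exists m => //.
set x := v - _ in h.
have [|dx Lx] := @sa_graph x (u^* *: x).
  move=> w dw; have : dot (u *: w - L w) x = 0.
    by rewrite dotC h ?conjC0//; exists w.
  by rewrite dotBl dotZl dotZr conjCK => /eqP; rewrite subr_eq0 => /eqP.
have x0 : x = 0.
  apply: (sa_inj (nonreal_conj u0) dx (dom0 L)).
  by rewrite -Lx scaler0 op0 !subrr.
by apply/eqP; rewrite eq_sym -subr_eq0; apply/eqP.
Qed.

Lemma resolventP u v : nonreal u ->
  dom L (resolvent L u v) /\ u *: resolvent L u v - L (resolvent L u v) = v.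
Proof.
move=> u0; rewrite /resolvent; case: xgetP => // h.
by have [w dw wE] := sa_surj v u0; case: (h w).
Qed.

Lemma resolventE u v w : nonreal u -> dom L w -> u *: w - L w = v ->
  resolvent L u v = w.
Proof.
move=> u0 dw wE; have [dr rE] := resolventP v u0.
by apply: (sa_inj u0 dr dw); rewrite rE.
Qed.

Lemma resolvent_adj u v w : nonreal u ->
  dot (resolvent L u v) w = dot v (resolvent L u^* w).
Proof.
move=> u0; have [dv vE] := resolventP v u0.
have [dw wE] := resolventP w (nonreal_conj u0).
rewrite -{1}wE -{2}vE dotBl dotBr dotZl dotZr conjCK.
by rewrite sa_sym.
Qed.

End Resolvent.
End SelfAdjoint.

(** * The embedded principal minor *)

Section Minor.
Context {R : realType} {H : completeNormedModType R[i]}.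
Variable dot : {dot H for Num.conj}.
Hypothesis hdot : hilbert_dot dot.

Lemma finite_rank_trace_class n (a b : 'I_n -> H) :
  trace_class dot (finite_rank dot a b).
Proof.
(* The trace norm is phrased with sequences, so both families are padded with zeros. *)
pose ext (c : 'I_n -> H) k := if insub k is Some i then c i else 0.
have extE c (i : 'I_n) : ext c i = c i by rewrite /ext valK.
have ext0 c k : (n <= k)%N -> ext c k = 0.
  by move=> nk; rewrite /ext insubF// ltnNge nk.
have sumE (G : nat -> R[i]) k : (forall j, (n <= j)%N -> G j = 0) ->
  (forall j, 0 <= G j) -> \sum_(j < k) G j <= \sum_(j < n) G j.
  move=> G0 Gp; have [kn|nk] := leqP k n.
    rewrite -!(big_mkord predT) (big_cat_nat _ kn)//= lerDl sumr_ge0//.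
  rewrite -!(big_mkord predT) (big_cat_nat (n := n) _ (ltnW nk))//=.
  rewrite [X in _ + X <= _]big_nat_cond [X in _ + X <= _]big1 ?addr0// => j /andP[/andP[nj _] _].
  exact: G0.
set r := \sum_(j < n) `|ext a j| * `|ext b j|.
exists (complex.Re r), (ext a), (ext b); split.
  move=> k; rewrite RRe_real; last first.
    by rewrite ger0_real// sumr_ge0// => j _; rewrite mulr_ge0.
  apply: (@sumE (fun j => `|ext a j| * `|ext b j|)).
    by move=> j nj; rewrite ext0// normr0 mul0r.
  by move=> j; rewrite mulr_ge0.
move=> v; apply: cvg_near_cst; exists n => // k /= nk.
rewrite /series/= (big_cat_nat (n := n) _ nk)//= [X in _ + X]big_nat_cond.
rewrite [X in _ + X]big1 ?addr0.
  by rewrite big_mkord; apply: eq_bigr => j _; rewrite !extE.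
by move=> j /andP[/andP[nj _] _]; rewrite !ext0// scaler0.
Qed.

(** The approximating operator is [K] itself at every precision, so the error is the zero series. *)
Lemma finite_rank_fredholm_det n (a b : 'I_n -> H) (K : H -> H) :
  (forall v, K v = finite_rank dot a b v) ->
  is_fredholm_det dot K (finite_rank_det dot a b).
Proof.
move=> KE e e0; exists n, a, b; split; last first.
  by rewrite subrr normr0 lecR ltW.
exists (fun=> 0), (fun=> 0); split.
  by move=> k; rewrite big1 ?lecR ?ltW// => j _; rewrite normr0 mul0r.
move=> v; rewrite KE subrr; apply: cvg_near_cst; near=> k.
by rewrite /series/= big1// => j _; rewrite scaler0.
Unshelve. all: by end_near. Qed.

Variables (L : operator H) (psi : H).
Hypotheses (L_sa : self_adjoint dot L) (psi1 : `|psi| = 1) (dpsi : dom L psi).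

(** With Q the projection onto [psi] and pi_+ = 1 - Q, one has L - pi_+ L pi_+ = pi_+ L Q + Q L.
    Symmetry turns <psi | L v> into <L psi | v>, which makes the second term defined everywhere. *)
Let K v := dot v psi *: (L psi - dot (L psi) psi *: psi) + dot v (L psi) *: psi.

Lemma dom_embedded_minor v : dom (embedded_minor dot L psi) v <-> dom L v.
Proof.
rewrite /= /proj_orth; split => dv; last by apply: domB => //; apply: domZ.
by rewrite -(subrK (dot v psi *: psi) v) addrC; apply: domP.
Qed.

Lemma embedded_minorE v : dom L v -> L v - embedded_minor dot L psi v = K v.
Proof.
move=> dv; rewrite /= /proj_orth opB//; last exact: domZ.
rewrite opZ// dotBl dotZl (sa_sym L_sa dv dpsi) /K scalerBr scalerBl scalerA.
move: (L v) (L psi) (dot v (L psi)) (dot v psi) (dot (L psi) psi) => a b c d e.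
by rewrite opprB addrCA subKr -[RHS]addrA [RHS]addrC [- _ + _]addrC.
Qed.

Lemma minor_dot_sym v w : dot (K v) w = dot v (K w).
Proof.
have er : (dot (L psi) psi)^* = dot (L psi) psi.
  by rewrite -dotC (sa_sym L_sa dpsi dpsi).
rewrite /K !dotDl !dotDr !dotZl !dotZr !dotBl !dotBr !dotZl !dotZr er -!dotC.
ring.
Qed.

(** [K] is symmetric and defined everywhere, so [y] is the weak image of [x] under the minor exactly
    when [y + K x] is its weak image under [L]. *)
Lemma embedded_minor_self_adjoint : self_adjoint dot (embedded_minor dot L psi).
Proof.
have [L_dense _] := L_sa.
have domE : fst @` graph (embedded_minor dot L psi) = fst @` graph L.
  apply/seteqP; split => _ [[v w] [dv _] <-].
    by exists (v, L v) => //; split => //; apply/(dom_embedded_minor v).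
  exists (v, embedded_minor dot L psi v) => //; split => //.
  exact/(dom_embedded_minor v).
split; first by rewrite domE.
apply/seteqP; split => [[x y] h|[x y] [dx yE] [v w] [dv wE]].
  have [|dx yE] := @sa_graph _ _ dot L L_sa x (y + K x).
    move=> v dv.
    have := h (v, embedded_minor dot L psi v)
      (conj ((dom_embedded_minor v).2 dv) erefl).
    rewrite -(subrK (embedded_minor dot L psi v) (L v)) embedded_minorE//.
    rewrite [snd _]/= [fst _]/= [in dot v _]/= => e.
    by rewrite dotDl minor_dot_sym e -dotDr addrC.
  split; first exact/(dom_embedded_minor x).
  by rewrite /= -[RHS](subKr (L x)) embedded_minorE// -yE addrK.
move: dx dv yE wE => /(dom_embedded_minor x) dx /(dom_embedded_minor v) dv.
have E z : dom L z -> embedded_minor dot L psi z = L z - K z.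
  by move=> dz; rewrite -embedded_minorE// subKr.
rewrite [snd _]/= [fst _]/= (E x)// (E v)// => -> ->.
by rewrite /= dotBl dotBr minor_dot_sym (sa_sym L_sa).
Qed.

Lemma minor_trace_class_difference :
  trace_class_difference dot L (embedded_minor dot L psi).
Proof.
split; first by apply/seteqP; split => v /dom_embedded_minor.
exists K; last exact: embedded_minorE.
pose a (i : 'I_2) := if i == 0 then L psi - dot (L psi) psi *: psi else psi.
pose b (i : 'I_2) := if i == 0 then psi else L psi.
have -> : K = finite_rank dot a b; last exact: finite_rank_trace_class.
by apply/funext => v; rewrite /finite_rank !big_ord_recl big_ord0 /= addr0.
Qed.

Lemma minor_fredholm_det u : nonreal u ->
  is_fredholm_det dot (perturbation L (embedded_minor dot L psi) u)
    (u * dot (resolvent L u psi) psi).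
Proof.
move=> u0.
pose r := resolvent L u psi; pose s := resolvent L u (L psi).
have [dr rE] := resolventP hdot L_sa psi u0.
have Lr : L r = u *: r - psi.
  by rewrite -[X in _ - X]rE -/r opprB addrC subrK.
(* The identity (u - L)^-1 L psi = u (u - L)^-1 psi - psi reduces the four matrix entries to [u],
   [T] and [m]. *)
have sE : s = u *: r - psi.
  apply: (resolventE hdot L_sa) => //; first by apply: domB => //; apply: domZ.
  by rewrite opB ?opZ//; [rewrite Lr subKr|exact: domZ].
set T := dot r psi; pose m := dot (L psi) psi.
have psipsi : dot psi psi = 1 by rewrite -hdot psi1 expr1n.
have rphi : dot r (L psi) = u * T - 1.
  by rewrite -(sa_sym L_sa)// Lr dotBl dotZl psipsi.
pose a (i : 'I_2) := if i == 0 then L psi - m *: psi else psi.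
(* The resolvent moves to the bra as its adjoint, the resolvent at the conjugate of [u]. *)
pose b (i : 'I_2) := resolvent L u^* (if i == 0 then psi else L psi).
have -> : u * T = finite_rank_det dot a b.
  rewrite /finite_rank_det (expand_det_row _ 0) !big_ord_recl big_ord0 addr0.
  rewrite /cofactor !det_mx11 !mxE /a /b /=.
  rewrite -!(resolvent_adj hdot L_sa)// -/r.
  have -> : resolvent L u (L psi - m *: psi) = s - m *: r.
    have ds : dom L s by rewrite sE; apply: domB => //; apply: domZ.
    apply: (resolventE hdot L_sa) => //; first by apply: domB => //; apply: domZ.
    rewrite opB ?opZ//; last exact: domZ.
    have [_ sR] := resolventP hdot L_sa (L psi) u0.
    rewrite -{2}rE -[in RHS]sR -/s -/r scalerBr !scalerBr !scalerA [m * u]mulrC.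
    by rewrite !opprD !opprK addrACA.
  rewrite !dotBl !dotZl sE !dotBl !dotZl rphi -/T -(sa_sym L_sa dpsi dpsi) -/m.
  by rewrite psipsi /bump/= !addn0 expr0 expr1; ring.
apply: finite_rank_fredholm_det => v.
have [dv vE] := resolventP hdot L_sa v u0.
rewrite /perturbation embedded_minorE// /K /finite_rank !big_ord_recl big_ord0.
by rewrite /= addr0 /b /= -!(resolvent_adj hdot L_sa).
Qed.

End Minor.

(** * Approximation of the resolvent by quadrature *)

Section Krylov.
Context {R : realType} {H : completeNormedModType R[i]}.
Variable dot : {dot H for Num.conj}.
Hypothesis hdot : hilbert_dot dot.

(** Linearly dependent vectors are skipped, so [d] may be smaller than [n]. The invariant [D] keeps
    the orthonormal family inside the domain of [L]. *)
Lemma gram_schmidt (D : set H) (f : nat -> H) n :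
  (forall a v w, D v -> D w -> D (a *: v + w)) -> D 0 -> (forall k, D (f k)) ->
  exists d (e : nat -> H),
    [/\ forall i j, (i < d)%N -> (j < d)%N -> dot (e i) (e j) = (i == j)%:R,
        forall i, (i < d)%N -> D (e i)
      & forall k, (k < n)%N -> f k = \sum_(i < d) dot (f k) (e i) *: e i].
Proof.
move=> Dlin D0 Df; elim: n => [|n [d [e [eo De fe]]]].
  by exists 0%N, (fun=> 0); split.
have Dsum (a : nat -> R[i]) m : (m <= d)%N -> D (\sum_(i < m) a i *: e i).
  elim: m => [|m ih] md; first by rewrite big_ord0.
  by rewrite big_ord_recr/= addrC; apply: (Dlin) (De _ md) (ih (ltnW md)).
set r := f n - \sum_(i < d) dot (f n) (e i) *: e i.
have [r0|r0] := eqVneq r 0.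
  exists d, e; split => // k; rewrite ltnS leq_eqVlt => /orP[/eqP->|/fe//].
  by apply/eqP; rewrite -subr_eq0 -/r r0.
have nr0 : `|r| != 0 by rewrite normr_eq0.
have nrC : `|r|^-1^* = `|r|^-1.
  by apply: conj_Creal; rewrite rpredV normr_real.
have re i : (i < d)%N -> dot r (e i) = 0.
  move=> id; rewrite dotBl dot_suml (bigD1 (Ordinal id))//= dotZl eo// eqxx mulr1.
  rewrite big1 ?addr0 ?subrr// => j ji; rewrite dotZl eo//.
  by rewrite (_ : (j == i :> nat) = false) ?mulr0//; apply: negbTE.
have er i : (i < d)%N -> dot (e i) r = 0 by move=> id; rewrite dotC re ?conjC0.
exists d.+1, (fun i => if (i < d)%N then e i else `|r|^-1 *: r); split.
- move=> i j; rewrite ltnS leq_eqVlt => id; rewrite ltnS leq_eqVlt => jd.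
  case/orP: id => [/eqP->|id]; case/orP: jd => [/eqP->|jd].
  + rewrite ltnn eqxx dotZl dotZr -hdot nrC expr2 mulKf// mulVf//.
  + by rewrite ltnn jd dotZl re// mulr0 gtn_eqF.
  + by rewrite ltnn id dotZr er// mulr0 ltn_eqF.
  + by rewrite id jd eo.
- move=> i _; case: ifPn => [/De//|_]; have Dr : D r.
    rewrite /r addrC -scaleN1r.
    exact: Dlin (-1) _ _ (Dsum (fun i => dot (f n) (e i)) _ (leqnn d)) (Df n).
  by rewrite -[_ *: _]addr0; exact: Dlin `|r|^-1 _ _ Dr D0.
move=> k; rewrite ltnS leq_eqVlt big_ord_recr/= ltnn.
under eq_bigr => i _ do rewrite ltn_ord.
move=> /orP[/eqP->|kn].
  have fn : f n = \sum_(i < d) dot (f n) (e i) *: e i + r by rewrite addrC subrK.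
  rewrite {1}fn; congr (_ + _).
  rewrite dotZr nrC {1}fn dotDl dot_suml big1 ?add0r.
    by rewrite -hdot expr2 mulKf// scalerA divff// scale1r.
  by move=> i _; rewrite dotZl er ?mulr0.
have fkr : dot (f k) r = 0.
  by rewrite (fe _ kn) dot_suml big1// => i _; rewrite dotZl er ?mulr0.
by rewrite dotZr fkr mulr0 scale0r addr0; exact: fe.
Qed.

End Krylov.

Section Quadrature.
Context {R : realType} {H : completeNormedModType R[i]}.
Variable dot : {dot H for Num.conj}.
Hypothesis hdot : hilbert_dot dot.
Variables (L : operator H) (psi : H).
Hypotheses (L_sa : self_adjoint dot L) (dpsi : forall k, dom L (iter k L psi)).

Lemma op_sum (I : Type) (r : seq I) (a : I -> R[i]) (e : I -> H) :
  (forall i, dom L (e i)) ->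
  dom L (\sum_(i <- r) a i *: e i) /\
  L (\sum_(i <- r) a i *: e i) = \sum_(i <- r) a i *: L (e i).
Proof.
move=> de; elim: r => [|i r [ihd ih]].
  by rewrite !big_nil; split; [exact: dom0|exact: op0].
by rewrite !big_cons; split; [exact: domP|rewrite opP// ih].
Qed.

(** The nodes are the eigenvalues of the Hermitian compression [A] of [L] to the span of the first
    [n] orbit vectors, and the weights are the squared moduli of the coordinates of [psi] in an
    eigenbasis. The coordinate row of L^k psi is [c 0] times A^k as long as the earlier orbit
    vectors lie in that span. *)
Lemma moment_quadrature n : exists d (lam w : 'I_d -> R),
  (forall i, 0 <= w i) /\
  forall j k, (j < n)%N -> (k < n)%N ->
    \sum_(i < d) (w i * lam i ^+ (j + k))%:C%C = dot (iter j L psi) (iter k L psi).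
Proof.
have [|||d [e [eo De fe]]] :=
  @gram_schmidt _ _ dot hdot (dom L) (fun k => iter k L psi) n.
- by move=> *; apply: domP.
- exact: dom0.
- by [].
pose A : 'M[R[i]]_d := \matrix_(i, j) dot (L (e i)) (e j).
pose c k : 'rV[R[i]]_d := \row_j dot (iter k L psi) (e j).
have cS k : (k < n)%N -> c k.+1 = c k *m A.
  move=> kn; apply/rowP => j; rewrite !mxE iterS {1}(fe _ kn).
  have [_ ->] := @op_sum _ (index_enum 'I_d) (fun i => dot (iter k L psi) (e i)) (fun i => e i)
    (fun i => De _ (ltn_ord i)).
  by rewrite dot_suml; apply: eq_bigr => i _; rewrite dotZl !mxE.
have Aherm : A \is hermsymmx.
  apply/is_hermitianmxP; rewrite expr0 scale1r; apply/matrixP => i j.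
  by rewrite !mxE -dotC (sa_sym L_sa)//; apply: De.
have /orthomx_spectralP AE := hermitian_normalmx Aherm.
have /mxOverP sreal := hermitian_spectral_diag_real Aherm.
have PU := spectral_unitarymx A.
have Punit := spectral_unit A.
move: (spectralmx A) (spectral_diag A) AE sreal PU Punit => P D AE sreal PU Punit.
pose z k := c k *m invmx P.
have zE k i : (k < n)%N -> z k 0 i = z 0%N 0 i * D 0 i ^+ k.
  elim: k => [|k ih] kn; first by rewrite expr0 mulr1.
  rewrite {1}/z cS ?(ltnW kn)// AE !mulmxA mulmxK// -/(z k).
  by rewrite mul_mx_diag mxE ih ?(ltnW kn)// exprSr mulrA.
exists d, (fun i => complex.Re (D 0 i)), (fun i => complex.Re (`|z 0%N 0 i| ^+ 2)).
split.
  by move=> i; rewrite -lecR RRe_real ?ger0_real ?exprn_ge0.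
move=> j k jn kn.
have -> : dot (iter j L psi) (iter k L psi) = (c j *m (map_mx Num.conj (c k)^T)) 0 0.
  rewrite {1}(fe _ jn) dot_suml !mxE; apply: eq_bigr => i _.
  by rewrite dotZl !mxE -dotC.
have cz m : c m = z m *m P by rewrite /z mulmxKV.
have conjE (v : 'rV[R[i]]_d) i : (map_mx Num.conj v^T) i 0 = (v 0 i)^*.
  by rewrite !mxE.
have -> : c j *m (map_mx Num.conj (c k)^T) = z j *m map_mx Num.conj (z k)^T.
  by rewrite !cz trmx_mul map_mxM mulmxA mulmxtVK.
rewrite mxE; apply: eq_bigr => i _.
rewrite conjE (zE j i jn) (zE k i kn) conjM.
have -> : (D 0 i ^+ k)^* = D 0 i ^+ k by apply: conj_Creal; rewrite rpredX.
have -> : ((complex.Re (`|z 0%N 0 i| ^+ 2) * complex.Re (D 0 i) ^+ (j + k)))%:C%C =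
    (complex.Re (`|z 0%N 0 i| ^+ 2))%:C%C * (complex.Re (D 0 i))%:C%C ^+ (j + k).
  by rewrite rmorphM rmorphXn.
rewrite !RRe_real ?sreal ?ger0_real ?exprn_ge0// exprD normCK.
by rewrite mulrACA.
Qed.

End Quadrature.

(** * Graph-norm density of the orbit *)

Section Core.
Context {R : realType} {H : completeNormedModType R[i]}.
Variable dot : {dot H for Num.conj}.
Hypothesis hdot : hilbert_dot dot.
Variables (L : operator H) (psi : H).
Hypotheses (L_sa : self_adjoint dot L).

Lemma closure_pair (G : set (H * H)) p (e : R[i]) : 0 < e -> closure G p ->
  exists2 q, G q & `|p.1 - q.1| < e /\ `|p.2 - q.2| < e.
Proof.
move=> e0 /(_ _ (nbhsx_ballx p e e0))[q [Gq [b1 b2]]]; exists q => //.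
by move: b1 b2; rewrite -!ball_normE.
Qed.

(* Since [graph L] is the adjoint of itself, it contains the closure of the
   restriction, and taking adjoints reverses this inclusion. *)
Lemma orbit_core :
  essentially_self_adjoint_graph dot (orbit_restriction L psi) ->
  graph L `<=` closure (orbit_restriction L psi).
Proof.
move=> [_ esa]; have [_ sa] := L_sa.
rewrite -esa => p; rewrite -{1}sa => hp q clq.
apply/eqP; rewrite -subr_eq0 -normr_le0; apply/ler_addgt0Pr => e e0.
have c0 : 0 < `|p.1| + `|p.2| + 1 by rewrite ltr_wpDl// addr_ge0.
have [g [gL _] [h1 h2]] := closure_pair (divr_gt0 e0 c0) clq.
rewrite add0r.
have -> : dot q.2 p.1 - dot q.1 p.2 = dot (q.2 - g.2) p.1 - dot (q.1 - g.1) p.2.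
  by rewrite !dotBl (hp g gL) opprB addrA subrK.
rewrite (le_trans (ler_normB _ _))//.
rewrite (le_trans (lerD (dot_norm_le hdot _ _) (dot_norm_le hdot _ _)))//.
rewrite (le_trans (lerD (ler_wpM2r (normr_ge0 p.1) (ltW h2))
  (ler_wpM2r (normr_ge0 p.2) (ltW h1))))// -mulrDr mulrAC ler_pdivrMr//.
by rewrite ler_wpM2l ?(ltW e0)// lerDl.
Qed.

End Core.

Section Approximation.
Context {R : realType} {H : completeNormedModType R[i]}.
Variable dot : {dot H for Num.conj}.
Hypothesis hdot : hilbert_dot dot.
Variables (L : operator H) (psi : H).
Hypotheses (L_sa : self_adjoint dot L) (dpsi : forall k, dom L (iter k L psi)).

(* [v = p(L) psi], where [p] is a polynomial function of degree less than [n] *)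
Definition orbit_poly n (v : H) (p : R -> R[i]) := exists a : nat -> R[i],
  v = \sum_(k < n) a k *: iter k L psi /\
  forall c, p c = \sum_(k < n) a k * c%:C%C ^+ k.

Lemma orbit_poly_lin n a v w p q : orbit_poly n v p -> orbit_poly n w q ->
  orbit_poly n (a *: v + w) (fun c => a * p c + q c).
Proof.
move=> [b [-> bp]] [c [-> cq]]; exists (fun k => a * b k + c k); split.
  rewrite scaler_sumr -big_split/=; apply: eq_bigr => k _.
  by rewrite scalerDl scalerA.
move=> x; rewrite bp cq mulr_sumr -big_split/=; apply: eq_bigr => k _.
by rewrite mulrDl mulrA.
Qed.

Lemma orbit_polyW n m v p : (n <= m)%N -> orbit_poly n v p -> orbit_poly m v p.
Proof.
move=> nm [b [-> bp]]; exists (fun k => if (k < n)%N then b k else 0); split.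
  rewrite (big_ord_widen _ (fun k => b k *: iter k L psi) nm) big_mkcond/=.
  by apply: eq_bigr => k _; case: ifP => // _; rewrite scale0r.
move=> x; rewrite bp (big_ord_widen _ (fun k => b k * x%:C%C ^+ k) nm) big_mkcond/=.
by apply: eq_bigr => k _; case: ifP => // _; rewrite mul0r.
Qed.

Lemma orbit_poly1 n : orbit_poly n.+1 psi (fun=> 1).
Proof.
apply: (@orbit_polyW 1) => //; exists (fun=> 1); split.
  by rewrite big_ord1 scale1r.
by move=> c; rewrite big_ord1 expr0 mulr1.
Qed.

Lemma orbit_polyX n v p : orbit_poly n v p ->
  orbit_poly n.+1 (L v) (fun c => c%:C%C * p c).
Proof.
move=> [a [-> ap]]; exists (fun k => if k is j.+1 then a j else 0); split.
  have [_ ->] := op_sum (index_enum 'I_n) a (fun i => dpsi i).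
  by rewrite big_ord_recl/= scale0r add0r; apply: eq_bigr.
move=> c; rewrite ap big_ord_recl/= mul0r add0r mulr_sumr.
by apply: eq_bigr => k _; rewrite mulrCA -exprS.
Qed.

Section Quadrature.
Variables (n d : nat) (lam w : 'I_d -> R).
Hypotheses (w0 : forall i, 0 <= w i).
Hypothesis wE : forall j k, (j < n)%N -> (k < n)%N ->
  \sum_(i < d) (w i * lam i ^+ (j + k))%:C%C = dot (iter j L psi) (iter k L psi).

(** The quadrature measure turns p |-> p(L) psi into an isometry on polynomials of degree less than
    [n]: both sides are sesquilinear in the coefficients and agree on monomials. *)
Lemma quadrature_poly v v' p p' : orbit_poly n v p -> orbit_poly n v' p' ->
  \sum_(i < d) (w i)%:C%C * (p (lam i) * (p' (lam i))^*) = dot v v'.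
Proof.
move=> [a [-> ap]] [b [-> bp]]; rewrite dot_suml.
transitivity (\sum_(j < n) \sum_(k < n) \sum_(i < d)
    a j * ((b k)^* * (w i * lam i ^+ (j + k))%:C%C)).
  rewrite [RHS](eq_bigr (fun j : 'I_n => \sum_(i < d) \sum_(k < n)
      a j * ((b k)^* * (w i * lam i ^+ (j + k))%:C%C))); last first.
    by move=> j _; rewrite exchange_big.
  rewrite exchange_big/=; apply: eq_bigr => i _.
  rewrite ap bp rmorph_sum/= mulr_suml mulr_sumr; apply: eq_bigr => j _.
  rewrite mulr_sumr mulr_sumr; apply: eq_bigr => k _.
  rewrite conjM (_ : (_ ^+ k)^* = (lam i)%:C%C ^+ k); last first.
    by apply: conj_Creal; rewrite rpredX//; apply/complex_realP; exists (lam i).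
  by rewrite rmorphM rmorphXn exprD; ring.
apply: eq_bigr => j _; rewrite dotZl dot_sumr mulr_sumr; apply: eq_bigr => k _.
by rewrite dotZr -wE// !mulr_sumr.
Qed.

End Quadrature.
End Approximation.

Lemma norm_resolvent_le {R : realType} (u : R[i]) (c : R) : nonreal u ->
  `|(u - c%:C%C)^-1| <= (`|complex.Im u|^-1)%:C%C.
Proof.
case: u => a b; rewrite /nonreal/= => b0.
have -> : (a +i* b)%C - c%:C%C = ((a - c) +i* b)%C by simpc.
rewrite normfV fmorphV lef_pV2 ?posrE ?normr_gt0 ?ltcR ?normr_gt0//; last first.
  by rewrite eq_complex/= (negbTE b0) andbF.
by rewrite normc_def lecR/= -sqrtr_sqr ler_wsqrtr// lerDr sqr_ge0.
Qed.

Lemma nonreal_sub_neq0 {R : realType} (u : R[i]) (c : R) : nonreal u ->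
  u - c%:C%C != 0.
Proof.
by case: u => a b; rewrite /nonreal eq_complex/= oppr0 addr0 => /negbTE ->; rewrite andbF.
Qed.

(** The difference of the two sides is the variance of [x] under the weights [w]. *)
Lemma sqr_mean_le {K : numDomainType} d (w x : 'I_d -> K) :
  (forall i, 0 <= w i) -> (forall i, 0 <= x i) -> \sum_i w i = 1 ->
  (\sum_i w i * x i) ^+ 2 <= \sum_i w i * x i ^+ 2.
Proof.
move=> w0 x0 w1; set m := \sum_i _; rewrite -subr_ge0.
have m0 : 0 <= m by apply: sumr_ge0 => i _; rewrite mulr_ge0.
have -> : \sum_i w i * x i ^+ 2 - m ^+ 2 = \sum_i w i * (x i - m) ^+ 2.
  rewrite [RHS](eq_bigr (fun i => w i * x i ^+ 2 - m *+ 2 * (w i * x i) + m ^+ 2 * w i)).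
    rewrite big_split sumrB/= -!mulr_sumr w1 -/m; ring.
  by move=> i _; ring.
apply: sumr_ge0 => i _; rewrite mulr_ge0// real_exprn_even_ge0//.
by rewrite rpredB ?ger0_real.
Qed.

Section Approximation.
Context {R : realType} {H : completeNormedModType R[i]}.
Variable dot : {dot H for Num.conj}.
Hypothesis hdot : hilbert_dot dot.
Variables (L : operator H) (psi : H).
Hypotheses (L_sa : self_adjoint dot L) (dpsi : forall k, dom L (iter k L psi)).
Hypothesis psi1 : `|psi| = 1.
Hypothesis L_esa : essentially_self_adjoint_graph dot (orbit_restriction L psi).

(** With e(c) = 1 - (u - c) p(c), the difference is the sum of the w e / (u - lam). The kernel is at
    most 1 / |Im u|, the mean of |e| is at most its quadratic mean, and the latter is |psi - (u - L)
    v| by the isometry. The degree of [e] may exceed that of [p] by one, hence [n.+2]. *)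
Lemma quadrature_resolvent (n d : nat) (lam w : 'I_d -> R) u v p :
  (forall i, 0 <= w i) ->
  (forall j k, (j < n.+2)%N -> (k < n.+2)%N ->
  \sum_(i < d) (w i * lam i ^+ (j + k))%:C%C = dot (iter j L psi) (iter k L psi)) ->
  nonreal u -> orbit_poly L psi n.+1 v p ->
  `|\sum_i (w i)%:C%C / (u - (lam i)%:C%C) - dot v psi| <=
  (`|complex.Im u|^-1)%:C%C * `|psi - (u *: v - L v)|.
Proof.
move=> w0 wE u0 vp.
have psi_p := orbit_poly1 L psi n.+1.
have vp' := orbit_polyW (leqnSn _) vp.
have quad := quadrature_poly wE.
have wC i : 0 <= (w i)%:C%C by rewrite lecR.
have sw : \sum_i (w i)%:C%C = 1.
  have := quad _ _ _ _ psi_p psi_p; rewrite -hdot psi1 expr1n => <-.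
  by apply: eq_bigr => i _; rewrite conjC1 !mulr1.
pose e (c : R) := 1 - (u - c%:C%C) * p c.
have ep : orbit_poly L psi n.+2 (psi - (u *: v - L v)) e.
  have := orbit_poly_lin 1 (orbit_poly_lin (- u) vp' (orbit_polyX dpsi vp)) psi_p.
  have -> : 1 *: (- u *: v + L v) + psi = psi - (u *: v - L v).
    by rewrite scale1r scaleNr addrC opprB [- _ + _]addrC.
  suff -> : (fun c => 1 * (- u * p c + c%:C%C * p c) + 1) = e by [].
  by apply/funext => c; rewrite /e; ring.
rewrite -(quad _ _ _ _ vp' psi_p) -sumrB.
have -> : \sum_i ((w i)%:C%C / (u - (lam i)%:C%C) - (w i)%:C%C * (p (lam i) * 1^*)) =
    \sum_i (w i)%:C%C * (e (lam i) / (u - (lam i)%:C%C)).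
  apply: eq_bigr => i _; rewrite conjC1 mulr1 -mulrBr /e mulrBl mul1r.
  by rewrite mulrAC divff ?mul1r ?nonreal_sub_neq0.
rewrite (le_trans (ler_norm_sum _ _ _))//.
rewrite (@le_trans _ _ ((`|complex.Im u|^-1)%:C%C * \sum_i (w i)%:C%C * `|e (lam i)|))//.
  rewrite mulr_sumr; apply: ler_sum => i _.
  rewrite !normrM ger0_norm// [leRHS]mulrCA ler_wpM2l// mulrC ler_wpM2r//.
  exact: norm_resolvent_le.
rewrite ler_wpM2l//; first by rewrite lecR invr_ge0.
rewrite -(@ler_pXn2r _ 2)// ?nnegrE//; last first.
  by apply: sumr_ge0 => i _; rewrite mulr_ge0.
rewrite (le_trans (sqr_mean_le _ _ sw))// hdot -(quad _ _ _ _ ep ep).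
by apply: ler_sum => i _; rewrite normCK.
Qed.

Lemma krylov_approximation : exists (d : nat -> nat) (lam w : forall n, 'I_(d n) -> R),
  [/\ forall n i, 0 <= w n i, forall n, \sum_i w n i = 1,
      forall n, \sum_i w n i * lam n i ^+ 2 = complex.Re (`|L psi| ^+ 2)
    & forall (u : R[i]) (e : R), nonreal u -> 0 < e ->
      exists N, forall n, (N <= n)%N ->
      `|\sum_i (w n i)%:C%C / (u - (lam n i)%:C%C) - dot (resolvent L u psi) psi|
       <= e%:C%C].
Proof.
(* The number of nodes depends on [n], hence the dependent pair. Even for n = 0, [n.+2] covers the
   moment j = k = 1, which is |L psi|^2. *)
have h n : exists t : {d : nat & (('I_d -> R) * ('I_d -> R))%type},
    (forall i, 0 <= (projT2 t).2 i) /\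
    forall j k, (j < n.+2)%N -> (k < n.+2)%N ->
    \sum_(i < projT1 t) ((projT2 t).2 i * (projT2 t).1 i ^+ (j + k))%:C%C =
    dot (iter j L psi) (iter k L psi).
  have [d [lam [w hw]]] := moment_quadrature hdot L_sa dpsi n.+2.
  by exists (existT _ d (lam, w)).
have [t ht] := choice h.
exists (fun n => projT1 (t n)), (fun n => (projT2 (t n)).1), (fun n => (projT2 (t n)).2).
split.
- by move=> n i; apply: (ht n).1.
- move=> n; apply: complexI; have := (ht n).2 0%N 0%N isT isT.
  rewrite -hdot psi1 expr1n rmorph1 => <-; rewrite rmorph_sum.
  by apply: eq_bigr => i _; rewrite expr0 mulr1.
- move=> n; apply: complexI; have := (ht n).2 1%N 1%N isT isT.
  rewrite -hdot RRe_real ?ger0_real ?exprn_ge0// => <-.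
  by rewrite rmorph_sum; apply: eq_bigr.
move=> u e u0 e0.
have [dr rE] := resolventP hdot L_sa psi u0.
set r := resolvent L u psi in dr rE *.
set b := `|complex.Im u|^-1.
have b0 : 0 < b by rewrite invr_gt0 normr_gt0.
(* If [v] is within delta of the resolvent vector in graph norm, the quadrature error is at most b
   (|u| + 1) delta and replacing [v] by that vector costs another delta. *)
have c0 : 0 < b%:C%C * (`|u| + 1) + 1 
  by rewrite ltr_wpDl// mulr_ge0// ?addr_ge0// ler0c ltW.
have e0' : 0 < e%:C%C by rewrite ltcR.
have [[v w'] [[/= dv ->] [m [a /= vE]]] [h1 h2]] :=
  closure_pair (divr_gt0 e0' c0) (orbit_core hdot L_sa L_esa (conj dr erefl : graph L (r, L r))).
have vp : orbit_poly L psi m v (fun c => \sum_(k < m) a k * c%:C%C ^+ k) by exists a.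
exists m => n mn.
have := quadrature_resolvent (ht n).1 (ht n).2 u0 (orbit_polyW (leqW mn) vp).
rewrite -/b => h3; rewrite -(subrKA (dot v psi)).
rewrite (le_trans (ler_normD _ _))//.
rewrite (le_trans (lerD h3 (lexx _)))// -dotBl.
rewrite (le_trans (lerD (lexx _) (dot_norm_le hdot _ _)))// psi1 mulr1.
have -> : psi - (u *: v - L v) = u *: (r - v) - (L r - L v).
  by rewrite -[X in X - _]rE scalerBr !opprD !opprK addrACA.
have h4 : `|u *: (r - v) - (L r - L v)| <= (`|u| + 1) * (e%:C%C / (b%:C%C * (`|u| + 1) + 1)).
  rewrite (le_trans (ler_normB _ _))// normrZ mulrDl mul1r.
  exact: lerD (ler_wpM2l (normr_ge0 u) (ltW h1)) (ltW h2).
have h5 : `|v - r| <= e%:C%C / (b%:C%C * (`|u| + 1) + 1) by rewrite distrC ltW.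
rewrite (le_trans (lerD (ler_wpM2l _ h4) h5)) ?lecR ?(ltW b0)//.
rewrite mulrA -[X in _ + X]mul1r -mulrDl mulrC divfK// gt_eqF//.
Qed.

End Approximation.

(** * Exponentials of Cauchy transforms *)

Section CauchyKernel.
Context {R : realType}.
Implicit Types (u : R[i]) (c : R).
Local Notation mu := (@lebesgue_measure R).

Definition kre u c : R := complex.Re (u - c%:C%C)^-1.
Definition kim u c : R := complex.Im (u - c%:C%C)^-1.

Lemma kreE x y c : kre (x +i* y)%C c = (x - c) / ((x - c) ^+ 2 + y ^+ 2).
Proof. by rewrite /kre/= oppr0 addr0. Qed.

Lemma kimE x y c : kim (x +i* y)%C c = - y / ((x - c) ^+ 2 + y ^+ 2).
Proof. by rewrite /kim/= oppr0 addr0 mulNr. Qed.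

Lemma kden_gt0 (x y c : R) : y != 0 -> 0 < (x - c) ^+ 2 + y ^+ 2.
Proof. by move=> y0; rewrite ltr_wpDl ?sqr_ge0// exprn_even_gt0. Qed.

Lemma normc_ge_Im (z : R[i]) : `|complex.Im z|%:C%C <= `|z|.
Proof. by case: z => a b; rewrite normc_def lecR/= -sqrtr_sqr ler_wsqrtr// lerDr sqr_ge0. Qed.

Lemma norm_kre u c : nonreal u -> `|kre u c| <= `|complex.Im u|^-1.
Proof.
by move=> u0; rewrite -lecR (le_trans (normc_ge_Re _))// norm_resolvent_le.
Qed.

Lemma norm_kim u c : nonreal u -> `|kim u c| <= `|complex.Im u|^-1.
Proof.
by move=> u0; rewrite -lecR (le_trans (normc_ge_Im _))// norm_resolvent_le.
Qed.

Lemma continuous_kden (x y : R) : continuous (fun c : R => (x - c) ^+ 2 + y ^+ 2).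
Proof.
move=> c; apply: cvgD; last exact: cvg_cst.
by under eq_fun do rewrite expr2; apply: cvgM; apply: cvgB => //; apply: cvg_cst.
Qed.

Lemma continuous_kre u : nonreal u -> continuous (kre u).
Proof.
case: u => x y y0.
have -> : kre (x +i* y)%C = (fun c => (x - c) / ((x - c) ^+ 2 + y ^+ 2)).
  by apply/funext => c; rewrite kreE.
move=> c; apply: cvgM; first by apply: cvgB => //; apply: cvg_cst.
by apply: cvgV; [rewrite gt_eqF// kden_gt0|exact: continuous_kden].
Qed.

Lemma continuous_kim u : nonreal u -> continuous (kim u).
Proof.
case: u => x y y0.
have -> : kim (x +i* y)%C = (fun c => - y / ((x - c) ^+ 2 + y ^+ 2)).
  by apply/funext => c; rewrite kimE.
move=> c; apply: cvgM; first exact: cvg_cst.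
by apply: cvgV; [rewrite gt_eqF// kden_gt0|exact: continuous_kden].
Qed.

Lemma measurable_kre u : nonreal u -> measurable_fun setT (kre u).
Proof. by move=> u0; apply: continuous_measurable_fun; apply: continuous_kre. Qed.

Lemma measurable_kim u : nonreal u -> measurable_fun setT (kim u).
Proof. by move=> u0; apply: continuous_measurable_fun; apply: continuous_kim. Qed.

Lemma bounded_kre u (A : set R) : nonreal u -> [bounded kre u c | c in A].
Proof.
move=> u0; exists (`|complex.Im u|^-1); split; first exact: num_real.
by move=> M MB c _; rewrite /= (le_trans (norm_kre _ u0))// ltW.
Qed.

Lemma bounded_kim u (A : set R) : nonreal u -> [bounded kim u c | c in A].
Proof.
move=> u0; exists (`|complex.Im u|^-1); split; first exact: num_real.
by move=> M MB c _; rewrite /= (le_trans (norm_kim _ u0))// ltW.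
Qed.

Definition cauchy (nu : {measure set (measurableTypeR R) -> \bar R}) (xi : R -> R) u :=
  Cintegral nu (fun c => (xi c)%:C%C / (u - c%:C%C)).

Variable nu : {measure set (measurableTypeR R) -> \bar R}.

Lemma cauchyE xi u : cauchy nu xi u =
  ((\int[nu]_c (xi c * kre u c)) +i* (\int[nu]_c (xi c * kim u c)))%C.
Proof.
rewrite /cauchy /Cintegral; congr (_ +i* _)%C; apply: eq_Rintegral => c _.
  by rewrite /kre; case: (_^-1) => a b /=; rewrite mul0r subr0.
by rewrite /kim; case: (_^-1) => a b /=; rewrite mul0r addr0.
Qed.

Section Integrable.
Variables (xi : R -> R) (u : R[i]).
Hypotheses (ixi : nu.-integrable setT (EFin \o xi)) (u0 : nonreal u).

Lemma integrable_kre : nu.-integrable setT (EFin \o (fun c => xi c * kre u c)).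
Proof.
exact: (integrableMl measurableT ixi (measurable_kre u0) (bounded_kre _ u0)).
Qed.

Lemma integrable_kim : nu.-integrable setT (EFin \o (fun c => xi c * kim u c)).
Proof.
exact: (integrableMl measurableT ixi (measurable_kim u0) (bounded_kim _ u0)).
Qed.

End Integrable.

Lemma cauchyD xi1 xi2 u : nu.-integrable setT (EFin \o xi1) ->
  nu.-integrable setT (EFin \o xi2) -> nonreal u ->
  cauchy nu (fun c => xi1 c + xi2 c) u = cauchy nu xi1 u + cauchy nu xi2 u.
Proof.
move=> i1 i2 u0; rewrite !cauchyE.
under eq_Rintegral do rewrite mulrDl.
under [X in (_ +i* X)%C = _]eq_Rintegral do rewrite mulrDl.
by rewrite !RintegralD//; [exact: integrable_kim|exact: integrable_kim|
  exact: integrable_kre|exact: integrable_kre].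
Qed.

Lemma cauchyB xi1 xi2 u : nu.-integrable setT (EFin \o xi1) ->
  nu.-integrable setT (EFin \o xi2) -> nonreal u ->
  cauchy nu (fun c => xi1 c - xi2 c) u = cauchy nu xi1 u - cauchy nu xi2 u.
Proof.
move=> i1 i2 u0; rewrite !cauchyE.
under eq_Rintegral do rewrite mulrBl.
under [X in (_ +i* X)%C = _]eq_Rintegral do rewrite mulrBl.
by rewrite !RintegralB//; [exact: integrable_kim|exact: integrable_kim|
  exact: integrable_kre|exact: integrable_kre].
Qed.

End CauchyKernel.

Section ExpC.
Context {R : realType}.
Implicit Types z w : R[i].

Lemma expCD z w : expC (z + w) = expC z * expC w.
Proof.
case: z w => a b [c d]; rewrite /expC/= expRD sinD cosD.
apply/eqP; rewrite eq_complex/=; apply/andP; split; apply/eqP; ring.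
Qed.

Lemma expC0 : expC (0 : R[i]) = 1.
Proof. by rewrite /expC/= expR0 cos0 sin0 mul1r. Qed.

Lemma expC_neq0 z : expC z != 0.
Proof.
apply/negP => /eqP z0; have := expCD z (- z).
by rewrite subrr expC0 z0 mul0r => /eqP; rewrite oner_eq0.
Qed.

Lemma expCN z : expC (- z) = (expC z)^-1.
Proof.
apply: (mulfI (expC_neq0 z)); rewrite -expCD subrr expC0 divff//.
exact: expC_neq0.
Qed.

Lemma norm_expC z : `|expC z| = (expR (complex.Re z))%:C%C.
Proof.
case: z => a b; rewrite /expC/= normrM normc_def/= expr0n/= addr0 sqrtr_sqr.
rewrite (ger0_norm (expR_ge0 _)) normc_def/= cos2Dsin2 sqrtr1.
by rewrite -rmorphM mulr1.
Qed.

End ExpC.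

Section Step.
Context {R : realType}.
Implicit Types (u : R[i]) (a b c : R).
Local Notation mu := (@lebesgue_measure R).

(** [ln_prim] + i [atan_prim] is - log (u - c) up to a constant depending on the sign of [y]; the
    arctangent of (x - c) / y is smooth on the whole line. *)
Let ln_prim (x y c : R) : R := - 2^-1 * ln ((x - c) ^+ 2 + y ^+ 2).
Let atan_prim (x y c : R) : R := atan ((x - c) / y).

Lemma is_derive_kre_prim (x y c : R) : y != 0 ->
  is_derive c 1 (ln_prim x y) (kre (x +i* y)%C c).
Proof.
move=> y0; have d0 := kden_gt0 x c y0.
have h1 : is_derive c 1 (fun c => (x - c) ^+ 2 + y ^+ 2) (- 2 * (x - c)).
  have -> : (fun c => (x - c) ^+ 2 + y ^+ 2) = (cst x - id) ^+ 2 + cst (y ^+ 2).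
    by apply/funext.
  apply: is_derive_eq.
  rewrite addr0; transitivity (2 * (x - c) ^+ 1 * (0 - 1)); [by []|by ring].
have h2 := is_derive1_ln d0.
have h3 := @is_derive1_comp R (@ln R) (fun c => (x - c) ^+ 2 + y ^+ 2) c _ _ h2 h1.
have -> : ln_prim x y = (- 2^-1) *: (@ln R \o (fun c => (x - c) ^+ 2 + y ^+ 2)).
  by apply/funext.
apply: is_derive_eq; rewrite kreE /GRing.scale/=.
by field; rewrite gt_eqF.
Qed.

Lemma is_derive_kim_prim (x y c : R) : y != 0 ->
  is_derive c 1 (atan_prim x y) (kim (x +i* y)%C c).
Proof.
move=> y0; have d0 := kden_gt0 x c y0.
have h1 : is_derive c 1 (fun c => (x - c) / y) (- y^-1).
  have -> : (fun c => (x - c) / y) = y^-1 *: (cst x - id).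
    by apply/funext => z; rewrite mulrC.
  by apply: is_derive_eq; rewrite /GRing.scale/=; ring.
have h2 := is_derive1_atan ((x - c) / y).
have h3 := @is_derive1_comp R (@atan R) (fun c => (x - c) / y) c _ _ h2 h1.
apply: is_derive_eq; rewrite kimE.
have d1 : 1 + ((x - c) / y) ^+ 2 != 0 by rewrite gt_eqF// ltr_pwDl// sqr_ge0.
have -> : (x - c) ^+ 2 + y ^+ 2 = (1 + ((x - c) / y) ^+ 2) * y ^+ 2 by field.
by field; rewrite y0 addrC gt_eqF.
Qed.

Lemma Rintegral_FTC (F k : R -> R) a b : a < b -> continuous k ->
  (forall c, is_derive c 1 F (k c)) -> \int[mu]_(c in `[a, b]) k c = F b - F a.
Proof.
move=> ab ck dF; rewrite /Rintegral (@continuous_FTC2 _ k F)//.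
- by apply: continuous_subspaceT.
- have cF : continuous F.
    by move=> c; apply/differentiable_continuous/derivable1_diffP; case: (dF c).
  split => //.
  + by apply: cvg_at_right_filter; exact: cF.
  + by apply: cvg_at_left_filter; exact: cF.
- by move=> c _; rewrite derive1E; case: (dF c).
Qed.

(** For b < a this is minus the indicator of [b, a[. Both orders occur, since the last step of a
    spectral shift runs from the largest atom to 0. *)
Definition step a b c : R := (a <= c)%R%:R - (b <= c)%R%:R.

Lemma stepN a b c : step b a c = - step a b c.
Proof. by rewrite /step opprB. Qed.

Lemma step_indic a b : a <= b -> step a b = \1_`[a, b[.
Proof.
move=> ab; apply/funext => c; rewrite /step indicE (_ : (c \in _) = (a <= c < b)).
  2: by apply/idP/idP; rewrite inE/= in_itv.
have [ac|ca] := leP a c; last by rewrite leNgt (lt_le_trans ca ab)/= subrr.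
by case: (ltP c b); rewrite ?subr0 ?subrr.
Qed.

Lemma integrable_step a b : mu.-integrable setT (EFin \o step a b).
Proof.
wlog ab : a b / a <= b.
  move=> h; have [|/ltW ba] := leP a b; first exact: h.
  have -> : EFin \o step a b = (\- (EFin \o step b a))%E.
    by apply/funext => c /=; rewrite stepN.
  by apply: integrableN; exact: h.
rewrite step_indic//; exact: integrable_indic_itv.
Qed.

Lemma Rintegral_step (F k : R -> R) a b : continuous k ->
  (forall c, is_derive c 1 F (k c)) -> \int[mu]_c (step a b c * k c) = F b - F a.
Proof.
move=> ck dF.
have ik a' b' : mu.-integrable `[a', b'] (EFin \o k).
  apply: continuous_compact_integrable; first exact: segment_compact.
  exact: continuous_subspaceT.
have hle a' b' : a' <= b' -> \int[mu]_c (step a' b' c * k c) = F b' - F a'.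
  move=> ab; transitivity (\int[mu]_c (k \_ `[a', b'[) c).
    apply: eq_Rintegral => c _; rewrite step_indic// patchE indicE.
    by case: (_ \in _); rewrite ?mul1r ?mul0r.
  rewrite -Rintegral_mkcond Rintegral_itv_bndo_bndc; last first.
    by apply: integrableS (ik a' b') => //; exact: subset_itv_co_cc.
  have [->|ab'] := eqVneq a' b'; first by rewrite set_itv1 Rintegral_set1 subrr.
  by apply: Rintegral_FTC => //; rewrite lt_neqAle ab'.
have [/hle//|/ltW ba] := leP a b.
rewrite -[RHS]opprB -(hle _ _ ba) -mulN1r -RintegralZl//.
  by apply: eq_Rintegral => c _; rewrite stepN mulNr mulN1r.
have -> : EFin \o (fun c => step b a c * k c) = EFin \o (k \_ `[b, a[).
  apply/funext => c; rewrite /= step_indic// patchE indicE.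
  by case: (_ \in _); rewrite ?mul1r ?mul0r.
rewrite -restrict_EFin -integrable_mkcond//.
by apply: integrableS (ik b a) => //; exact: subset_itv_co_cc.
Qed.

Lemma expC_step a b u : nonreal u ->
  expC (- cauchy mu (step a b) u) = (u - b%:C%C) / (u - a%:C%C).
Proof.
move=> u0; case: u u0 => x y; rewrite /nonreal/= => y0.
have u0 : nonreal (x +i* y)%C by [].
rewrite cauchyE (Rintegral_step _ _ (continuous_kre u0)
  (fun c => is_derive_kre_prim x c y0)).
rewrite (Rintegral_step _ _ (continuous_kim u0) (fun c => is_derive_kim_prim x c y0)).
pose E c := expC (- (ln_prim x y c +i* atan_prim x y c)%C).
(* This is the exponential of log (u - c) up to the constant of integration: the factor -i sgn y
   cancels in [E b / E a]. *)
have EE c : E c = (Num.sg y)%:C%C * - 'i%C * ((x +i* y)%C - c%:C%C).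
  have d0 := kden_gt0 x c y0; set t := (x - c) / y.
  have dE : (x - c) ^+ 2 + y ^+ 2 = y ^+ 2 * (1 + t ^+ 2) by rewrite /t; field.
  have q0 : 0 < 1 + t ^+ 2 by rewrite ltr_pwDl// sqr_ge0.
  have eA : expR (- ln_prim x y c) = `|y| * Num.sqrt (1 + t ^+ 2).
    rewrite -[RHS]ger0_norm ?mulr_ge0// -sqrtr_sqr exprMn sqr_sqrtr ?(ltW q0)// real_normK ?num_real// -dE.
    rewrite -[LHS](ger0_norm (expR_ge0 _)) -sqrtr_sqr -expRM_natl /ln_prim.
    rewrite (_ : 2 * - _ = ln ((x - c) ^+ 2 + y ^+ 2)) ?lnK ?posrE//.
    by field.
  have s0 : Num.sqrt (1 + t ^+ 2) != 0 by rewrite gt_eqF// sqrtr_gt0.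
  have sB : sin (atan t) = t * cos (atan t).
    by rewrite -{2}(atanK t) /tan divfK// cos_atan invr_eq0.
  rewrite /E /expC/= cosN sinN eA /atan_prim -/t sB cos_atan.
  have sgy : Num.sg y * y = `|y| by rewrite normrEsg.
  apply/eqP; rewrite eq_complex/=; apply/andP; split; apply/eqP.
    by rewrite !(mul0r, mulr0, subr0, sub0r, add0r, addr0, oppr0, mulrN, mulNr, mul1r, mulr1, opprK) mulfK// -sgy.
  rewrite !(mul0r, mulr0, subr0, sub0r, add0r, addr0, oppr0, mulrN, mulNr, mul1r, mulr1, opprK).
  by rewrite -sgy /t; field; rewrite y0 andbT; exact: s0.
have E0 c : E c != 0 by exact: expC_neq0.
transitivity (E b / E a).
  rewrite /E -expCN -expCD opprK; congr expC.
  by apply/eqP; rewrite eq_complex/=; apply/andP; split; apply/eqP; ring.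
have := E0 a; rewrite !EE; set z := (Num.sg y)%:C%C * _ => za.
have z0 : z != 0 by apply: contraNneq za => ->; rewrite mul0r.
by rewrite invfM mulrACA divff// mul1r.
Qed.

End Step.

(** * Finitely supported measures *)

Lemma bigD1_seq_cond {K : comNzRingType} {I : eqType} (r : seq I) (P : pred I)
    (F : I -> K) j : j \in r -> uniq r -> P j ->
  \prod_(i <- r | P i) F i = F j * \prod_(i <- r | P i && (i != j)) F i.
Proof.
move=> jr ur Pj; rewrite big_mkcond/= (bigD1_seq j)//= Pj -big_mkcondr.
by congr (_ * _); apply: eq_bigl => i; rewrite andbC.
Qed.

(* The ring morphism [f] makes the identity cover both real moments and sums
   of complex numbers. *)
Lemma merge_atoms {R : realType} d (lam w : 'I_d -> R) :
  (forall i, 0 <= w i) -> exists (s : seq R) (W : R -> R),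
  [/\ sorted <%R s, forall x, x \in s -> 0 < W x &
    forall (K : nzRingType) (f : {rmorphism R -> K}) (phi : R -> K),
    \sum_i f (w i) * phi (lam i) = \sum_(x <- s) f (W x) * phi x].
Proof.
move=> w0; pose W x := \sum_(i | lam i == x) w i.
(* Nodes of weight zero are dropped, because interlacing needs strictly positive weights. *)
pose s := sort <=%R (undup [seq lam i | i <- enum 'I_d & 0 < w i]).
have sP x : x \in s = has (fun i => (lam i == x) && (0 < w i)) (enum 'I_d).
  rewrite mem_sort mem_undup; apply/mapP/hasP.
    by move=> [j + ->]; rewrite mem_filter => /andP[wj je]; exists j; rewrite // eqxx.
  by move=> [i ie /andP[/eqP <- wi]]; exists i; rewrite // mem_filter wi.
have us : uniq s by rewrite sort_uniq undup_uniq.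
exists s, W; split.
- by rewrite lt_sorted_uniq_le us/=; apply: sort_sorted; exact: le_total.
- move=> x; rewrite sP => /hasP[i _ /andP[lx wi]].
  by rewrite /W (bigD1 i)//= ltr_pwDl// sumr_ge0.
move=> K f phi.
transitivity (\sum_(x <- s) \sum_(i | lam i == x) f (w i) * phi (lam i)); last first.
  apply: eq_bigr => x _; rewrite /W rmorph_sum mulr_suml.
  by apply: eq_bigr => i /eqP ->.
under [RHS]eq_bigr do rewrite big_mkcond/=.
rewrite exchange_big/=; apply: eq_bigr => i _.
have [ls|ls] := boolP (lam i \in s).
  rewrite (bigD1_seq (lam i))//= eqxx big1 ?addr0// => x.
  by rewrite eq_sym => /negbTE ->.
rewrite big1_seq ?addr0.
  have : w i = 0.
    apply/eqP; rewrite eq_le w0 andbT leNgt; apply: contra ls => wi.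
    by rewrite sP; apply/hasP; exists i; rewrite ?mem_enum// eqxx wi.
  by move=> ->; rewrite rmorph0 mul0r.
move=> x /andP[_ xs]; case: eqP => // lx; rewrite -lx in xs.
by rewrite xs in ls.
Qed.

(** * Interlacing of zeros and poles *)

Section Interlacing.
Context {R : realType}.
Variables (s : seq R) (W : R -> R) (m : nat).
Hypotheses (ss : sorted <%R s) (sm : size s = m.+1).
Hypothesis W0 : forall x, x \in s -> 0 < W x.
Hypothesis W1 : \sum_(x <- s) W x = 1.
Let x_ i := nth 0 s i.

Let us : uniq s.
Proof. by move: ss; rewrite lt_sorted_uniq_le => /andP[]. Qed.

Let x_lt i j : (i < j)%N -> (j < m.+1)%N -> x_ i < x_ j.
Proof.
move=> ij jm; rewrite /x_ lt_sorted_ltn_nth// inE sm//.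
exact: ltn_trans jm.
Qed.

(* The sum [\sum_x W x / (u - x)] is [num] over [\prod_x (u - x)]. *)
Let num : {poly R} := \sum_(x <- s) W x *: \prod_(y <- s | y != x) ('X - y%:P).

Let size_prod x : x \in s ->
  size (\prod_(y <- s | y != x) ('X - y%:P)) = m.+1.
Proof.
move=> xs; rewrite -big_filter size_prod_XsubC -rem_filter// size_rem// sm.
by [].
Qed.

Let num_at i : (i < m.+1)%N ->
  num.[x_ i] = W (x_ i) * \prod_(y <- s | y != x_ i) (x_ i - y).
Proof.
move=> im; have xs : x_ i \in s by rewrite mem_nth ?sm.
rewrite /num horner_sum (bigD1_seq (x_ i))//= [X in _ + X]big1_seq ?addr0.
  rewrite hornerZ horner_prod; congr (_ * _).
  by apply: eq_bigr => y _; rewrite hornerXsubC.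
move=> x /andP[xxi xs']; rewrite hornerZ horner_prod (@bigD1_seq_cond _ _ _ _ _ (x_ i))//=.
  by rewrite hornerXsubC subrr !(mul0r, mulr0).
by rewrite eq_sym.
Qed.

(** At an atom a single summand of [num] survives. Two consecutive atoms lie on the same side of
    every other atom, so the sign comes only from their difference, which enters once with each
    sign. *)
Let num_sign i : (i < m)%N -> num.[x_ i] * num.[x_ i.+1] < 0.
Proof.
move=> im; have im1 : (i < m.+1)%N by exact: ltnW.
have xs : x_ i \in s by rewrite mem_nth ?sm.
have xs1 : x_ i.+1 \in s by rewrite mem_nth ?sm.
have xlt := x_lt (ltnSn i) im.
rewrite !num_at// (@bigD1_seq_cond _ _ _ _ _ (x_ i.+1))//= ?gt_eqF//.
rewrite [X in _ * (_ * X)](@bigD1_seq_cond _ _ _ _ _ (x_ i))//= ?lt_eqF//.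
rewrite [X in _ * (_ * (_ * X))](eq_bigl (fun y => (y != x_ i) && (y != x_ i.+1))); last first.
  by move=> y; rewrite andbC.
set A := \prod_(y <- s | _) (x_ i - y); set B := \prod_(y <- s | _) (x_ i.+1 - y).
have AB : 0 < A * B.
  rewrite /A /B -big_split/= big_seq_cond; apply: prodr_gt0 => y.
  move=> /andP[ys /andP[yi yi1]].
  have [j jm yE] : exists2 j, (j < m.+1)%N & y = x_ j.
    by exists (index y s); [rewrite -sm index_mem|rewrite /x_ nth_index].
  have [ji|ij|ij] := ltngtP j i.
  - by rewrite mulr_gt0// subr_gt0 yE; apply: x_lt => //; exact: ltnW.
  - have ij1 : (i.+1 < j)%N.
      rewrite ltn_neqAle ij andbT; apply: contra yi1 => /eqP ->.
      by rewrite yE.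
    by rewrite nmulr_rgt0 ?subr_lt0 yE; apply: x_lt.
  - by rewrite yE ij eqxx in yi.
rewrite (_ : _ * _ = - ((W (x_ i) * W (x_ i.+1)) * (A * B) * (x_ i.+1 - x_ i) ^+ 2)).
  rewrite oppr_lt0; apply: mulr_gt0; last by rewrite exprn_gt0// subr_gt0.
  by apply: mulr_gt0 => //; apply: mulr_gt0; apply: W0.
by rewrite expr2; ring.
Qed.

Let num_monic : num \is monic /\ size num = m.+1.
Proof.
have c1 : num`_m = 1.
  rewrite /num coef_sum -W1 big_seq [RHS]big_seq; apply: eq_bigr => x xs.
  rewrite coefZ; have := monic_prod_XsubC s (fun y => y != x) id.
  by move=> /monicP; rewrite lead_coefE size_prod// => ->; rewrite mulr1.
have sz : (size num <= m.+1)%N.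
  rewrite /num big_seq; apply: (big_ind (fun p : {poly R} => (size p <= m.+1)%N)).
  - by rewrite size_poly0.
  - by move=> p q hp hq; rewrite (leq_trans (size_polyD _ _))// geq_max hp.
  - move=> x xs; rewrite (leq_trans (size_scale_leq _ _))// size_prod//.
have sE : size num = m.+1.
  apply/eqP; rewrite eqn_leq sz ltnNge; apply/negP => h.
  by have := c1; rewrite nth_default// => /esym/eqP; rewrite oner_eq0.
by split => //; apply/monicP; rewrite lead_coefE sE.
Qed.

(** Total mass 1 makes [num] monic of degree [m]. The sign changes put a root in each of the [m]
    gaps, so these are all its roots and [num] splits. *)
Lemma interlacing : exists mu_ : nat -> R,
  (forall i, (i < m)%N -> x_ i < mu_ i < x_ i.+1) /\
  forall u : R[i], nonreal u ->
  \sum_(x <- s) (W x)%:C%C / (u - x%:C%C) =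
  (u - (x_ m)%:C%C)^-1 *
  \prod_(i < m) ((u - (mu_ i)%:C%C) / (u - (x_ i)%:C%C)).
Proof.
have h i : exists y, (i < m)%N -> (x_ i < y < x_ i.+1) /\ root num y.
  have [im|] := ltnP i m; last by exists 0.
  have [y] := poly_ivtoo (ltW (x_lt (ltnSn i) im)) (num_sign im).
  by rewrite in_itv => /= yi ry; exists y.
have [mu_ hmu] := choice h; exists mu_; split.
  by move=> i /hmu[].
have mu_lt i j : (i < j)%N -> (j < m)%N -> mu_ i < mu_ j.
  move=> ij jm; have [/andP[_ h1] _] := hmu i (ltn_trans ij jm).
  have [/andP[h2 _] _] := hmu j jm.
  rewrite (lt_trans h1)// (le_lt_trans _ h2)//.
  by move: ij; rewrite leq_eqVlt => /orP[/eqP ->//|ij]; rewrite ltW// x_lt// ltnW.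
have [nm ns] := num_monic.
have numE : num = \prod_(y <- [seq mu_ i | i <- iota 0 m]) ('X - y%:P).
  rewrite -[RHS]scale1r -(monicP nm); apply: all_roots_prod_XsubC.
  - by rewrite size_map size_iota.
  - by apply/allP => _ /mapP[j + ->]; rewrite mem_iota/= add0n => /hmu[].
  - rewrite uniq_rootsE map_inj_in_uniq ?iota_uniq// => i j.
    rewrite !mem_iota/= !add0n => im jm ij.
    by have [/mu_lt/(_ jm)|/mu_lt/(_ im)|//] := ltngtP i j; rewrite ij ltxx.
move=> u u0.
have uE x := nonreal_sub_neq0 x u0.
have := congr1 (fun p => (map_poly (real_complex R) p).[u]) numE.
have evalX y : (map_poly (real_complex R) ('X - y%:P)).[u] = u - y%:C%C.
  by rewrite rmorphB/= map_polyX map_polyC hornerXsubC.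
pose Q := \prod_(y <- s) (u - y%:C%C).
have QE : Q = (\prod_(i < m) (u - (x_ i)%:C%C)) * (u - (x_ m)%:C%C).
  by rewrite /Q (big_nth 0) sm big_mkord big_ord_recr.
have Q0 : Q != 0 by rewrite /Q prodf_seq_neq0; apply/allP => y _; rewrite uE.
have -> : (map_poly (real_complex R) num).[u] =
    (\sum_(x <- s) (W x)%:C%C / (u - x%:C%C)) * Q.
  rewrite /num rmorph_sum/= horner_sum mulr_suml big_seq [RHS]big_seq.
  apply: eq_bigr => x xs; rewrite map_polyZ hornerZ rmorph_prod/= horner_prod.
  rewrite /Q (bigD1_seq x)//= -mulrA mulKf//; congr (_ * _).
  by apply: eq_bigr => y _; rewrite evalX.
move=> /(canRL (mulfK Q0)) ->.
rewrite rmorph_prod/= horner_prod big_map -[X in iota 0 X]subn0 big_mkord.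
rewrite big_split/= prodfV QE invfM [RHS]mulrCA [X in _ = _ * X]mulrC; congr (_ * _).
by apply: eq_bigr => i _; rewrite evalX.
Qed.

End Interlacing.

Section StepSum.
Context {R : realType}.
Local Notation mu := (@lebesgue_measure R).

Lemma expC_step_sum (a b : nat -> R) n :
  mu.-integrable setT (EFin \o (fun c => \sum_(i < n) step (a i) (b i) c)) /\
  forall u, nonreal u ->
  expC (- cauchy mu (fun c => \sum_(i < n) step (a i) (b i) c) u) =
  \prod_(i < n) ((u - (b i)%:C%C) / (u - (a i)%:C%C)).
Proof.
elim: n => [|n [ih1 ih2]].
  have -> : (fun c => \sum_(i < 0) step (a i) (b i) c) = cst 0.
    by apply/funext => c; rewrite big_ord0.
  split; first exact: integrable0.
  move=> u u0; rewrite big_ord0 cauchyE.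
  under eq_Rintegral do rewrite mul0r.
  under [X in (_ +i* X)%C]eq_Rintegral do rewrite mul0r.
  rewrite Rintegral_cst// mul0r (_ : - _ = 0) ?expC0//.
  by apply/eqP; rewrite eq_complex/= oppr0 eqxx.
have -> : (fun c => \sum_(i < n.+1) step (a i) (b i) c) =
    (fun c => \sum_(i < n) step (a i) (b i) c + step (a n) (b n) c).
  by apply/funext => c; rewrite big_ord_recr.
split.
  by apply: eq_integrable (integrableD measurableT ih1 (integrable_step (a n) (b n))).
move=> u u0; rewrite cauchyD//; last exact: integrable_step.
by rewrite opprD expCD ih2// expC_step// big_ord_recr.
Qed.

(** By interlacing the intervals [x i, mu_ i[ and [x m, +oo[ are disjoint, and the sum is the
    indicator of their union. *)
Lemma interlacing_step_bounds (x mu_ : nat -> R) m (c : R) :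
  (forall i, (i < m)%N -> x i < mu_ i < x i.+1) ->
  0 <= (x m <= c)%R%:R + \sum_(i < m) step (x i) (mu_ i) c <= 1.
Proof.
move=> h.
have x_le k : (k <= m)%N -> forall i, (i < k)%N -> mu_ i < x k.
  elim: k => [|k ih] km i //; rewrite ltnS leq_eqVlt => /orP[/eqP ->|ik].
    by have /andP[] := h k km.
  have /andP[h1 h2] := h k km.
  by rewrite (lt_trans (ih (ltnW km) i ik))// (lt_trans h1).
have x_1 k : (k <= m)%N -> x k <= c -> \sum_(i < k) step (x i) (mu_ i) c = 0.
  move=> km xc; rewrite big1// => i _; rewrite /step.
  have mc : mu_ i <= c by rewrite (le_trans _ xc)// ltW// x_le.
  have /andP[h1 _] := h i (leq_trans (ltn_ord i) km).
  by rewrite mc (le_trans (ltW h1) mc) subrr.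
elim: m h x_le x_1 => [|m ih] h x_le x_1.
  by rewrite big_ord0 addr0; case: (x 0%N <= c); rewrite ?lexx ?ler01.
have /andP[h1 h2] := h m (ltnSn m).
have [mc|cm] := leP (mu_ m) c; last first.
  have -> : (x m.+1 <= c) = false.
    by apply/negbTE; rewrite -ltNge (lt_trans cm).
  rewrite add0r big_ord_recr/= /step (leNgt (mu_ m)) cm subr0 addrC.
  apply: ih => [i im|k km|k km]; first by apply: h; exact: ltnW.
    by apply: x_le; exact: ltnW.
  by apply: x_1; exact: ltnW.
rewrite big_ord_recr/= x_1// ?(le_trans (ltW h1))// /step mc (le_trans (ltW h1) mc).
by rewrite add0r subrr addr0; case: (_ <= c); rewrite ?lexx ?ler01.
Qed.

Lemma log_representation (s : seq R) (W : R -> R) :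
  sorted <%R s -> (forall x, x \in s -> 0 < W x) -> \sum_(x <- s) W x = 1 ->
  exists xi : R -> R,
  [/\ mu.-integrable setT (EFin \o xi),
      forall c, 0 <= xi c + \1_`[0, +oo[ c <= 1
    & forall u, nonreal u -> \sum_(x <- s) (W x)%:C%C / (u - x%:C%C) =
        u^-1 * expC (- cauchy mu xi u)].
Proof.
move=> ss W0 W1; have [m sm] : exists m, size s = m.+1.
  case: s W1 {ss W0} => [|x s'] W1; last by exists (size s').
  by move: W1; rewrite big_nil => /eqP; rewrite eq_sym oner_eq0.
have [mu_ [h1 h2]] := interlacing ss sm W0 W1.
pose x i := nth 0 s i.
(* The factor u / (u - x m) is treated as one more step, from [x m] to 0; its second half is the
   indicator of [0, +oo[ that shifts [xi]. *)
pose b i := if (i < m)%N then mu_ i else 0.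
have bm : b m = 0 by rewrite /b ltnn.
have bi (i : 'I_m) : b i = mu_ i by rewrite /b ltn_ord.
have [i1 i2] := expC_step_sum x b m.+1.
exists (fun c => \sum_(i < m.+1) step (x i) (b i) c); split => //.
  move=> c; have := @interlacing_step_bounds x mu_ m c h1.
  rewrite big_ord_recr/= bm [X in _ -> _ <= _ + X <= _]indicE.
  rewrite (_ : (c \in _) = (0 <= c)); last first.
    by apply/idP/idP; rewrite inE/= in_itv/= andbT.
  under [X in _ -> _ <= X + _ + _ <= _]eq_bigr do rewrite bi.
  by rewrite [X in _ -> _ <= X <= _](_ : _ =
    (x m <= c)%R%:R + \sum_(i < m) step (x i) (mu_ i) c)// -addrA subrK addrC.
move=> u u0; rewrite i2// h2// big_ord_recr/= bm rmorph0 subr0.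
have u_neq0 : u != 0 by have := nonreal_sub_neq0 0 u0; rewrite rmorph0 subr0.
under [in RHS]eq_bigr do rewrite bi.
by rewrite mulrCA mulKf// mulrC.
Qed.

End StepSum.

(** * Weak-* compactness *)

Import HBSimple.

(** The sequence clusters in a compact interval, and along an ultrafilter a cluster point is a
    limit. One ultrafilter serves all sets and test functions at once, with no extraction of
    subsequences. *)
Lemma ultra_cvgr {R : realType} (U : set_system nat) (UU : UltraFilter U)
  (a : nat -> R) (M : R) : (forall n, `|a n| <= M) -> cvg (a n @[n --> U]).
Proof.
move=> aM; have cK : compact `[- M, M]%classic by exact: segment_compact.
have FK : (a @ U) `[- M, M]%classic.
  suff : U (a @^-1` `[- M, M]%classic) by [].
  by apply: filterE => n; rewrite /= in_itv/= -ler_norml.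
have [l [_ al]] := cK _ (fmap_proper_filter a _) FK.
apply/cvg_ex; exists l => A Al.
have [//|UnA] := in_ultra_setVsetC (a @^-1` A) UU.
have [x [/= + nx]] := al (~` A) A UnA Al.
by [].
Qed.

Lemma cvg_sumr {R : realType} (U : set_system nat) {FU : Filter U}
    (f : nat -> nat -> R) (l : nat -> R) k :
  (forall i, f i n @[n --> U] --> l i) ->
  \sum_(i < k) f i n @[n --> U] --> \sum_(i < k) l i.
Proof.
move=> fl; elim: k => [|k ih].
  by under eq_fun do rewrite big_ord0; rewrite big_ord0; exact: cvg_cst.
by under eq_fun do rewrite big_ord_recr/=; rewrite big_ord_recr; exact: cvgD.
Qed.

Section WeakCompactness.
Context d (T : measurableType d) (R : realType).
Variable P : {finite_measure set T -> \bar R}.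
Variables (U : set_system nat) (UU : UltraFilter U) (F_ : nat -> T -> R).
Hypothesis mF : forall n, measurable_fun setT (F_ n).
Hypothesis F01 : forall n x, 0 <= F_ n x <= 1.

Let r n A := \int[P]_(x in A) F_ n x.

Let P_lty A : measurable A -> (P A < +oo)%E.
Proof. by move=> mA; rewrite ltey_eq fin_num_measure. Qed.

Let integrable_bounded (h : T -> R) A : measurable A -> measurable_fun setT h ->
  (forall x, 0 <= h x <= 1) -> P.-integrable A (EFin \o h).
Proof.
move=> mA mh h01; apply: measurable_bounded_integrable => //.
- exact: P_lty.
- exact: measurable_funTS.
- exists 1; split; first exact: num_real.
  move=> M M1 x _ /=; have /andP[h0 h1] := h01 x.
  by rewrite ger0_norm// (le_trans h1)// ltW.
Qed.

Let r_ge0 n A : 0 <= r n A.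
Proof. by apply: Rintegral_ge0 => x _; have /andP[] := F01 n x. Qed.

Let r_le n A : measurable A -> r n A <= fine (P A).
Proof.
move=> mA; rewrite -[leRHS]mul1r -Rintegral_cst//; apply: le_Rintegral => //.
- exact: integrable_bounded.
- apply: (@integrable_bounded (cst 1)) => // x; rewrite /= ler01 lexx//.
- by move=> x _; have /andP[] := F01 n x.
Qed.

Let rU n A B : measurable A -> measurable B -> [disjoint A & B] ->
  r n (A `|` B) = r n A + r n B.
Proof.
by move=> mA mB AB; rewrite /r Rintegral_setU//; apply: integrable_bounded => //;
  exact: measurableU.
Qed.

Let l A := lim (r n A @[n --> U]).

Let cvg_l A : measurable A -> r n A @[n --> U] --> l A.
Proof.
move=> mA; apply: (ultra_cvgr UU (M := fine (P A))) => n.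
by rewrite ger0_norm ?r_le.
Qed.

Let l_ge0 A : measurable A -> 0 <= l A.
Proof. by move=> mA; apply: cvgr_to_ge (cvg_l mA) _; near=> n; exact: r_ge0.
Unshelve. all: by end_near. Qed.

Let l_le A : measurable A -> l A <= fine (P A).
Proof. by move=> mA; apply: cvgr_to_le (cvg_l mA) _; near=> n; exact: r_le.
Unshelve. all: by end_near. Qed.

Let lU A B : measurable A -> measurable B -> [disjoint A & B] ->
  l (A `|` B) = l A + l B.
Proof.
move=> mA mB AB; apply: cvg_lim; first exact: Rhausdorff.
under eq_fun do rewrite rU//.
by apply: cvgD; exact: cvg_l.
Qed.

(** The absolute value makes [nu] nonnegative on all sets; on measurable sets it changes nothing. *)
Let nu (A : set T) : \bar R := `|l A|%:E.

Let nuE A : measurable A -> nu A = (l A)%:E.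
Proof. by move=> mA; rewrite /nu ger0_norm ?l_ge0. Qed.

Let nu0 : nu set0 = 0%E.
Proof.
rewrite nuE//; congr EFin; apply/eqP; rewrite eq_le l_ge0// andbT.
by have := l_le measurable0; rewrite measure0.
Qed.

Let nu_ge0 A : (0 <= nu A)%E.
Proof. by rewrite lee_fin. Qed.

Let nu_le A : measurable A -> (nu A <= P A)%E.
Proof.
by move=> mA; rewrite nuE// -(fineK (fin_num_measure P _ mA)) lee_fin l_le.
Qed.

(* Finite additivity passes to the limit; the domination by [P] makes the
   limit countably additive. *)
Let nu_sigma_additive : semi_sigma_additive nu.
Proof.
move=> A mA tA mUA.
pose B n := \big[setU/set0]_(i < n) A i.
have mB n : measurable (B n) by exact: bigsetU_measurable.
have dB n : [disjoint B n & A n].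
  apply/disj_setPS => x [Bx Ax].
  move: Bx; rewrite /B -bigcup_mkord => -[k /= kn Akx].
  have /trivIsetP/(_ k n Logic.I Logic.I) := tA.
  by rewrite (ltn_eqF kn) => /(_ isT)/seteqP[/(_ x (conj Akx Ax))].
have BS n : B n.+1 = B n `|` A n by rewrite /B big_ord_recr.
have sumB (f : set T -> R) : f set0 = 0 ->
  (forall A B, measurable A -> measurable B -> [disjoint A & B] ->
    f (A `|` B) = f A + f B) -> forall n, f (B n) = \sum_(i < n) f (A i).
  move=> f0 fU; elim=> [|n ih]; first by rewrite /B !big_ord0.
  by rewrite BS fU// ih big_ord_recr.
have l0 : l set0 = 0 by have := nuE measurable0; rewrite nu0 => -[].
have lB := sumB l l0 lU.
pose V := \bigcup_n A n.
have BV n : B n `<=` V by rewrite /B -bigcup_mkord; apply: bigcup_sub => i _; exact: bigcup_sup.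
have fin A' : measurable A' -> P A' \is a fin_num by exact: fin_num_measure.
have VB : V = \bigcup_n B n.
  apply/seteqP; split => [x [k _ Akx]|x [k _ /BV//]].
  by exists k.+1 => //; rewrite BS; right.
have PBV : P (B n) @[n --> \oo] --> P V.
  rewrite VB; apply: nondecreasing_cvg_mu => //; first by rewrite -VB.
  by apply/nondecreasing_seqP => n; apply/subsetPset; rewrite BS; exact: subsetUl.
have PB : fine (P (B n)) @[n --> \oo] --> fine (P V).
  by apply: fine_cvg; rewrite fineK ?fin.
rewrite nuE// (_ : (fun n => _) = EFin \o (fun n => l (B n))); last first.
  apply/funext => n /=; rewrite lB -sumEFin big_mkord; apply: eq_bigr => i _.
  exact: nuE.
apply: cvg_EFin; first by near=> n.
have lD n : 0 <= l V - l (B n) <= fine (P V) - fine (P (B n)).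
  have mD : measurable (V `\` B n) by exact: measurableD.
  have VE : V = B n `|` (V `\` B n) by rewrite setDUK.
  have dj : [disjoint B n & V `\` B n] by apply/disj_setPS => x [? []].
  rewrite {1 2 3}VE lU// addrAC subrr add0r l_ge0//=.
  rewrite (measureU P)//; last by apply/seteqP; split => // x [? []].
  by rewrite fineD ?fin// addrAC subrr add0r l_le.
apply/cvgrPdist_le => e e0; move/cvgrPdist_le : PB => /(_ _ e0).
apply: filterS => n /= hn; have /andP[h1 h2] := lD n.
rewrite ger0_norm// (le_trans h2)//; exact: le_trans (ler_norm _) hn.
Unshelve. all: by end_near. Qed.

HB.instance Definition _ := isMeasure.Build _ _ _ nu nu0 nu_ge0 nu_sigma_additive.

Let nu_fin : fin_num_fun nu. Proof. by []. Qed.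

HB.instance Definition _ := @Measure_isFinite.Build _ _ _ nu nu_fin.

Let nu_dom : nu `<< P.
Proof.
apply/null_content_dominatesP => A mA PA0.
by apply/eqP; rewrite eq_le nu_ge0 andbT -PA0 nu_le.
Qed.

Let density : exists h : T -> R, [/\ forall x, 0 <= h x,
  P.-integrable setT (EFin \o h) &
  forall A, measurable A -> \int[P]_(x in A) h x = l A].
Proof.
have [f [f0 ffin fi fE]] := radon_nikodym_sigma_finite nu_dom.
have fh : EFin \o (fine \o f) = f by apply/funext => x; rewrite /= fineK.
exists (fine \o f); split.
- by move=> x; rewrite fine_ge0.
- by rewrite fh.
- move=> A mA; have fE' : (l A)%:E = (\int[P]_(x in A) f x)%E.
    by rewrite -nuE//; exact: fE.
  by rewrite /Rintegral -fh in fE' *; rewrite -fE'.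
Qed.

(** A Radon-Nikodym density is bounded by 1 only almost everywhere, so it is truncated. On the set
    where it exceeds 1, its integral is at most the [P]-measure because [nu] is dominated by [P],
    and the truncation loses nothing. *)
Let bounded_density : exists F : T -> R, [/\ measurable_fun setT F,
  forall x, 0 <= F x <= 1 &
  forall A, measurable A -> \int[P]_(x in A) F x = l A].
Proof.
have [h [h0 hi hE]] := density.
have mh : measurable_fun setT h by apply/measurable_EFinP; exact: measurable_int hi.
exists (fun x => Num.min (h x) 1); split.
- exact: measurable_minr.
- by move=> x; rewrite le_min h0 ler01 ge_min lexx orbT.
move=> A mA.
have mF1 : measurable_fun setT (fun x => Num.min (h x) 1) by exact: measurable_minr.
have iF B : measurable B -> P.-integrable B (EFin \o (fun x => Num.min (h x) 1)).
  move=> mB; apply: integrable_bounded => // x.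
  by rewrite le_min h0 ler01 ge_min lexx orbT.
pose S := [set x | 1 < h x].
have mS : measurable S.
  have -> : S = setT `&` h @^-1` `]1, +oo[.
    by rewrite setTI; apply/seteqP; split => x; rewrite /S/= in_itv/= andbT.
  by apply: mh => //; exact: measurable_itv.
have ih B : measurable B -> P.-integrable B (EFin \o h).
  by move=> mB; apply: integrableS hi.
have mA1 : measurable (A `&` S) by exact: measurableI.
have mA2 : measurable (A `\` S) by exact: measurableD.
have dA : [disjoint A `&` S & A `\` S] by apply/disj_setPS => x [[_ ?] []].
have AE : A = (A `&` S) `|` (A `\` S) by rewrite setUIDK.
rewrite {1}AE Rintegral_setU -?AE//; last exact: iF.
rewrite -(hE A)// {3}AE Rintegral_setU -?AE//; last exact: ih.
congr (_ + _); last first.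
  apply: eq_Rintegral => x; rewrite inE => -[_ /negP]; rewrite -leNgt => hx.
  by rewrite min_l.
apply/eqP; rewrite eq_le; apply/andP; split.
  by apply: le_Rintegral => //; [exact: iF|exact: ih|
    move=> x _; rewrite ge_min lexx].
rewrite hE// (le_trans (l_le mA1))// -[leLHS]mul1r -Rintegral_cst//.
rewrite le_eqVlt; apply/orP; left; apply/eqP; apply: eq_Rintegral => x.
by rewrite inE => -[_ /ltW hx]; rewrite min_r.
Qed.

(** For simple functions this is convergence on measurable sets. Since all [F_ n] lie in [0, 1],
    approximating [phi] in L^1 costs the same error for every [n] and for the limit. *)
Lemma weak_compactness : exists F : T -> R, [/\ measurable_fun setT F,
  forall x, 0 <= F x <= 1 &
  forall phi : T -> R, P.-integrable setT (EFin \o phi) ->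
  \int[P]_x (F_ n x * phi x) @[n --> U] --> \int[P]_x (F x * phi x)].
Proof.
have [F [mFF F01' FE]] := bounded_density.
exists F; split => // phi iphi.
have iM (h g : T -> R) : measurable_fun setT h -> (forall x, 0 <= h x <= 1) ->
    P.-integrable setT (EFin \o g) -> P.-integrable setT (EFin \o (fun x => h x * g x)).
  move=> mh h01 ig; apply: (integrableMr measurableT mh _ ig).
  exists 1; split; first exact: num_real.
  move=> M M1 x _ /=; have /andP[h0 h1] := h01 x.
  by rewrite ger0_norm// (le_trans h1)// ltW.
have simple (s : {sfun T >-> R}) : P.-integrable setT (EFin \o s) ->
    \int[P]_x (F_ n x * s x) @[n --> U] --> \int[P]_x (F x * s x).
  move=> _.
  pose sf : T -> R := s.
  pose S := fset_set (range sf).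
  have sE x : sf x = \sum_(i < #|`S|) (S`_i * \1_(sf @^-1` [set S`_i]) x) by exact: fimfunEord.
  have mS i : measurable (sf @^-1` [set S`_i]) by exact: measurable_sfunP.
  have iS k : P.-integrable setT
      (EFin \o (fun x => \sum_(i < k) (S`_i * \1_(sf @^-1` [set S`_i]) x))).
    elim: k => [|k ih].
      rewrite (_ : EFin \o _ = cst 0%E); first exact: integrable0.
      by apply/funext => x; rewrite /= big_ord0.
    rewrite (_ : EFin \o _ = ((EFin \o
        (fun x => \sum_(i < k) (S`_i * \1_(sf @^-1` [set S`_i]) x))%R) \+
        (fun x => (S`_k)%:E * (\1_(sf @^-1` [set S`_k]) x)%:E))%E).
      by apply: integrableD => //; apply: integrableZl => //; exact: integrable_indic.
    by apply/funext => x; rewrite /= big_ord_recr.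
  have stepE (h : T -> R) k : measurable_fun setT h -> (forall x, 0 <= h x <= 1) ->
      \int[P]_x (h x * \sum_(i < k) (S`_i * \1_(sf @^-1` [set S`_i]) x)) =
      \sum_(i < k) S`_i * \int[P]_(x in sf @^-1` [set S`_i]) h x.
    move=> mh h01; elim: k => [|k ih].
      rewrite big_ord0; under eq_Rintegral do rewrite big_ord0 mulr0.
      by rewrite Rintegral_cst// mul0r.
    under eq_Rintegral do rewrite big_ord_recr/= mulrDr.
    have ind_i : P.-integrable setT (EFin \o (\1_(sf @^-1` [set S`_k]) : T -> R)).
      exact: integrable_indic.
    have ihk : P.-integrable setT (EFin \o (fun x => h x * \1_(sf @^-1` [set S`_k]) x)).
      exact: (iM h _ mh h01 ind_i).
    rewrite RintegralD//; first last.
    - under [X in _.-integrable _ (_ \o X)]eq_fun do rewrite mulrCA.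
      by rewrite (_ : _ \o _ = (fun x => (S`_k)%:E * (h x * \1_(sf @^-1` [set S`_k]) x)%:E)%E);
        [exact: integrableZl|apply/funext].
    - exact: (iM h _ mh h01 (iS k)).
    rewrite ih big_ord_recr/=; congr (_ + _).
    under eq_Rintegral do rewrite mulrCA.
    rewrite RintegralZl//; congr (_ * _).
    rewrite [RHS]Rintegral_mkcond; apply: eq_Rintegral => x _.
    by rewrite patchE indicE; case: (_ \in _); rewrite ?mulr1 ?mulr0.
  have key (h : T -> R) : measurable_fun setT h -> (forall x, 0 <= h x <= 1) ->
      \int[P]_x (h x * s x) = \sum_(i < #|`S|) S`_i * \int[P]_(x in sf @^-1` [set S`_i]) h x.
    move=> mh h01; rewrite -stepE//; apply: eq_Rintegral => x _.
    by rewrite -[s x]/(sf x) sE.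
  rewrite (key F)//; under eq_fun do rewrite key//.
  apply: (cvg_sumr (f := fun i n => S`_i * \int[P]_(x in sf @^-1` [set S`_i]) F_ n x)
    (l := fun i => S`_i * \int[P]_(x in sf @^-1` [set S`_i]) F x)) => i.
  apply: cvgM; first exact: cvg_cst.
  by rewrite FE//; exact: cvg_l.
have [s [si _ sphi]] := approximation_sfun_integrable measurableT iphi.
apply/cvgrPdist_le => e e0.
have e3 : 0 < e / 3 by rewrite divr_gt0.
have [k hk] : exists k, \int[P]_x `|phi x - s k x| <= e / 3.
  have : (fine \o (fun n => \int[P]_z `|(phi z)%:E - (s n z)%:E|)%E) @ \oo --> 0.
    exact: fine_cvg.
  move/cvgrPdist_le => /(_ _ e3)[k _ /(_ k (leqnn k))].
  by rewrite sub0r normrN => /(le_trans (ler_norm _)) h; exists k.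
have ips : P.-integrable setT (EFin \o (fun x => phi x - s k x)).
  by apply: eq_integrable (integrableB measurableT iphi (si k)).
have diff (h : T -> R) : measurable_fun setT h -> (forall x, 0 <= h x <= 1) ->
    `|\int[P]_x (h x * phi x) - \int[P]_x (h x * s k x)| <= e / 3.
  move=> mh h01; rewrite -RintegralB//; [|exact: iM|exact: iM (si k)].
  under eq_Rintegral do rewrite -mulrBr.
  apply: le_trans (le_normr_Rintegral measurableT (iM _ _ mh h01 ips)) _.
  apply: le_trans hk; apply: le_Rintegral => //.
  - exact: integrable_norm (iM _ _ mh h01 ips).
  - exact: integrable_norm ips.
  - move=> x _; have /andP[h0 h1] := h01 x.
    by rewrite normrM ger0_norm// ler_piMl.
move/cvgrPdist_le : (simple _ (si k)) => /(_ _ e3); apply: filterS => n hn.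
have h1 := diff _ mFF F01'; have h2 := diff _ (mF n) (F01 n).
rewrite distrC in h2.
rewrite -(subrKA (\int[P]_x (F x * s k x))) (le_trans (ler_normD _ _))//.
rewrite -(subrKA (\int[P]_x (F_ n x * s k x)) (\int[P]_x (F x * s k x))).
rewrite (le_trans (lerD h1 (ler_normD _ _)))//.
rewrite (le_trans (lerD (lexx _) (lerD hn h2)))//; lra.
Qed.

End WeakCompactness.

Section WeakLebesgue.
Context {R : realType}.
Local Notation mu := (@lebesgue_measure R).
(** A finite measure with everywhere positive density: phi |-> phi / g carries L^1 of Lebesgue
    measure into L^1 of [P], which transfers the compactness theorem to the line. *)
Let g : R -> R := normal_pdf 0 1.
Let P : {finite_measure set (measurableTypeR R) -> \bar R} := normal_prob 0 1.

Let g_gt0 x : 0 < g x.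
Proof.
by rewrite /g normal_pdfE ?oner_eq0// mulr_gt0 ?normal_peak_gt0 ?oner_eq0 ?expR_gt0.
Qed.

Let mg : measurable_fun setT g.
Proof. exact: measurable_normal_pdf. Qed.

Let P_dom : P `<< mu.
Proof. exact: normal_prob_dominates. Qed.

Let r := Radon_Nikodym_SigmaFinite.f P mu.

Let r_g : ae_eq mu setT r (EFin \o g).
Proof.
apply: integral_ae_eq => //.
- exact: Radon_Nikodym_SigmaFinite.f_integrable.
- exact/measurable_EFinP.
- by move=> E _ mE; rewrite /r -Radon_Nikodym_SigmaFinite.f_integral.
Qed.

Let ge0_integral_P (f : R -> \bar R) : measurable_fun setT f -> (forall x, 0 <= f x)%E ->
  (\int[P]_x f x = \int[mu]_x (f x * (g x)%:E))%E.
Proof.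
move=> mf f0; rewrite -(Radon_Nikodym_SigmaFinite.change_of_variables P_dom)//.
apply: ae_eq_integral => //.
- apply: emeasurable_funM => //.
  exact: measurable_int (Radon_Nikodym_SigmaFinite.f_integrable _).
- by apply: emeasurable_funM => //; exact/measurable_EFinP.
- exact: ae_eqe_mul2l.
Qed.

Let integrable_P (phi : R -> R) : mu.-integrable setT (EFin \o phi) ->
  P.-integrable setT (EFin \o (fun x => phi x / g x)).
Proof.
move=> iphi; have mphi : measurable_fun setT phi.
  by apply/measurable_EFinP; exact: measurable_int iphi.
have mq : measurable_fun setT (fun x => phi x / g x).
  apply: measurable_funM => //; apply: continuous_measurable_fun => x.
  by apply: cvgV; [rewrite gt_eqF|apply: continuous_normal_pdf; exact: oner_neq0].
apply/integrableP; split; first exact/measurable_EFinP.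
rewrite ge0_integral_P//; last first.
  by apply/measurableT_comp => //; exact/measurable_EFinP.
have /integrableP[_] := iphi; apply: le_lt_trans.
rewrite le_eqVlt; apply/orP; left; apply/eqP; apply: eq_integral => x _ /=.
by rewrite -EFinM normrM normfV (gtr0_norm (g_gt0 x)) divfK// gt_eqF.
Qed.

Let integral_P (psi : R -> R) : P.-integrable setT (EFin \o psi) ->
  \int[P]_x psi x = \int[mu]_x (psi x * g x).
Proof.
move=> ipsi; rewrite /Rintegral; congr fine.
rewrite -(Radon_Nikodym_change_of_variables P_dom)//.
have mr := Radon_Nikodym_SigmaFinite.f_integrable P_dom.
apply: ae_eq_integral => //.
- apply: emeasurable_funM => //; first exact: measurable_int ipsi.
- apply/measurable_EFinP/measurable_funM => //.
  by apply/measurable_EFinP; exact: measurable_int ipsi.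
have h0 := ae_eq_trans (ae_eq_sym (ae_eq_Radon_Nikodym_SigmaFinite P_dom measurableT)) r_g.
by apply: filterS h0 => x /= hx xT; rewrite hx.
Qed.

Lemma weak_compactness_lebesgue (U : set_system nat) (UU : UltraFilter U)
    (F_ : nat -> R -> R) :
  (forall n, measurable_fun setT (F_ n)) -> (forall n x, 0 <= F_ n x <= 1) ->
  exists F : R -> R, [/\ measurable_fun setT F,
    forall x, 0 <= F x <= 1 &
    forall phi : R -> R, mu.-integrable setT (EFin \o phi) ->
    \int[mu]_x (F_ n x * phi x) @[n --> U] --> \int[mu]_x (F x * phi x)].
Proof.
move=> mF F01; have [F [mFF F01' FE]] := @weak_compactness _ _ _ P U UU F_ mF F01.
exists F; split => // phi iphi.
have key (h : R -> R) : measurable_fun setT h -> (forall x, 0 <= h x <= 1) ->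
    \int[P]_x (h x * (phi x / g x)) = \int[mu]_x (h x * phi x).
  move=> mh h01; rewrite integral_P.
    by apply: eq_Rintegral => x _; rewrite -mulrA divfK// gt_eqF.
  have bh : [bounded h x | x in setT].
    exists 1; split; first exact: num_real.
    move=> M M1 x _ /=; have /andP[h0 h1] := h01 x.
    by rewrite ger0_norm// (le_trans h1)// ltW.
  exact: (@integrableMr _ (measurableTypeR R) R P setT measurableT h _ mh bh
    (integrable_P iphi)).
rewrite -key//; under eq_fun do rewrite -key//.
exact/FE/integrable_P.
Qed.

End WeakLebesgue.

(** * Moment and tail bounds for spectral shift functions *)

Section SpectralShiftBounds.
Context {R : realType}.
Local Notation mu := (@lebesgue_measure R).

(* In particular [xi c] and [c] have opposite signs. *)
Definition shifted (xi : R -> R) := forall c, 0 <= xi c + \1_`[0, +oo[ c <= 1.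

Lemma indic_ge0 (c : R) : \1_`[0, +oo[ c = (0 <= c)%R%:R :> R.
Proof.
rewrite indicE (_ : (c \in _) = (0 <= c))//.
by apply/idP/idP; rewrite inE/= in_itv/= andbT.
Qed.

Lemma shifted_norm xi c : shifted xi -> `|xi c| <= 1.
Proof.
move=> /(_ c); rewrite indic_ge0 ler_norml.
by case: (0 <= c) => /= /andP[h1 h2]; apply/andP; split; lra.
Qed.

Lemma shifted_mul xi c : shifted xi -> - (xi c * c) = `|xi c| * `|c|.
Proof.
move=> /(_ c); rewrite indic_ge0; case: (lerP 0 c) => c0 /= /andP[h1 h2].
  by rewrite (ger0_norm c0) ler0_norm ?mulNr//; lra.
by rewrite (ltr0_norm c0) ger0_norm ?mulrN//; lra.
Qed.

Definition window (B : R) : set (measurableTypeR R) := `[- B, B]%classic.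

Lemma measurable_window B : measurable (window B). Proof. exact: measurable_itv. Qed.

Lemma windowP B c : window B c <-> `|c| <= B.
Proof. by rewrite /window/= in_itv/= ler_norml. Qed.

Lemma window_lty B : (mu (window B) < +oo)%E.
Proof. by rewrite /window lebesgue_measure_itv/=; case: ifP => // _; rewrite ltry. Qed.

Lemma integrable_window (h : R -> R) B C : measurable_fun setT h ->
  (forall c, window B c -> `|h c| <= C) -> mu.-integrable (window B) (EFin \o h).
Proof.
move=> mh hC; apply: measurable_bounded_integrable.
- exact: measurable_window.
- exact: window_lty.
- exact: measurable_funTS.
- exists C; split; first exact: num_real.
  by move=> M CM c Bc /=; rewrite (le_trans (hC _ Bc))// ltW.
Qed.

Lemma integrable_window_mul (xi : R -> R) B : measurable_fun setT xi -> shifted xi ->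
  mu.-integrable (window B) (EFin \o (fun c => `|xi c| * `|c|)).
Proof.
move=> mxi sxi; apply: (@integrable_window _ _ B).
  by apply: measurable_funM; [apply: measurableT_comp|exact: normr_measurable].
move=> c /windowP cB; rewrite normrM !normr_id -[leRHS]mul1r ler_pM//.
exact: shifted_norm.
Qed.

(** If I > 2 x, then e^-I < 1 / (1 + 2 x) <= 1 - x, where the last inequality is x >= 2 x^2. *)
Lemma expR_bound_le (I x : R) : 0 <= x <= 2^-1 -> 1 - x <= expR (- I) -> I <= 2 * x.
Proof.
move=> /andP[x0 x1] h; rewrite leNgt; apply/negP => xI.
have : expR (- I) < expR (- (2 * x)) by rewrite ltr_expR ltrN2.
move/(le_lt_trans h); apply/negP; rewrite -leNgt expRN.
rewrite (@le_trans _ _ (1 + 2 * x)^-1)//.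
  by rewrite lef_pV2 ?posrE ?expR_gt0 ?expR_ge1Dx//; lra.
by rewrite -div1r ler_pdivrMr; nra.
Qed.

Definition iy (y : R) : R[i] := (0 +i* y)%C.

(* At [u = i y] the real part of the exponent is
   [- \int |xi c| |c| / (c ^ 2 + y ^ 2)]; [y] is taken large compared to [B]. *)
Lemma moment_bound (xi : R -> R) (M B : R) : mu.-integrable setT (EFin \o xi) -> shifted xi ->
  0 <= M ->
  (forall y, 0 < y -> 1 - M / y ^+ 2 <= complex.Re `|expC (- cauchy mu xi (iy y))|) ->
  \int[mu]_(c in window B) (`|xi c| * `|c|) <= 4 * M.
Proof.
move=> ixi sxi M0 hM.
have mxi : measurable_fun setT xi by apply/measurable_EFinP; exact: measurable_int ixi.
(* y >= |B| gives c^2 + y^2 <= 2 y^2 on the window, and y >= 2 M + 1 gives M / y^2 <= 1/2. The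
   constant 4 is this factor 2 times the one in [expR_bound_le]. *)
pose y := `|B| + 2 * M + 1.
have y1 : 1 <= y by rewrite /y lerDr addr_ge0// mulr_ge0.
have y0 : 0 < y by rewrite (lt_le_trans _ y1).
have ynr : nonreal (iy y) by rewrite /nonreal/= gt_eqF.
have x1 : 0 <= M / y ^+ 2 <= 2^-1.
  rewrite divr_ge0 ?sqr_ge0//= ler_pdivrMr ?exprn_gt0// mulrC ler_pdivlMr//.
  rewrite (@le_trans _ _ y)//; first by rewrite /y; have := normr_ge0 B; lra.
  by rewrite expr2 ler_peMl// ltW.
have := hM y y0; rewrite norm_expC cauchyE/=.
move=> /(expR_bound_le x1); set I := \int[mu]_c _ => hI.
have hk c : xi c * kre (iy y) c = `|xi c| * `|c| / (c ^+ 2 + y ^+ 2).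
  by rewrite -(shifted_mul c sxi) /iy kreE sub0r sqrrN; ring.
have d0 c : 0 < c ^+ 2 + y ^+ 2 by rewrite ltr_wpDl ?sqr_ge0 ?exprn_gt0.
have y2 : 0 < 2 * y ^+ 2 by rewrite mulr_gt0// exprn_gt0.
have iI := integrable_kre ixi ynr.
have mw := measurable_window B.
rewrite -(ler_pM2l (_ : 0 < (2 * y ^+ 2)^-1)) ?invr_gt0//.
have -> : (2 * y ^+ 2)^-1 * (4 * M) = 2 * (M / y ^+ 2).
  by field; rewrite gt_eqF.
apply: le_trans hI; rewrite -RintegralZl//; last exact: integrable_window_mul.
apply: (@le_trans _ _ (\int[mu]_(c in window B) (xi c * kre (iy y) c))).
  apply: le_Rintegral => //.
  - rewrite (_ : EFin \o _ = (fun c => ((2 * y ^+ 2)^-1)%:E * (`|xi c| * `|c|)%:E)%E)//.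
    by apply: integrableZl => //; exact: integrable_window_mul.
  - exact: integrableS iI.
  move=> c /windowP cB; rewrite hk mulrC ler_wpM2l ?mulr_ge0//.
  rewrite lef_pV2 ?posrE//.
  have : `|c| <= y by rewrite (le_trans cB)// /y; have := ler_norm B; lra.
  rewrite -(@ler_pXn2r _ 2) ?nnegrE ?(ltW y0)// real_normK ?num_real//.
  lra.
rewrite /I [leLHS]Rintegral_mkcond; apply: le_Rintegral => //.
- rewrite -restrict_EFin -integrable_mkcond//; exact: integrableS iI.
move=> c _; rewrite patchE; case: ifP => // _.
by rewrite hk divr_ge0 ?mulr_ge0// ltW.
Qed.

(** Markov's inequality: |xi| <= |xi| |c| / A outside the window. The integral is extended-valued
    because integrability of [xi] is deduced from this bound; monotone convergence over the bounded
    sets [V n] gives the whole tail. *)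
Lemma tail_bound (xi : R -> R) (K A : R) : measurable_fun setT xi -> shifted xi ->
  (forall B, \int[mu]_(c in window B) (`|xi c| * `|c|) <= K) -> 0 < A ->
  (\int[mu]_(c in ~` window A) `|xi c|%:E <= (K / A)%:E)%E.
Proof.
move=> mxi sxi hK A0.
pose V n : set (measurableTypeR R) := window n%:R `\` window A.
have mV n : measurable (V n) by apply: measurableD; exact: measurable_window.
have VU : ~` window A = \bigcup_n V n.
  apply/seteqP; split => [c Ac|c [n _ [_ //]]].
  have [n cn] : exists n : nat, `|c| <= n%:R.
    by exists (Num.trunc `|c|).+1; rewrite ltW// truncnS_gt.
  by exists n => //; split => //; apply/windowP.
have ndV : nondecreasing_seq V.
  move=> m n mn; apply/subsetPset => c [/windowP cm Ac]; split => //.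
  by apply/windowP; rewrite (le_trans cm)// ler_nat.
have mn B : measurable_fun B (fun c => `|xi c|%:E).
  apply/measurable_EFinP; apply: measurable_funTS.
  by apply: measurableT_comp; [exact: normr_measurable|].
have VI : (\int[mu]_(c in V n) `|xi c|%:E @[n --> \oo] -->
    \int[mu]_(c in ~` window A) `|xi c|%:E)%E.
  rewrite VU; apply: ge0_nondecreasing_set_cvg_integral => // i.
  exact: mn.
rewrite -(cvg_lim _ VI)//; apply: lime_le; first by apply/cvg_ex; eexists; exact: VI.
near=> n.
have iV : mu.-integrable (V n) (EFin \o (fun c => `|xi c|)).
  apply: (@integrableS _ (measurableTypeR R) R mu (window n%:R) (V n) _
    (measurable_window n%:R) (mV n)); first exact: subDsetl.
  apply: (@integrable_window _ _ 1); first exact: measurableT_comp.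
  by move=> c _; rewrite normr_id; exact: shifted_norm.
have iVc : mu.-integrable (V n) (EFin \o (fun c => `|xi c| * `|c|)).
  apply: (@integrableS _ (measurableTypeR R) R mu (window n%:R) (V n) _
    (measurable_window n%:R) (mV n)); first exact: subDsetl.
  exact: integrable_window_mul.
rewrite -(fineK (integrable_fin_num (mV n) iV)) lee_fin ler_pdivlMr//.
apply: le_trans (hK n%:R); rewrite -/(Rintegral mu (V n) _) mulrC -RintegralZl//.
apply: (@le_trans _ _ (\int[mu]_(c in V n) (`|xi c| * `|c|))).
  apply: le_Rintegral => //.
  - rewrite (_ : EFin \o _ = (fun c => A%:E * `|xi c|%:E)%E)//.
    exact: integrableZl.
  - move=> c [_ /windowP/negP]; rewrite -ltNge => Ac.
    by rewrite mulrC ler_wpM2l// ltW.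
rewrite Rintegral_mkcond [leRHS]Rintegral_mkcond; apply: le_Rintegral => //.
- by rewrite -restrict_EFin -integrable_mkcond.
- rewrite -restrict_EFin -integrable_mkcond//; last exact: measurable_window.
  exact: integrable_window_mul.
move=> c _; rewrite !patchE; case: ifPn => [|_].
  by rewrite inE => -[wc _]; rewrite mem_set.
by case: ifPn => // _; rewrite mulr_ge0.
Unshelve. all: by end_near. Qed.

Lemma shifted_integrable (xi : R -> R) (K : R) : measurable_fun setT xi -> shifted xi ->
  (forall B, \int[mu]_(c in window B) (`|xi c| * `|c|) <= K) ->
  mu.-integrable setT (EFin \o xi).
Proof.
move=> mxi sxi hK; have mw := measurable_window 1.
apply/integrableP; split; first exact/measurable_EFinP.
rewrite -(setUv (window 1)) ge0_integral_setU//=.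
- apply: lte_add_pinfty; last exact: le_lt_trans (tail_bound mxi sxi hK ltr01) (ltry _).
  have : mu.-integrable (window 1) (EFin \o xi).
    by apply: (@integrable_window _ _ 1) => // c _; exact: shifted_norm.
  by case/integrableP.
- exact: measurableC.
- apply/measurable_EFinP; apply: measurable_funTS.
  by apply: measurableT_comp; [exact: normr_measurable|].
- by apply/disj_setPS => x [].
Qed.

End SpectralShiftBounds.

(** * Limits of exponential representations *)

Section Limit.
Context {R : realType}.
Local Notation mu := (@lebesgue_measure R).

Section Tail.
Variables (xi h : R -> R) (K b A : R).
Hypotheses (ixi : mu.-integrable setT (EFin \o xi)) (sxi : shifted xi).
Hypothesis hK : forall B, \int[mu]_(c in window B) (`|xi c| * `|c|) <= K.
Hypotheses (mh : measurable_fun setT h) (hb : forall c, `|h c| <= b).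

Lemma integrable_shifted_mul : mu.-integrable setT (EFin \o (fun c => xi c * h c)).
Proof.
have bh : [bounded h x | x in setT].
  by exists b; split; [exact: num_real|move=> M bM x _ /=; rewrite (le_trans (hb x))// ltW].
exact: (@integrableMl _ (measurableTypeR R) R mu setT measurableT _ _ ixi mh bh).
Qed.

Lemma window_tail : 0 < A ->
  `|\int[mu]_c (xi c * h c) - \int[mu]_(c in window A) (xi c * h c)| <= b * (K / A).
Proof.
move=> A0; have mxi : measurable_fun setT xi.
  by apply/measurable_EFinP; exact: measurable_int ixi.
have mw := measurable_window A.
have mwC : measurable (~` window A) by exact: measurableC.
have b0 : 0 <= b by exact: le_trans (hb 0).
have ih := integrable_shifted_mul.
rewrite -{1}(setUv (window A)) Rintegral_setU//; first last.
- by apply/disj_setPS => x [].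
- by rewrite setUv.
rewrite addrAC subrr add0r.
have ihC : mu.-integrable (~` window A) (EFin \o (fun c => xi c * h c)).
  exact: integrableS ih.
have ixC : mu.-integrable (~` window A) (EFin \o (fun c => `|xi c|)).
  by apply: integrable_norm; exact: integrableS ixi.
rewrite (le_trans (le_normr_Rintegral mwC ihC))//.
apply: (@le_trans _ _ (b * \int[mu]_(c in ~` window A) `|xi c|)).
  rewrite -RintegralZl//; apply: le_Rintegral => //.
  - exact: integrable_norm ihC.
  - rewrite (_ : EFin \o _ = (fun c => b%:E * `|xi c|%:E)%E)//.
    exact: integrableZl.
  - by move=> c _; rewrite normrM mulrC ler_wpM2r.
rewrite ler_wpM2l// -lee_fin /Rintegral fineK; last exact: integrable_fin_num.
exact: tail_bound.
Qed.

End Tail.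

Lemma cvg_expC (U : set_system nat) {FU : Filter U} (a b : nat -> R) (a0 b0 : R) :
  a n @[n --> U] --> a0 -> b n @[n --> U] --> b0 ->
  complex.Re (expC (- (a n +i* b n)%C)) @[n --> U] --> complex.Re (expC (- (a0 +i* b0)%C)) /\
  complex.Im (expC (- (a n +i* b n)%C)) @[n --> U] --> complex.Im (expC (- (a0 +i* b0)%C)).
Proof.
move=> aa bb.
have ea : expR (- a n) @[n --> U] --> expR (- a0).
  by apply: continuous_cvg; [exact: continuous_expR|exact: cvgN].
have cb : cos (- b n) @[n --> U] --> cos (- b0).
  by apply: continuous_cvg; [exact: continuous_cos|exact: cvgN].
have sb : sin (- b n) @[n --> U] --> sin (- b0).
  by apply: continuous_cvg; [exact: continuous_sin|exact: cvgN].
have reE x y : complex.Re (expC (- (x +i* y)%C)) = expR (- x) * cos (- y) :> R.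
  by rewrite /expC/= mul0r subr0.
have imE x y : complex.Im (expC (- (x +i* y)%C)) = expR (- x) * sin (- y) :> R.
  by rewrite /expC/= mul0r addr0.
split.
  by rewrite reE; under eq_fun do rewrite reE; exact: cvgM.
by rewrite imE; under eq_fun do rewrite imE; exact: cvgM.
Qed.

Lemma limit_log_representation (T : R[i] -> R[i]) (xi_ : nat -> R -> R) (M : R) :
  (forall n, mu.-integrable setT (EFin \o xi_ n)) -> (forall n, shifted (xi_ n)) ->
  0 <= M ->
  (forall n y, 0 < y -> 1 - M / y ^+ 2 <= complex.Re `|expC (- cauchy mu (xi_ n) (iy y))|) ->
  (forall u (e : R), nonreal u -> 0 < e -> exists N, forall n, (N <= n)%N ->
    `|expC (- cauchy mu (xi_ n) u) - T u| <= e%:C%C) ->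
  exists xi, [/\ mu.-integrable setT (EFin \o xi), shifted xi &
    forall u, nonreal u -> T u = expC (- cauchy mu xi u)].
Proof.
move=> ixi sxi M0 hM hT.
(* The values at [u] converge along the whole sequence, so an ultrafilter limit of the [xi_ n] still
   represents [T]. *)
have [U [UU oU]] := ultraFilterLemma (eventually_filter).
pose F_ n c := xi_ n c + \1_`[0, +oo[ c.
have mxi n : measurable_fun setT (xi_ n).
  by apply/measurable_EFinP; exact: measurable_int (ixi n).
have m1 : measurable_fun setT (\1_`[0, +oo[ : R -> R).
  by apply: measurable_indic; exact: measurable_itv.
have mF n : measurable_fun setT (F_ n) by exact: measurable_funD.
have [F [mFF F01 FE]] := weak_compactness_lebesgue UU mF sxi.
pose xi c := F c - \1_`[0, +oo[ c.
have mx : measurable_fun setT xi by exact: measurable_funB.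
have sx : shifted xi by move=> c; rewrite /xi subrK.
have bounded01 (h : R -> R) : (forall c, 0 <= h c <= 1) -> [bounded h c | c in setT].
  move=> h01; exists 1; split; first exact: num_real.
  move=> B B1 c _ /=; have /andP[h0 h1] := h01 c.
  by rewrite ger0_norm// (le_trans h1)// ltW.
have iM (h phi : R -> R) : measurable_fun setT h -> (forall c, 0 <= h c <= 1) ->
    mu.-integrable setT (EFin \o phi) -> mu.-integrable setT (EFin \o (fun c => h c * phi c)).
  move=> mh h01 ip.
  exact: (@integrableMr _ (measurableTypeR R) R mu setT measurableT _ _ mh (bounded01 _ h01) ip).
have i01 (c : R) : 0 <= (\1_`[0, +oo[ : R -> R) c <= 1.
  by have -> := indic_ge0 c; case: (0 <= c); rewrite ?lexx ?ler01.
have weak (phi : R -> R) : mu.-integrable setT (EFin \o phi) ->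
    \int[mu]_c (xi_ n c * phi c) @[n --> U] --> \int[mu]_c (xi c * phi c).
  move=> ip.
  have E (h : R -> R) : measurable_fun setT h -> (forall c, 0 <= h c <= 1) ->
      \int[mu]_c ((h c - \1_`[0, +oo[ c) * phi c) =
      \int[mu]_c (h c * phi c) - \int[mu]_c (\1_`[0, +oo[ c * phi c).
    move=> mh h01; rewrite -RintegralB//; [|exact: iM|exact: iM].
    by apply: eq_Rintegral => c _; rewrite mulrBl.
  rewrite /xi E//.
  have -> : (fun n => \int[mu]_c (xi_ n c * phi c)) =
      (fun n => \int[mu]_c (F_ n c * phi c) - \int[mu]_c (\1_`[0, +oo[ c * phi c)).
    apply/funext => n; rewrite -E//; last exact: sxi.
    by apply: eq_Rintegral => c _; rewrite /F_ addrK.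
  by apply: cvgB; [exact: FE|exact: cvg_cst].
have window_weak (h : R -> R) B (b : R) : measurable_fun setT h ->
    (forall c, window B c -> `|h c| <= b) ->
    \int[mu]_(c in window B) (xi_ n c * h c) @[n --> U] -->
    \int[mu]_(c in window B) (xi c * h c).
  move=> mh hb; have mw := measurable_window B.
  have ih : mu.-integrable setT (EFin \o (h \_ (window B))).
    rewrite -restrict_EFin -integrable_mkcond//; exact: integrable_window hb.
  have E (x : R -> R) : \int[mu]_(c in window B) (x c * h c) =
      \int[mu]_c (x c * (h \_ (window B)) c).
    rewrite Rintegral_mkcond; apply: eq_Rintegral => c _.
    by rewrite !patchE; case: ifPn; rewrite ?mulr0.
  rewrite E; under eq_fun do rewrite E.
  exact: weak.
have hKn n B : \int[mu]_(c in window B) (`|xi_ n c| * `|c|) <= 4 * M.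
  exact: moment_bound (hM n).
(* The bound passes to the weak limit because |xi c| |c| = - xi c * c is linear in [xi] for shifted
   functions. *)
have hK B : \int[mu]_(c in window B) (`|xi c| * `|c|) <= 4 * M.
  have E (x : R -> R) : shifted x -> \int[mu]_(c in window B) (`|x c| * `|c|) =
      \int[mu]_(c in window B) (x c * - c).
    by move=> sx'; apply: eq_Rintegral => c _; rewrite -shifted_mul// mulrN.
  rewrite E//; apply: cvgr_to_le (window_weak _ B B _ _) _.
  - exact: oppr_measurable.
  - by move=> c /windowP; rewrite normrN.
  - by near=> n; rewrite -E.
have ix := shifted_integrable mx sx hK.
exists xi; split => // u u0.
have b0 : 0 < `|complex.Im u|^-1 by rewrite invr_gt0 normr_gt0.
(* The Cauchy kernel is bounded but not integrable: weak convergence applies on a window, and the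
   moment bound makes the tails small uniformly in [n]. *)
have cvg_int (h : R -> R) : measurable_fun setT h ->
    (forall c, `|h c| <= `|complex.Im u|^-1) ->
    \int[mu]_c (xi_ n c * h c) @[n --> U] --> \int[mu]_c (xi c * h c).
  move=> mh hb; apply/cvgrPdist_le => e e0.
  set b := `|complex.Im u|^-1 in b0 hb.
  (* Makes the tail bound b (4 M / A) at most e / 3; the 1 keeps [A] positive when M = 0. *)
  pose A := b * (4 * M + 1) / (e / 3).
  have A0 : 0 < A by rewrite divr_gt0 ?divr_gt0// mulr_gt0// ltr_wpDl// mulr_ge0.
  have bA : b * (4 * M / A) <= e / 3.
    rewrite mulrA ler_pdivrMr// /A [leRHS]mulrC divfK ?gt_eqF ?divr_gt0//.
    by rewrite ler_wpM2l ?(ltW b0)// lerDl.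
  have t1 := le_trans (window_tail ix sx hK mh hb A0) bA.
  have t2 n := le_trans (window_tail (ixi n) (sxi n) (hKn n) mh hb A0) bA.
  have e3 : 0 < e / 3 by rewrite divr_gt0.
  have /cvgrPdist_le/(_ _ e3) := window_weak h A b mh (fun c _ => hb c).
  apply: filterS => n hn.
  rewrite -(subrKA (\int[mu]_(c in window A) (xi c * h c))) (le_trans (ler_normD _ _))//.
  rewrite -(subrKA (\int[mu]_(c in window A) (xi_ n c * h c))
    (\int[mu]_(c in window A) (xi c * h c))).
  rewrite (le_trans (lerD t1 (ler_normD _ _)))//.
  have t2' := t2 n; rewrite distrC in t2'.
  by rewrite (le_trans (lerD (lexx _) (lerD hn t2')))//; lra.
have [re im] := cvg_expC (cvg_int _ (measurable_kre u0) (fun c => norm_kre c u0))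
  (cvg_int _ (measurable_kim u0) (fun c => norm_kim c u0)).
have hTU (e : R) : 0 < e -> \forall n \near U, `|expC (- cauchy mu (xi_ n) u) - T u| <= e%:C%C.
  by move=> e0; apply: oU; have [N hN] := hT u e u0 e0; exists N.
rewrite cauchyE; apply/eqP; rewrite eq_complex; apply/andP; split; apply/eqP.
- apply: (cvg_unique (@Rhausdorff R) _ re); apply/cvgrPdist_le => e /hTU.
  apply: filterS => n; rewrite cauchyE distrC => hn; rewrite -lecR (le_trans _ hn)//.
  rewrite (le_trans _ (normc_ge_Re _))// lecR.
  by case: (T u) (expC _) => ? ? [].
- apply: (cvg_unique (@Rhausdorff R) _ im); apply/cvgrPdist_le => e /hTU.
  apply: filterS => n; rewrite cauchyE distrC => hn; rewrite -lecR (le_trans _ hn)//.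
  rewrite (le_trans _ (normc_ge_Im _))// lecR.
  by case: (T u) (expC _) => ? ? [].
Unshelve. all: by end_near. Qed.

End Limit.

(** * Limits of probability measures *)

Section Compactification.
Context {R : realType}.
Implicit Types (u : R[i]).
Local Notation mu := (@lebesgue_measure R).

(* [1 / (u - tan t)], extended by continuity with the value [0] at the
   odd multiples of [pi / 2]. *)
Definition gden u (t : R) : R :=
  (complex.Re u * cos t - sin t) ^+ 2 + (complex.Im u * cos t) ^+ 2.
Definition gre u (t : R) : R := cos t * (complex.Re u * cos t - sin t) / gden u t.
Definition gim u (t : R) : R := - complex.Im u * cos t ^+ 2 / gden u t.

Lemma gden_gt0 u t : nonreal u -> 0 < gden u t.
Proof.
move=> u0; rewrite lt_def addr_ge0 ?sqr_ge0// andbT paddr_eq0 ?sqr_ge0//.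
rewrite !sqrf_eq0 mulf_eq0 (negbTE u0)/=; apply/negP => /andP[/eqP h /eqP ct].
have := cos2Dsin2 t; move: h; rewrite ct mulr0 sub0r expr0n/= add0r.
by move=> /eqP; rewrite oppr_eq0 => /eqP ->; rewrite expr0n/= => /eqP; rewrite eq_sym oner_eq0.
Qed.

Lemma gre_tan u t : nonreal u -> cos t != 0 -> gre u t = kre u (tan t).
Proof.
case: u => x y u0 ct; rewrite /gre /gden /tan kreE/=; field.
have := gden_gt0 t u0; rewrite /gden/= => h.
rewrite ct gt_eqF//=; move: h; congr (0 < _); ring.
Qed.

Lemma gim_tan u t : nonreal u -> cos t != 0 -> gim u t = kim u (tan t).
Proof.
case: u => x y u0 ct; rewrite /gim /gden /tan kimE/=; field.
have := gden_gt0 t u0; rewrite /gden/= => h.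
rewrite ct gt_eqF//=; move: h; congr (0 < _); ring.
Qed.

Lemma gre0 u t : cos t = 0 -> gre u t = 0.
Proof. by rewrite /gre => ->; rewrite !mul0r. Qed.

Lemma gim0 u t : cos t = 0 -> gim u t = 0.
Proof. by rewrite /gim => ->; rewrite expr0n/= mulr0 mul0r. Qed.

Lemma norm_gre u t : nonreal u -> `|gre u t| <= `|complex.Im u|^-1.
Proof.
move=> u0; have [ct|ct] := eqVneq (cos t) 0; first by rewrite gre0// normr0.
by rewrite gre_tan//; exact: norm_kre.
Qed.

Lemma norm_gim u t : nonreal u -> `|gim u t| <= `|complex.Im u|^-1.
Proof.
move=> u0; have [ct|ct] := eqVneq (cos t) 0; first by rewrite gim0// normr0.
by rewrite gim_tan//; exact: norm_kim.
Qed.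

Lemma continuous_gden u : continuous (gden u).
Proof.
move=> t; rewrite /gden.
have c1 : cos z @[z --> t] --> cos t by exact: continuous_cos.
have c2 : sin z @[z --> t] --> sin t by exact: continuous_sin.
have h1 : (complex.Re u * cos z - sin z) @[z --> t] --> complex.Re u * cos t - sin t.
  by apply: cvgB => //; apply: cvgM => //; exact: cvg_cst.
have h2 : (complex.Im u * cos z) @[z --> t] --> complex.Im u * cos t.
  by apply: cvgM => //; exact: cvg_cst.
apply: cvgD; first by under eq_fun do rewrite expr2; rewrite expr2; exact: cvgM.
by under eq_fun do rewrite expr2; rewrite expr2; exact: cvgM.
Qed.

Lemma continuous_gre u : nonreal u -> continuous (gre u).
Proof.
move=> u0 t; rewrite /gre.
have c1 : cos z @[z --> t] --> cos t by exact: continuous_cos.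
have c2 : sin z @[z --> t] --> sin t by exact: continuous_sin.
apply: cvgM; last by apply: cvgV; [rewrite gt_eqF// gden_gt0|exact: continuous_gden].
by apply: cvgM => //; apply: cvgB => //; apply: cvgM => //; exact: cvg_cst.
Qed.

Lemma continuous_gim u : nonreal u -> continuous (gim u).
Proof.
move=> u0 t; rewrite /gim.
have c1 : cos z @[z --> t] --> cos t by exact: continuous_cos.
apply: cvgM; last by apply: cvgV; [rewrite gt_eqF// gden_gt0|exact: continuous_gden].
apply: cvgM; first exact: cvg_cst.
by under eq_fun do rewrite expr2; rewrite expr2; exact: cvgM.
Qed.

End Compactification.

(** * Quantile functions of finitely supported measures *)

Section Quantile.
Context {R : realType}.
Variables (s : seq R) (W : R -> R) (m : nat).
Hypotheses (ss : sorted <%R s) (sm : size s = m.+1).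
Hypothesis W0 : forall x, x \in s -> 0 < W x.
Hypothesis W1 : \sum_(x <- s) W x = 1.
Local Notation mu := (@lebesgue_measure R).
Let x_ i := nth 0 s i.

Let cum k := \sum_(i < k) W (x_ i).

(** The left-continuous inverse of the distribution function, written as a sum of jumps so that it
    is monotone term by term on the whole line. *)
Definition quantile (t : R) : R :=
  x_ 0%N + \sum_(i < m) (x_ i.+1 - x_ i) * (cum i.+1 < t)%R%:R.

Let x_le i : (i < m)%N -> x_ i <= x_ i.+1.
Proof. by move=> im; rewrite ltW// lt_sorted_ltn_nth// inE sm ltnS// ltnW. Qed.

Lemma quantile_nd : {homo quantile : t1 t2 / t1 <= t2}.
Proof.
move=> t1 t2 t12; rewrite lerD2l; apply: ler_sum => i _.
rewrite ler_wpM2l ?subr_ge0 ?x_le// ler_nat.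
by case: (ltP _ t1) => // h; rewrite (lt_le_trans h).
Qed.

Let Wx i : (i < m.+1)%N -> 0 < W (x_ i).
Proof. by move=> im; rewrite W0// mem_nth// sm. Qed.

Let cum_lt i j : (i <= j)%N -> (j <= m.+1)%N -> cum i <= cum j.
Proof.
elim: j => [|j ih]; first by rewrite leqn0 => /eqP ->.
rewrite leq_eqVlt => /orP[/eqP -> //|]; rewrite ltnS => ij jm.
by rewrite (le_trans (ih ij (ltnW jm)))// /cum big_ord_recr/= lerDl ltW// Wx.
Qed.

Let quantileE k t : (k < m.+1)%N -> cum k < t <= cum k.+1 -> quantile t = x_ k.
Proof.
move=> km /andP[t1 t2]; rewrite /quantile.
have -> : \sum_(i < m) (x_ i.+1 - x_ i) * (cum i.+1 < t)%R%:R =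
    \sum_(0 <= i < m) (x_ i.+1 - x_ i) * (cum i.+1 < t)%R%:R by rewrite big_mkord.
rewrite (big_cat_nat (n := k))//=.
rewrite [X in _ + (X + _)](eq_big_nat _ _ (F2 := fun i => x_ i.+1 - x_ i)); last first.
  move=> i /andP[_ ik]; rewrite (le_lt_trans (cum_lt ik (ltnW km)) t1) mulr1//.
rewrite telescope_sumr// [X in _ + (_ + X)]big_nat_cond big1 ?addr0 1?addrC ?subrK//.
move=> i /andP[/andP[ki im] _]; have h : cum k.+1 <= cum i.+1 by apply: cum_lt => //; exact: ltnW.
by rewrite ltNge (le_trans t2 h) mulr0.
Qed.

Lemma measurable_quantile : measurable_fun setT quantile.
Proof. by apply: nondecreasing_measurable => //; exact: quantile_nd. Qed.

(** The quantile function equals [x_ k] on ]cum k, cum k.+1], an interval of length [W (x_ k)]. *)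
Lemma Rintegral_quantile (phi : R -> R) (b : R) : measurable_fun setT phi ->
  (forall x, `|phi x| <= b) ->
  \int[mu]_(t in `]0, 1]) phi (quantile t) = \sum_(x <- s) W x * phi x.
Proof.
move=> mphi phib.
have mpq : measurable_fun setT (phi \o quantile).
  by apply: measurableT_comp => //; exact: measurable_quantile.
have ipq (l r : R) : mu.-integrable `]l, r] (EFin \o (phi \o quantile)).
  apply: measurable_bounded_integrable => //.
  - by rewrite /= lebesgue_measure_itv/=; case: ifP => // _; rewrite ltry.
  - exact: measurable_funTS.
  - exists b; split; first exact: num_real.
    by move=> B bB t _ /=; rewrite (le_trans (phib _))// ltW.
have key k : (k <= m.+1)%N ->
    \int[mu]_(t in `]0, cum k]) phi (quantile t) = \sum_(i < k) W (x_ i) * phi (x_ i).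
  elim: k => [|k ih] km.
    by rewrite big_ord0 /cum big_ord0 set_itvoc0 Rintegral_set0.
  have c0 : 0 <= cum k by have := cum_lt (leq0n k) (ltnW km); rewrite /cum big_ord0.
  have c1 : cum k <= cum k.+1 by exact: cum_lt.
  rewrite big_ord_recr/= -ih ?(ltnW km)//.
  rewrite -[LHS](subrK (\int[mu]_(t in `]0, cum k]) phi (quantile t))) addrC.
  congr (_ + _); have := @Rintegral_itvB _ (phi \o quantile) _ _ (cum k) (ipq 0 (cum k.+1)).
  rewrite !bnd_simp => /(_ c0 c1) /= ->.
  have -> : \int[mu]_(t in `]cum k, cum k.+1]) phi (quantile t) =
      \int[mu]_(t in `]cum k, cum k.+1]) (cst (phi (x_ k)) t).
    apply: eq_Rintegral => t; rewrite inE/= in_itv/= => tk.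
    by rewrite (@quantileE k).
  rewrite Rintegral_cst//= lebesgue_measure_itv/= lte_fin.
  have -> : cum k.+1 = cum k + W (x_ k) by rewrite /cum big_ord_recr.
  by rewrite ltrDl Wx//= addrAC subrr add0r mulrC.
have sE F : \sum_(x <- s) F x = \sum_(i < m.+1) F (x_ i).
  by rewrite (big_nth 0) sm big_mkord.
have <- : cum m.+1 = 1 by rewrite -W1 sE.
by rewrite key// sE.
Qed.

End Quantile.

(** * Helly's selection theorem *)

Section Helly.
Context {R : realType}.
Local Notation mu := (@lebesgue_measure R).

(** An enumeration of the rationals, with 0 for codes of no rational. *)
Let q (j : nat) : R := if choice.unpickle j is Some r then ratr (r : rat) else 0.

Let rat_between (s t : R) : s < t -> exists j, s < q j < t.
Proof.
move=> /rat_in_itvoo[r]; rewrite in_itv/= => rst; exists (choice.pickle r).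
by rewrite /q choice.pickleK.
Qed.

(** The ultrafilter limit defines [a] at every point, so it is monotone without extension from a
    dense set. A true sequence, needed for dominated convergence, is then chosen to converge at the
    rationals, and monotonicity gives convergence at the continuity points of [a]. The indices
    [n_ k] need not increase: k <= n_ k suffices for them to tend to infinity. *)
Lemma helly_selection (a_ : nat -> R -> R) (b l r : R) :
  (forall n, {homo a_ n : s t / s <= t}) -> (forall n t, `|a_ n t| <= b) ->
  exists (a : R -> R) (n_ : nat -> nat), [/\ {homo a : s t / s <= t},
    forall t, `|a t| <= b, forall k, (k <= n_ k)%N &
    {ae mu, forall t, t \in `]l, r[ -> a_ (n_ k) t @[k --> \oo] --> a t}].
Proof.
move=> a_nd a_b; have [U [UU oU]] := ultraFilterLemma (eventually_filter).
have h0 : forall t : R, exists x : R, a_ n t @[n --> U] --> x.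
  by move=> t; exists (lim (a_ n t @[n --> U])); apply: (ultra_cvgr UU (M := b)) => n.
have [a aE] := choice h0; clear h0.
have and_ : {homo a : s t / s <= t}.
  move=> s t st; apply: (ler_cvg_to (aE s) (aE t)).
  by apply: filterE => n; exact: a_nd.
have ab t : `|a t| <= b.
  rewrite ler_norml; apply/andP; split.
    apply: (cvgr_to_ge (aE t)); apply: filterE => n.
    by have := a_b n t; rewrite ler_norml => /andP[].
  apply: (cvgr_to_le (aE t)); apply: filterE => n.
  by have := a_b n t; rewrite ler_norml => /andP[].
have near_q (e : R) m : 0 < e ->
    \forall n \near U, forall j, (j < m)%N -> `|a_ n (q j) - a (q j)| < e.
  move=> e0; elim: m => [|m ih]; first exact: filterE.
  have := aE (q m) => /cvgrPdist_lt /(_ _ e0) h.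
  apply: filterS2 ih h => n h1 h2 j; rewrite ltnS leq_eqVlt => /orP[/eqP ->|/h1//].
  by rewrite distrC.
(* Diagonal choice: the k-th index controls the first [k] rationals with error 1/(k+1). *)
have h0 : forall k, exists n, (k <= n)%N /\
    forall j, (j < k)%N -> `|a_ n (q j) - a (q j)| < k.+1%:R^-1.
  move=> k; have Uk : \forall n \near U, (k <= n)%N by apply: oU; exact: nbhs_infty_ge.
  have k0 : 0 < k.+1%:R^-1 :> R by rewrite invr_gt0 ltr0n.
  have [n [n1 n2]] := @filter_ex _ U _ _ (filterI Uk (near_q _ k k0)).
  by exists n.
have [n_ nP] := choice h0; clear h0.
have cvq j : a_ (n_ k) (q j) @[k --> \oo] --> a (q j).
  apply/cvgrPdist_lt => e e0; near=> k.
  have [_ /(_ j) h] := nP k; rewrite distrC; apply: (lt_trans (h _)).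
    by near: k; exact: nbhs_infty_gt.
  by near: k; exact: near_infty_natSinv_lt (PosNum e0).
exists a, n_; split => //; first by move=> k; case: (nP k).
have ndlr : {in `[l, r] &, nondecreasing_fun a} by move=> x y _ _; exact: and_.
suff key (t : R) : t \in `]l, r[ -> ~ discontinuity a t ->
    a_ (n_ k) t @[k --> \oo] --> a t.
  exists [set x | x \in (`]l, r[) /\ discontinuity a x]; split.
  - apply: countable_measurable => //; exact: discontinuity_countable.
  - exact/countable_lebesgue_measure0/discontinuity_countable.
  move=> t /= /not_implyP[tlr tn]; split => //; apply: contrapT => nd; apply: tn.
  exact: key.
move=> tlr nd.
have cl : cvg (a x @[x --> t^'-]).
  apply: nondecreasing_at_left_is_cvgr; first by near=> s => x y _ _; exact: and_.
  by near=> s; exists (a t) => _ [y + <-]; rewrite /= in_itv/= => /andP[_ /ltW/and_].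
have cr : cvg (a x @[x --> t^'+]).
  apply: nondecreasing_at_right_is_cvgr; first by near=> s => x y _ _; exact: and_.
  by near=> s; exists (a t) => _ [y + <-]; rewrite /= in_itv/= => /andP[/ltW/and_].
have lr : lim (a x @[x --> t^'-]) = lim (a x @[x --> t^'+]).
  by apply: contrapT => /eqP h; apply: nd; split.
set z := lim (a x @[x --> t^'-]) in lr.
(* At a continuity point, rationals on both sides of [t] have values of [a] within [e] of the common
   one-sided limit; monotonicity squeezes everything at [t] between them. *)
have qe (e : R) : 0 < e -> exists i j, [/\ q i < t, t < q j, z - e < a (q i) & a (q j) < z + e].
  move=> e0.
  have /cvgrPdist_lt/(_ _ e0) hl := cl.
  have /cvgrPdist_lt/(_ _ e0) hr := cr.
  rewrite -lr -/z in hr.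
  have [s [s1 s2]] := @filter_ex _ (t^'-) _ _ (filterI hl (nbhs_left_lt t)).
  have [s' [s1' s2']] := @filter_ex _ (t^'+) _ _ (filterI hr (nbhs_right_gt t)).
  have [i /andP[i1 i2]] := rat_between s2.
  have [j /andP[j1 j2]] := rat_between s2'.
  exists i, j; split => //.
    move: s1; rewrite ltr_distlC => /andP[s1 _]; apply: (lt_le_trans s1).
    exact/and_/ltW.
  move: s1'; rewrite ltr_distlC => /andP[_]; apply: le_lt_trans.
  exact/and_/ltW.
have az : a t = z.
  apply/eqP; rewrite -subr_eq0 -normr_le0; apply/ler_addgt0Pl => e e0.
  have [i [j [i1 j1 i2 j2]]] := qe _ e0.
  have := and_ _ _ (ltW i1); have := and_ _ _ (ltW j1).
  rewrite addr0 ler_norml; lra.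
apply/cvgrPdist_lt => e e0.
have e2 : 0 < e / 2 by rewrite divr_gt0.
have [i [j [i1 j1 i2 j2]]] := qe _ e2.
have /cvgrPdist_lt /(_ _ e2) hi := cvq i.
have /cvgrPdist_lt /(_ _ e2) hj := cvq j.
apply: filterS2 hi hj => k; rewrite !ltr_distlC => hi hj.
have := a_nd (n_ k) _ _ (ltW i1); have := a_nd (n_ k) _ _ (ltW j1).
rewrite az; lra.
Unshelve. all: by end_near. Qed.

End Helly.

Section MonotoneLimit.
Context {R : realType}.
Local Notation mu := (@lebesgue_measure R).
Local Notation I := (`]0, 1]%classic : set R).

Lemma integrable_bounded_unit (h : R -> R) (b : R) : measurable_fun setT h ->
  (forall t, `|h t| <= b) -> mu.-integrable I (EFin \o h).
Proof.
move=> mh hb; apply: measurable_bounded_integrable => //.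
- by rewrite /= lebesgue_measure_itv/= lte01 ltry.
- exact: measurable_funTS.
- exists b; split; first exact: num_real.
  by move=> B bB t _ /=; rewrite (le_trans (hb _))// ltW.
Qed.

Lemma Rintegral_uniform (h : R -> R) (b : R) : measurable_fun setT h ->
  (forall t, `|h t| <= b) ->
  \int[uniform_prob (@ltr01 R)]_t h t = \int[mu]_(t in I) h t.
Proof.
move=> mh hb.
have ih : (uniform_prob (@ltr01 R)).-integrable setT (EFin \o h).
  apply: measurable_bounded_integrable => //.
  - by rewrite -ge0_fin_numE ?fin_num_measure.
  - exists b; split; first exact: num_real.
    by move=> B bB t _ /=; rewrite (le_trans (hb _))// ltW.
have ib : (uniform_prob (@ltr01 R)).-integrable setT (EFin \o cst b).
  apply: measurable_bounded_integrable => //.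
  - by rewrite -ge0_fin_numE ?fin_num_measure.
  - exists `|b|; split; first exact: num_real.
    by move=> B bB t _ /=; rewrite ltW.
have ibI : mu.-integrable I (EFin \o cst b).
  by apply: (@integrable_bounded_unit (cst b) `|b|).
have ihI := integrable_bounded_unit mh hb.
(* Adding [b] makes the integrand nonnegative, as [integral_uniform] requires. *)
apply: (@addIr _ b).
have h0 t : 0 <= h t + b by have := hb t; rewrite ler_norml; lra.
transitivity (\int[mu]_(t in I) (h t + b)); last first.
  rewrite RintegralD//; congr (_ + _).
  have /= -> := @Rintegral_cst _ _ _ mu I (measurable_itv _) b.
  by rewrite lebesgue_measure_itv/= lte01/= subr0 mulr1.
transitivity (\int[uniform_prob (@ltr01 R)]_t (h t + b)).
  rewrite RintegralD//; congr (_ + _).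
  have /= -> := @Rintegral_cst _ _ _ (uniform_prob (@ltr01 R)) setT measurableT b.
  by rewrite probability_setT mulr1.
rewrite Rintegral_itv_obnd_cbnd//; last first.
  apply: (@integrable_bounded_unit (fun t => h t + b) (b + b)).
    exact: measurable_funD.
  by move=> t; rewrite ger0_norm// lerD2r; have := hb t; rewrite ler_norml => /andP[].
rewrite /Rintegral integral_uniform//.
- by rewrite subr0 invr1 mul1e.
- by apply/measurable_EFinP; exact: measurable_funD.
Qed.

Variables (T : R[i] -> R[i]) (M : R) (a_ : nat -> R -> R).
Hypothesis a_nd : forall n, {homo a_ n : s t / s <= t}.
Hypothesis a_b : forall n t, `|a_ n t| <= pi / 2.
Hypothesis a_re : forall u, nonreal u ->
  \int[mu]_(t in I) gre u (a_ n t) @[n --> \oo] --> complex.Re (T u).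
Hypothesis a_im : forall u, nonreal u ->
  \int[mu]_(t in I) gim u (a_ n t) @[n --> \oo] --> complex.Im (T u).
Hypothesis T_mass : forall y, 0 < y -> 1 - M / y ^+ 2 <= - y * complex.Im (T (iy y)).

(** The measure is the image of Lebesgue measure on ]0, 1] under the tangent of the Helly limit of
    the angles [a_ n]. The compactified kernels are continuous and bounded in the angle, so
    dominated convergence applies. *)
Lemma stieltjes_limit : exists tau : probability (measurableTypeR R) R,
  forall u, nonreal u -> stieltjes tau u = T u.
Proof.
have [a [n_ [and_ ab n_k cva]]] := helly_selection 0 2 a_nd a_b.
have ma : measurable_fun setT a by exact: nondecreasing_measurable.
have ma_ n : measurable_fun setT (a_ n) by apply: nondecreasing_measurable => //; exact: a_nd.
have n_oo : n_ k @[k --> \oo] --> \oo.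
  move=> A [N _ NA]; exists N => // k /= Nk; apply: NA => /=.
  exact: leq_trans Nk (n_k k).
have lim_eq (g : R -> R) b l : continuous g -> (forall t, `|g t| <= b) ->
    \int[mu]_(t in I) g (a_ n t) @[n --> \oo] --> l ->
    \int[mu]_(t in I) g (a t) = l.
  move=> cg gb gl.
  have mg : measurable_fun setT g by exact: continuous_measurable_fun.
  have mga_ n : measurable_fun setT (g \o a_ n) by exact: measurableT_comp.
  have mga : measurable_fun setT (g \o a) by exact: measurableT_comp.
  have h1 k : measurable_fun I (fun t => (g (a_ (n_ k) t))%:E).
    by apply: measurable_funTS; apply/measurable_EFinP; exact: mga_.
  have h2 : measurable_fun I (fun t => (g (a t))%:E).
    by apply: measurable_funTS; apply/measurable_EFinP; exact: mga.
  have h3 : {ae mu, forall t, I t -> (g (a_ (n_ k) t))%:E @[k --> \oo] --> (g (a t))%:E}.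
    apply: filterS cva; first exact: (ae_filter_ringOfSetsType mu).
    move=> t cvt It; apply: cvg_EFin; first exact: nearW.
    by apply: continuous_cvg; [exact: cg|apply: cvt; move: It; rewrite /= !in_itv/=; lra].
  have h4 : mu.-integrable I (fun _ => b%:E).
    by apply: (@integrable_bounded_unit (cst b) `|b|).
  have h5 : {ae mu, forall t k, I t -> (`|(g (a_ (n_ k) t))%:E| <= b%:E)%E}.
    by apply: aeW => t k _; rewrite lee_fin.
  have [i1 _ i2] := @dominated_convergence _ (measurableTypeR R) R mu I (measurable_itv _)
    _ _ _ h1 h2 h3 h4 h5.
  have i3 : \int[mu]_(t in I) g (a_ (n_ k) t) @[k --> \oo] --> \int[mu]_(t in I) g (a t).
    apply: fine_cvg; rewrite fineK//.
    exact: integrable_fin_num i1.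
  apply: (cvg_unique (@Rhausdorff R) i3).
  exact: cvg_comp n_oo gl.
have reE u : nonreal u -> \int[mu]_(t in I) gre u (a t) = complex.Re (T u).
  move=> u0; apply: lim_eq (a_re u0); first exact: continuous_gre.
  by move=> t; exact: norm_gre.
have imE u : nonreal u -> \int[mu]_(t in I) gim u (a t) = complex.Im (T u).
  move=> u0; apply: lim_eq (a_im u0); first exact: continuous_gim.
  by move=> t; exact: norm_gim.
have mcos : measurable_fun setT (fun t => cos (a t)).
  by apply: measurableT_comp => //; apply: continuous_measurable_fun; exact: continuous_cos.
have msin : measurable_fun setT (fun t => sin (a t)).
  by apply: measurableT_comp => //; apply: continuous_measurable_fun; exact: continuous_sin.
(* [Z] collects the mass that escapes to infinity. The kernel vanishes there, so - y Im T(iy) <= 1 -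
   mu Z, whereas [T_mass] bounds the left side below by 1 - M / y^2. *)
pose Z : set (measurableTypeR R) := I `&` [set t | cos (a t) = 0].
have mZ : measurable Z.
  by apply: measurableI => //; have := mcos measurableT [set 0] (measurable_set1 0); rewrite setTI.
have Z0 : mu Z = 0%E.
  have Zfin : mu Z \is a fin_num.
    rewrite ge0_fin_numE//; apply: (@le_lt_trans _ _ (mu I)).
      by apply: le_measure; rewrite ?inE//; exact: subIsetl.
    by rewrite lebesgue_measure_itv/= lte01 ltry.
  apply/eqP; rewrite -(fineK Zfin) eqe eq_le fine_ge0// andbT.
  have mI : mu I = 1%E by rewrite lebesgue_measure_itv/= lte01 sube0.
  have bound y : 0 < y -> fine (mu Z) <= M / y ^+ 2.
    move=> y0; have iy0 : nonreal (iy y) by rewrite /nonreal/= gt_eqF.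
    have mgim : measurable_fun setT (fun t => gim (iy y) (a t)).
      by apply: measurableT_comp => //; apply: continuous_measurable_fun; exact: continuous_gim.
    have igim := integrable_bounded_unit mgim (fun t => norm_gim (a t) iy0).
    have iZ : mu.-integrable I (EFin \o (\1_Z : R -> R)).
      apply: (@integrable_bounded_unit _ 1); first exact: measurable_indic.
      by move=> t; rewrite indicE; case: (_ \in _); rewrite ?normr1 ?normr0.
    have i1 : mu.-integrable I (EFin \o cst (1 : R)).
      by apply: (@integrable_bounded_unit (cst 1) 1) => // t; rewrite normr1.
    have := T_mass y0; rewrite -imE// => h.
    have : - y * \int[mu]_(t in I) gim (iy y) (a t) <=
        \int[mu]_(t in I) (1 - \1_Z t).
      rewrite -RintegralZl//; apply: le_Rintegral => //.
      - rewrite (_ : EFin \o _ = (fun t => (- y)%:E * (gim (iy y) (a t))%:E)%E)//.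
        exact: integrableZl.
      - by apply: eq_integrable (integrableB _ i1 iZ).
      move=> t It; rewrite indicE; case: (boolP (t \in Z)) => [|/negP tZ].
        by rewrite inE => -[_ ct]; rewrite gim0// mulr0 subrr.
      rewrite subr0 /gim /gden/= !mulNr mulrN opprK.
      have ct : cos (a t) != 0 by apply/eqP => ct; apply: tZ; rewrite inE.
      have d0 : 0 < (0 * cos (a t) - sin (a t)) ^+ 2 + (y * cos (a t)) ^+ 2.
        by rewrite ltr_wpDl ?sqr_ge0// exprn_even_gt0//= mulf_neq0// gt_eqF.
      rewrite mulrA ler_pdivrMr// mul1r.
      have := sqr_ge0 (0 * cos (a t) - sin (a t)); nra.
    rewrite RintegralB// => /(le_trans h).
    have /= -> := @Rintegral_cst _ _ _ mu I (measurable_itv _) (1 : R).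
    have -> : \int[mu]_(t in I) \1_Z t = fine (mu Z).
      by rewrite /Rintegral integral_indic// setIidl//; exact: subIsetl.
    by rewrite mI mulr1/= => h'; lra.
  case: (leP (fine (mu Z)) 0) => // Zpos; exfalso.
  (* Chosen so that M < mu Z * y, while y >= 1 gives mu Z * y <= mu Z * y^2: this contradicts
     [bound]. *)
  pose y := (`|M| + 1) / fine (mu Z) + 1.
  have y1 : 1 <= y by rewrite /y lerDr divr_ge0// ?addr_ge0// ltW.
  have y0 : 0 < y by rewrite (lt_le_trans _ y1).
  have := bound y y0; rewrite leNgt => /negP; apply.
  rewrite ltr_pdivrMr ?exprn_gt0//; apply: (@lt_le_trans _ _ (fine (mu Z) * y)).
    rewrite /y mulrDr mulr1 mulrC divfK ?gt_eqF//.
    by have := ler_norm M; lra.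
  by rewrite ler_wpM2l ?(ltW Zpos)// expr2 ler_peMl// ltW.
(* Equal to the tangent where the cosine is nonzero, hence positive as |a t| <= pi/2, and measurable
   on the whole line as a composite of measurable functions. *)
pose X t := sin (a t) * expR (- ln (cos (a t))).
have mX : measurable_fun setT X.
  apply: measurable_funM => //; apply: measurableT_comp => //.
  apply: measurableT_comp => //; apply: (measurableT_comp (@measurable_ln R)).
  exact: mcos.
have XE t : cos (a t) != 0 -> X t = tan (a t).
  move=> ct; rewrite /X expRN lnK//; rewrite posrE lt_def ct/=.
  by apply: cos_ge0_pihalf; rewrite -ler_norml.
have ne_ae : {ae mu, forall t, I t -> cos (a t) != 0}.
  exists Z; split => // t /= /not_implyP[It /negP]; rewrite negbK => /eqP ct.
  by split.
have mX' : @measurable_fun _ _ (measurableTypeR R) (measurableTypeR R) setT X := mX.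
pose X' : {mfun (measurableTypeR R) >-> (measurableTypeR R)} :=
  @mfun_Sub _ _ (measurableTypeR R) (measurableTypeR R) X (mem_set mX').
exists (distribution (uniform_prob (@ltr01 R)) X') => u u0.
have key (k g : R -> R) : measurable_fun setT k -> measurable_fun setT g ->
    (forall c, `|k c| <= `|complex.Im u|^-1) ->
    (forall t, cos t != 0 -> g t = k (tan t)) ->
    \int[distribution (uniform_prob (@ltr01 R)) X']_c k c = \int[mu]_(t in I) g (a t).
  move=> mk mg kb gk.
  have mkX : measurable_fun setT (k \o X) by exact: measurableT_comp.
  transitivity (\int[uniform_prob (@ltr01 R)]_t k (X t)).
    rewrite /Rintegral integral_distribution//; [exact/measurable_EFinP|].
    apply: measurable_bounded_integrable => //.
    - by rewrite -ge0_fin_numE ?fin_num_measure.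
    - exists `|complex.Im u|^-1; split; first exact: num_real.
      by move=> B bB t _ /=; rewrite (le_trans (kb _))// ltW.
  rewrite (Rintegral_uniform mkX (fun t => kb (X t))) /Rintegral; congr (fine _).
  apply: ae_eq_integral => //.
  - by apply/measurable_EFinP; exact: measurable_funTS.
  - by apply/measurable_EFinP; apply: measurable_funTS; exact: measurableT_comp.
  - apply: filterS ne_ae; first exact: (ae_filter_ringOfSetsType mu).
    by move=> t h It; have h' := h It; rewrite /= XE// gk.
rewrite /stieltjes /Cintegral.
rewrite (key (kre u) (gre u)); last first.
- by move=> t; exact: gre_tan.
- by move=> c; exact: norm_kre.
- by apply: continuous_measurable_fun; exact: continuous_gre.
- exact: measurable_kre.
rewrite (key (kim u) (gim u)); last first.
- by move=> t; exact: gim_tan.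
- by move=> c; exact: norm_kim.
- by apply: continuous_measurable_fun; exact: continuous_gim.
- exact: measurable_kim.
by rewrite reE// imE//; case: (T u).
Qed.

End MonotoneLimit.

(** * Profiles with a given shifted Rayleigh function *)

Section MeasurableDerivative.
Context {R : realType}.
Variable f : R -> R.
Hypothesis cf : continuous f.

Let q (h x : R) : R := h^-1 * (f (h + x) - f x).

Let continuous_q h : continuous (q h).
Proof.
move=> x; have h1 : h + z @[z --> x] --> h + x by apply: cvgD; [exact: cvg_cst|exact: cvg_id].
have h2 : {for x, continuous (f \o (fun z => h + z))}.
  by apply: continuous_comp; [exact: h1|exact: cf].
apply: cvgM; first exact: cvg_cst.
by apply: cvgB; [exact: h2|exact: cf].
Qed.

Let small (m : nat) (h : R) := h != 0 /\ `|h| < m.+1%:R^-1.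

Let near_small (P : R -> Prop) (m : nat) : (forall h, small m h -> P h) ->
  \forall h \near (0 : R)^', P h.
Proof.
move=> hP; have m0 : 0 < m.+1%:R^-1 :> R by rewrite invr_gt0.
rewrite near_withinE; apply/nbhs_ballP; exists m.+1%:R^-1 => //= h.
by rewrite /ball/= sub0r normrN => hm h0; apply: hP.
Qed.

Let small_near (P : R -> Prop) : (\forall h \near (0 : R)^', P h) ->
  exists m, forall h, small m h -> P h.
Proof.
rewrite near_withinE => /nbhs_ballP[d /= d0 hd].
have [m _ hm] := near_infty_natSinv_lt (PosNum d0); exists m => h [h0 hs].
apply: hd => //=; rewrite /ball/= sub0r normrN (lt_trans hs)//.
by have := hm m; rewrite /= => /(_ (leqnn m)).
Qed.

(* Closed, since [f] is continuous; [f] is differentiable exactly on [D]. *)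
Let A (k m : nat) : set R := \bigcap_(p in [set p : R * R | small m p.1 /\ small m p.2])
  [set x | `|q p.1 x - q p.2 x| <= k.+1%:R^-1].

Let D := \bigcap_k \bigcup_m A k m.

Let mD : measurable D.
Proof.
apply: bigcap_measurable => // k _; apply: bigcup_measurable => m _.
apply: closed_measurable; apply: closed_bigI => -[h h'] _ /=.
apply: (@closed_comp _ _ (fun x => `|q h x - q h' x|) [set y | y <= k.+1%:R^-1]).
  move=> x _; apply: (@continuous_comp _ _ _ (fun x => q h x - q h' x)).
    by apply: cvgB; exact: continuous_q.
  exact: norm_continuous.
exact: closed_le.
Qed.

Let DE x : D x <-> cvg (q ^~ x @ (0 : R)^').
Proof.
split=> [Dx|/cvg_ex[/= l /cvgrPdist_lt cq] k _].
  apply: cauchy_cvg; apply: cauchy_exP => e e0.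
  have [k _ hk] := near_infty_natSinv_lt (PosNum e0).
  have [m _ Am] := Dx k I.
  have m0 : 0 < m.+1%:R^-1 :> R by rewrite invr_gt0.
  pose h0 : R := m.+1%:R^-1 / 2.
  have sh0 : small m h0.
    split; first by rewrite /h0 gt_eqF// divr_gt0.
    by rewrite ger0_norm ?divr_ge0 ?(ltW m0)// ltr_pdivrMr// ltr_pMr// ltr1n.
  exists (q h0 x); apply: (near_small (m := m)) => h sh.
  apply: le_lt_trans (Am (h0, h) _) _ => //.
  by have := hk k (leqnn k).
have k0 : 0 < k.+1%:R^-1 / 2 :> R by rewrite divr_gt0// invr_gt0.
have [m hm] := small_near (cq _ k0); exists m => // -[h h'] /= [sh sh'].
have h1 : `|q h x - l| <= k.+1%:R^-1 / 2 by rewrite distrC ltW//; exact: hm.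
have h2 : `|l - q h' x| <= k.+1%:R^-1 / 2 by rewrite ltW//; exact: hm.
rewrite /= -(subrKA l) (le_trans (ler_normD _ _))//.
by rewrite (le_trans (lerD h1 h2))// -splitr.
Qed.

Lemma measurable_derive1 : measurable_fun setT (derive1 f).
Proof.
have m1 : measurable_fun D (derive1 f).
  apply: (@measurable_fun_cvg _ _ _ D (fun n => q n.+1%:R^-1)).
    by move=> n; apply: measurable_funTS; apply: continuous_measurable_fun.
  move=> x /DE /= cq; apply: (@cvg_comp _ _ _ (fun n : nat => n.+1%:R^-1 : R) (q ^~ x)) cq.
  move=> P [d /= d0 hd].
  have [m _ hm] := near_infty_natSinv_lt (PosNum d0); exists m => // n /= mn.
  apply: hd; last by rewrite /= invr_eq0 pnatr_eq0.
  rewrite /ball/= sub0r normrN ger0_norm ?invr_ge0//.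
  exact: hm.
(* Off [D] the difference quotients diverge, and [derive1 f] is the constant default value of a
   limit. *)
have m2 : measurable_fun (~` D) (derive1 f).
  apply: (@eq_measurable_fun _ _ _ _ _ (cst (point : R))) => // x.
  rewrite inE => /DE ncq; apply/esym; exact: dvgP ncq.
rewrite -(setUv D); apply/measurable_funU => //; exact: measurableC.
Qed.

End MeasurableDerivative.

Section Profile.
Context {R : realType}.
Local Notation mu := (@lebesgue_measure R).

Lemma lipschitz_continuous (f : R -> R) : 1.-lipschitz f -> continuous f.
Proof.
move=> lf x; apply/cvgrPdist_lt => e e0; near=> y.
have h : `|f x - f y| <= 1 * `|x - y| := lf (x, y) (conj I I).
rewrite (le_lt_trans h)// mul1r.
by near: y; apply: cvgr_dist_lt.
Unshelve. all: by end_near. Qed.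

(** Off 0, |x| has slope 2 * 1_[0, +oo[ - 1, so adding twice a primitive of [xi] gives the slope 2
    (xi + 1_[0, +oo[) - 1, which lies in [-1, 1] because [xi] is shifted. *)
Lemma exists_primitive_profile (xi : R -> R) :
  mu.-integrable setT (EFin \o xi) -> shifted xi ->
  exists f : R -> R, 1.-lipschitz f /\
    {ae mu, forall c, derive1 f c = 2 * (xi c + \1_`[0, +oo[ c) - 1}.
Proof.
move=> ixi sxi.
pose G y := \int[mu]_(t in `]-oo, y]) xi t.
have iy (A : set (measurableTypeR R)) : measurable A -> mu.-integrable A (EFin \o xi).
  by move=> mA; apply: integrableS ixi.
have i1 (x y : R) (r : R) : mu.-integrable `]x, y[ (EFin \o cst r).
  apply: measurable_bounded_integrable => //.
  - by rewrite /= lebesgue_measure_itv/=; case: ifP => // _; rewrite ltry.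
  - exists `|r|; split; first exact: num_real.
    by move=> B bB t _ /=; rewrite ltW.
have GB x y : x <= y -> G y - G x = \int[mu]_(t in `]x, y[) xi t.
  move=> xy; have := @Rintegral_itvB _ xi -oo%O (BRight y) x (iy _ (measurable_itv _)).
  by rewrite !bnd_simp => /(_ isT xy) ->; rewrite -Rintegral_itv_bndo_bndc//; exact: iy.
have cstE x y r : x <= y -> \int[mu]_(t in `]x, y[) (cst r t) = r * (y - x).
  move=> xy; rewrite Rintegral_cst//= lebesgue_measure_itv/= lte_fin.
  by case: ltP => //= yx; rewrite (@le_anti _ _ x y) ?subrr ?xy.
have Gpos x y : 0 <= x -> x <= y -> - (y - x) <= G y - G x <= 0.
  move=> x0 xy; rewrite GB//; apply/andP; split.
    rewrite -mulN1r -(cstE _ _ (-1) xy); apply: le_Rintegral => //; first exact: iy.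
    move=> t /=; rewrite in_itv/= => /andP[xt _]; have := sxi t.
    by rewrite indic_ge0 (le_trans x0 (ltW xt))/= => /andP[h _]; lra.
  rewrite -(mul0r (y - x)) -(cstE _ _ 0 xy); apply: le_Rintegral => //; first exact: iy.
  move=> t /=; rewrite in_itv/= => /andP[xt _]; have := sxi t.
  by rewrite indic_ge0 (le_trans x0 (ltW xt))/= => /andP[_ h]; lra.
have Gneg x y : y <= 0 -> x <= y -> 0 <= G y - G x <= y - x.
  move=> y0 xy; rewrite GB//; apply/andP; split.
    rewrite -(mul0r (y - x)) -(cstE _ _ 0 xy); apply: le_Rintegral => //; first exact: iy.
    move=> t /=; rewrite in_itv/= => /andP[_ ty]; have := sxi t.
    by rewrite indic_ge0 (leNgt 0 t) (lt_le_trans ty y0)/= => /andP[h _]; lra.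
  rewrite -[leRHS]mul1r -(cstE _ _ 1 xy); apply: le_Rintegral => //; first exact: iy.
  move=> t /=; rewrite in_itv/= => /andP[_ ty]; have := sxi t.
  by rewrite indic_ge0 (leNgt 0 t) (lt_le_trans ty y0)/= => /andP[_ h]; lra.
pose f x := `|x| + 2 * G x.
(* On each half-line |x| is linear and the increments of [G] have a sign; an interval containing 0
   is cut there. *)
have fle x y : x <= y -> `|f x - f y| <= y - x.
  move=> xy; rewrite /f ler_norml.
  have [x0|x0] := lerP 0 x.
    by have := Gpos x y x0 xy; rewrite !ger0_norm ?(le_trans x0)//; lra.
  have [y0|y0] := lerP y 0.
    by have := Gneg x y y0 xy; rewrite !ler0_norm ?(ltW x0)//; lra.
  have := Gneg x 0 (lexx _) (ltW x0); have := Gpos 0 y (lexx _) (ltW y0).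
  by rewrite (gtr0_norm y0) (ltr0_norm x0); lra.
exists f; split.
  move=> [x y] _ /=; rewrite mul1r; have [xy|/ltW yx] := lerP x y.
    by rewrite (le_trans (fle _ _ xy))// distrC ler_norm.
  by rewrite distrC (le_trans (fle _ _ yx))// ler_norm.
have locxi : locally_integrable [set: R] xi.
  by apply: open_integrable_locally; [exact: openT|exact: ixi].
have := FTC1Ny (fun y => iy _ (measurable_itv _)) locxi => /= aeG.
have ae0 : {ae mu, forall c, c != 0}.
  exists [set (0 : R)]; split => //; first exact: lebesgue_measure_set1.
  by move=> c /= /negP; rewrite negbK => /eqP.
apply: filterS2 aeG ae0; first exact: (ae_filter_ringOfSetsType mu).
suff key (c : R) : derivable G c 1 /\ G^`()%classic c = xi c -> c != 0 ->
    derive1 f c = 2 * (xi c + \1_`[0, +oo[ c) - 1 by move=> c; exact: key.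
move=> [dG dGE] c0.
have isG : is_derive c 1 G (xi c) by apply: DeriveDef => //; rewrite -derive1E.
rewrite derive1E indic_ge0.
have abs_der : is_derive c 1 (Num.norm : R -> R) (2 * (0 <= c)%R%:R - 1).
  have [c1|c1] := ltrP 0 c.
    rewrite (ltW c1)/= (_ : 2 * 1 - 1 = 1); last by ring.
    apply: (@near_eq_is_derive _ _ _ id) (is_derive_id _ _).
    by near=> z; rewrite ger0_norm//; near: z; exact: (cvgr_ge c cvg_id 0 c1).
  have {}c1 : c < 0 by rewrite lt_neqAle c0.
  rewrite leNgt c1/= mulr0 sub0r.
  apply: (@near_eq_is_derive _ R R -%R).
    by near=> z; rewrite ler0_norm//; near: z; exact: (cvgr_le c cvg_id 0 c1).
have := is_deriveD abs_der (is_deriveZ 2 isG).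
move=> [_ h]; rewrite (_ : f = Num.norm + 2 \*: G) ?h//.
rewrite /GRing.scale/=; ring.
Unshelve. all: by end_near. Qed.

End Profile.

Section ProfileOfShift.
Context {R : realType}.
Local Notation mu := (@lebesgue_measure R).
Variable xi : R -> R.
Hypotheses (ixi : mu.-integrable setT (EFin \o xi)) (sxi : shifted xi).

(** Almost everywhere 1 + f' = 2 |xi| on the negative half-line and 1 - f' = 2 |xi| on the positive
    one. As 1 + |c| >= 1, integrability of [xi] gives both conditions on a profile. *)
Theorem exists_profile : exists f : R -> R, [/\ profile f,
  mu.-integrable setT (EFin \o shifted_rayleigh f) &
  forall u, nonreal u -> T_up f u = u^-1 * expC (- cauchy mu xi u)].
Proof.
have [f [lf aef]] := exists_primitive_profile ixi sxi.
have mxi : measurable_fun setT xi by apply/measurable_EFinP; exact: measurable_int ixi.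
have md : measurable_fun setT (derive1 f).
  by apply: measurable_derive1; exact: lipschitz_continuous lf.
have m1 : measurable_fun setT (\1_`[0, +oo[ : R -> R).
  by apply: measurable_indic; exact: measurable_itv.
have ms : measurable_fun setT (shifted_rayleigh f).
  by apply: measurable_funB => //; apply: measurable_funM => //; exact: measurable_funD.
have aexi : {ae mu, forall c, shifted_rayleigh f c = xi c}.
  apply: filterS aef; first exact: (ae_filter_ringOfSetsType mu).
  by move=> c /= h; rewrite /shifted_rayleigh /rayleigh h; field.
have ae0 : {ae mu, forall c, c != 0}.
  exists [set (0 : R)]; split => //; first exact: lebesgue_measure_set1.
  by move=> c /= /negP; rewrite negbK => /eqP.
have minv : measurable_fun setT (fun c : R => (1 + `|c|)^-1).
  apply: continuous_measurable_fun => c; apply: cvgV; first by rewrite gt_eqF// ltr_wpDr.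
  by apply: cvgD; [exact: cvg_cst|exact: norm_continuous].
have mabs : measurable_fun setT (fun c => `|xi c|).
  by apply: measurableT_comp; [exact: normr_measurable|exact: mxi].
have mk : measurable_fun setT (fun c => 2 * `|xi c| / (1 + `|c|)).
  by apply: measurable_funM => //; exact: measurable_funM.
have bound (A : set (measurableTypeR R)) : measurable A ->
    (\int[mu]_(c in A) (2 * `|xi c| / (1 + `|c|))%:E < +oo)%E.
  move=> mA; apply: (@le_lt_trans _ _ (\int[mu]_(c in A) (2%:E * `|(xi c)%:E|))%E).
    apply: ge0_le_integral => //.
    - by apply: measurable_funTS; apply/measurable_EFinP.
    - apply: measurable_funTS; apply/measurable_EFinP.
      by apply: measurable_funM.
    - move=> c _; rewrite lee_fin ler_pdivrMr ?ltr_wpDr// ler_peMr ?mulr_ge0//.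
      by rewrite lerDl.
  rewrite ge0_integralZl//; last by apply: measurable_funTS; apply/measurable_EFinP.
  rewrite lte_mul_pinfty// ?lee_fin//.
  by have /integrableP[_] := integrableS measurableT mA (@subsetT _ _) ixi.
have prof : profile f.
  split => //.
  - rewrite (@ae_eq_integral _ (measurableTypeR R) R mu _
      (fun c => (2 * `|xi c| / (1 + `|c|))%:E)); first exact: bound.
    + exact: measurable_itv.
    + apply: measurable_funTS; apply/measurable_EFinP; apply: measurable_funM => //.
      exact: measurable_funD.
    + by apply: measurable_funTS; apply/measurable_EFinP.
    + apply: filterS2 aef ae0; first exact: (ae_filter_ringOfSetsType mu).
      move=> c /= h c0; rewrite in_itv/= => cle; congr (_ / _)%:E.
      have := sxi c; rewrite h indic_ge0 (leNgt 0 c) lt_neqAle c0 cle/= => /andP[h1 _].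
      by rewrite ger0_norm; lra.
  - rewrite (@ae_eq_integral _ (measurableTypeR R) R mu _
      (fun c => (2 * `|xi c| / (1 + `|c|))%:E)); first exact: bound.
    + exact: measurable_itv.
    + apply: measurable_funTS; apply/measurable_EFinP; apply: measurable_funM => //.
      exact: measurable_funB.
    + by apply: measurable_funTS; apply/measurable_EFinP.
    + apply: filterS aef; first exact: (ae_filter_ringOfSetsType mu).
      move=> c /= h; rewrite in_itv/= andbT => cge; congr (_ / _)%:E.
      have := sxi c; rewrite h indic_ge0 cge/= => /andP[_ h1].
      by rewrite ler0_norm; lra.
exists f; split => //.
  apply/integrableP; split; first exact/measurable_EFinP.
  rewrite (@ae_eq_integral _ (measurableTypeR R) R mu _ (fun c => `|(xi c)%:E|%E)) //.
  - by have /integrableP[] := ixi.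
  - by apply: measurableT_comp => //; apply/measurable_EFinP.
  - by apply: measurableT_comp => //; apply/measurable_EFinP.
  - apply: filterS aexi; first exact: (ae_filter_ringOfSetsType mu).
    by move=> c /= -> _.
move=> u u0; rewrite /T_up -/(cauchy mu (shifted_rayleigh f) u) !cauchyE.
have E (k : R -> R) : measurable_fun setT k ->
    \int[mu]_c (shifted_rayleigh f c * k c) = \int[mu]_c (xi c * k c).
  move=> mk'; rewrite /Rintegral; congr (fine _); apply: ae_eq_integral => //.
  - by apply/measurable_EFinP; exact: measurable_funM.
  - by apply/measurable_EFinP; exact: measurable_funM.
  - apply: filterS aexi; first exact: (ae_filter_ringOfSetsType mu).
    by move=> c /= -> _.
by rewrite !E//; [exact: measurable_kim|exact: measurable_kre].
Qed.

End ProfileOfShift.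

(** * Uniqueness *)

Section Inversion.
Context {R : realType}.
Local Notation mu := (@lebesgue_measure R).
Variable d : R -> R.
Hypothesis id_ : mu.-integrable setT (EFin \o d).

Let nu (x y : R) := (x +i* y)%C.

Let md : measurable_fun setT d.
Proof. by apply/measurable_EFinP; exact: measurable_int id_. Qed.

Let iabs : mu.-integrable setT (EFin \o (fun c => `|d c|)).
Proof. exact: integrable_abse id_. Qed.

(* The imaginary part of the Cauchy transform is continuous along a vertical
   line, tends to [0] at infinity and takes its values in [2 pi Z]. *)
Lemma cauchy_im_eq0 : (forall u, nonreal u -> expC (cauchy mu d u) = 1) ->
  forall x y, 0 < y -> \int[mu]_c (d c * kim (x +i* y)%C c) = 0.
Proof.
move=> hd x y0 y0_gt0; pose v y := \int[mu]_c (d c * kim (x +i* y)%C c).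
have nr y : 0 < y -> nonreal (x +i* y)%C by move=> y_gt0; rewrite /nonreal/= gt_eqF.
have cosv y : 0 < y -> cos (v y) = 1.
  move=> /nr u0; have := hd _ u0; rewrite cauchyE /expC/= => /eqP.
  rewrite eq_complex/= !mul0r subr0 addr0 -/(v y) => /andP[/eqP h1 /eqP h2].
  set e := expR _ in h1 h2.
  have e0 : e != 0 by rewrite gt_eqF// expR_gt0.
  have s0 : sin (v y) = 0 by apply/eqP; move/eqP: h2; rewrite mulf_eq0 (negbTE e0).
  have := cos2Dsin2 (v y); rewrite s0 expr0n/= addr0 => /eqP.
  rewrite sqrf_eq1 => /orP[/eqP//|/eqP c1].
  by have := expR_gt0 (\int[mu]_c (d c * kre (x +i* y)%C c)); rewrite -/e; move: h1; rewrite c1; lra.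
pose N := \int[mu]_c `|d c|.
have vN y : 0 < y -> `|v y| <= N / y.
  move=> y_gt0; have u0 := nr y y_gt0.
  rewrite (le_trans (le_normr_Rintegral _ _))//; first exact: integrable_kim.
  rewrite mulrC /N -RintegralZl//.
  apply: le_Rintegral => //.
  - by have := integrable_abse (integrable_kim id_ u0).
  - rewrite (_ : EFin \o _ = (fun c => y^-1%:E * (`|d c|)%:E)%E)//; exact: integrableZl.
  - move=> c _; rewrite normrM mulrC ler_wpM2r//.
    by rewrite (le_trans (norm_kim c u0))//= gtr0_norm.
apply: contrapT => /eqP v0.
(* A positive value that |v| must take between [y0] and [Y]; t <= 1 < pi makes cos t different from
   1. *)
pose t := Num.min `|v y0| 1.
have t0 : 0 < t by rewrite /t lt_min normr_gt0 v0 ltr01.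
have t1 : t <= 1 by rewrite ge_min lexx orbT.
(* Then t Y >= N, so the decay bound N / Y is at most [t]. *)
pose Y := y0 + N / t.
have N0 : 0 <= N by apply: Rintegral_ge0.
have y0Y : y0 <= Y by rewrite lerDl divr_ge0// ltW.
have Y0 : 0 < Y by exact: lt_le_trans y0Y.
have vY : `|v Y| <= t.
  rewrite (le_trans (vN _ Y0))// ler_pdivrMr// /Y mulrDr mulrCA mulfV ?gt_eqF// mulr1.
  by rewrite lerDr mulr_ge0// ltW.
have cv : {within `[y0, Y], continuous (fun y => `|v y|)}.
  have h := @continuity_under_integral R _ (measurableTypeR R) mu
    (fun y c => d c * kim (x +i* y)%C c) setT measurableT (y0 / 2) (Y + 1).
  apply: continuous_in_subspaceT => y; rewrite inE/= in_itv/= => /andP[y1 y2].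
  apply: continuous_comp; last exact: norm_continuous.
  apply: (h _ _ (fun c => `|d c| * (y0 / 2)^-1)).
  - move=> z; rewrite /= in_itv/= => /andP[z1 _].
    by apply: integrable_kim => //; apply: nr; lra.
  - apply: aeW => c _ z; rewrite inE/= in_itv/= => /andP[z1 _].
    apply: cvgM; first exact: cvg_cst.
    have z0 : 0 < z by lra.
    rewrite (_ : kim _ _ = - z / ((x - c) ^+ 2 + z ^+ 2)); last exact: kimE.
    under eq_fun do rewrite kimE.
    apply: cvgM; first by apply: cvgN; exact: cvg_id.
    apply: cvgV; first by rewrite gt_eqF// kden_gt0// gt_eqF.
    apply: cvgD; first exact: cvg_cst.
    under eq_fun do rewrite expr2; rewrite expr2.
    by apply: cvgM; exact: cvg_id.
  - rewrite (_ : EFin \o _ = (fun c => (y0 / 2)^-1%:E * (`|d c|)%:E)%E); first exact: integrableZl.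
    by apply/funext => c /=; rewrite mulrC.
  - move=> z; rewrite /= in_itv/= => /andP[z1 _]; apply: aeW => c _.
    have z0 : 0 < z by lra.
    rewrite normrM ler_wpM2l// (le_trans (norm_kim c (nr _ z0)))//= gtr0_norm//.
    by rewrite lef_pV2 ?posrE ?divr_gt0// ltW.
  - by rewrite inE/= in_itv/=; apply/andP; split; lra.
have [] := IVT (v := t) y0Y cv.
  by rewrite ge_min vY orbT/= le_max /t ge_min lexx.
move=> z; rewrite in_itv/= => /andP[z1 _] vz.
have z0 : 0 < z by exact: lt_le_trans z1.
have : cos t = cos 0.
  by rewrite cos0 -vz -[RHS](cosv z z0); case: (ger0P (v z)) => _; rewrite ?cosN.
have pi2 := pi_ge2 R.
move=> /cos_inj; rewrite !in_itv/= lexx pi_ge0 (ltW t0)/= => /(_ _ isT).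
by rewrite (le_trans t1) ?(le_trans _ pi2)// ?ler1n// => /(_ isT) th; rewrite th ltxx in t0.
Qed.

End Inversion.

(** * Injectivity of the Poisson integral *)

Section PoissonUniqueness.
Context {R : realType}.
Local Notation mu := (@lebesgue_measure R).
Variable d : R -> R.
Hypothesis id_ : mu.-integrable setT (EFin \o d).
Hypothesis hd : forall x y, 0 < y -> \int[mu]_c (d c * kim (x +i* y)%C c) = 0.

Let md : measurable_fun setT d.
Proof. by apply/measurable_EFinP; exact: measurable_int id_. Qed.

Let iabs : mu.-integrable setT (EFin \o (fun c => `|d c|)).
Proof. exact: integrable_abse id_. Qed.

(** A primitive in [x] of the Poisson kernel y / ((x - c)^2 + y^2), which is minus [kim]. *)
Let A (y x c : R) := atan ((x - c) / y).

Let A_cts y x : continuous (A y x).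
Proof.
move=> c; apply: (@continuous_comp _ _ _ (fun c => (x - c) / y) atan); last exact: continuous_atan.
by apply: cvgM; [apply: cvgB; [exact: cvg_cst|exact: cvg_id]|exact: cvg_cst].
Qed.

Let A_bnd y x c : `|A y x c| <= pi / 2.
Proof. by rewrite ler_norml ltW ?atan_gtNpi2// ltW// atan_ltpi2. Qed.

Let A_int y x : mu.-integrable setT (EFin \o (fun c => d c * A y x c)).
Proof.
have mA : measurable_fun setT (A y x) by apply: continuous_measurable_fun; exact: A_cts.
have bA : [bounded A y x c | c in setT].
  exists (pi / 2); split; first exact: num_real.
  by move=> B bB c _ /=; rewrite (le_trans (A_bnd _ _ _))// ltW.
exact: (@integrableMl _ (measurableTypeR R) R mu setT measurableT _ (A y x) id_ mA bA).
Qed.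

Let is_derive_A (y x c : R) : 0 < y ->
  is_derive x 1 (fun x : R => d c * A y x c) (- (d c * kim (x +i* y)%C c)).
Proof.
move=> y0; have h1 : is_derive x 1 (fun x => (x - c) / y) (y^-1).
  have -> : (fun x => (x - c) / y) = y^-1 *: (id - cst c).
    by apply/funext => z; rewrite mulrC.
  by apply: is_derive_eq; rewrite /GRing.scale/=; ring.
have h2 := is_derive1_atan ((x - c) / y).
have h3 := @is_derive1_comp R (@atan R) (fun x => (x - c) / y) x _ _ h2 h1.
have -> : (fun x => d c * A y x c) = d c *: (@atan R \o (fun x => (x - c) / y)) by apply/funext.
apply: is_derive_eq; rewrite kimE /GRing.scale/=.
have d1 : 1 + ((x - c) / y) ^+ 2 != 0 by rewrite gt_eqF// ltr_pwDl// sqr_ge0.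
have y1 : y != 0 by rewrite gt_eqF.
have d0 := kden_gt0 x c y1.
have -> : (x - c) ^+ 2 + y ^+ 2 = (1 + ((x - c) / y) ^+ 2) * y ^+ 2 by field.
by field; rewrite y1 addrC gt_eqF.
Qed.

(** Differentiating under the integral, with dominating function |d| / y, gives the vanishing
    Poisson integral as derivative in [x]. *)
Let A_const y a b : 0 < y ->
  \int[mu]_c (d c * (A y b c - A y a c)) = 0.
Proof.
move=> y0; pose Phi x := \int[mu]_c (d c * A y x c).
have nr x : nonreal (x +i* y)%C by rewrite /nonreal/= gt_eqF.
suff PhiE : Phi b = Phi a.
  transitivity (Phi b - Phi a); last by rewrite PhiE subrr.
  rewrite /Phi -RintegralB//.
  by apply: eq_Rintegral => c _; rewrite mulrBr.
apply: is_derive_0_is_cst => x.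
have pE z c : partial1of2 (fun x c => d c * A y x c) z c = - (d c * kim (z +i* y)%C c).
  by rewrite partial1of2E; have [_ ->] := is_derive_A z c y0.
have Gint : mu.-integrable setT (EFin \o (fun c => `|d c| * `|y|^-1)).
  rewrite (_ : EFin \o _ = (fun c => (`|y|^-1)%:E * (`|d c|)%:E)%E); first exact: integrableZl.
  by apply/funext => c /=; rewrite mulrC.
have xI : `]x - 1, x + 1[%classic x by rewrite /= in_itv/=; lra.
have h1 z : `]x - 1, x + 1[%classic z ->
  mu.-integrable setT (EFin \o (fun c => d c * A y z c)) by move=> _; exact: A_int.
have h2 z c : `]x - 1, x + 1[%classic z -> [set: R] c -> derivable (fun x => d c * A y x c) z 1.
  by move=> _ _; have [] := is_derive_A z c y0.
have h3 c : 0 <= `|d c| * `|y|^-1 by rewrite mulr_ge0.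
have h4 z c : `]x - 1, x + 1[%classic z -> [set: R] c ->
    `|partial1of2 (fun x c => d c * A y x c) z c| <= `|d c| * `|y|^-1.
  by move=> _ _; rewrite pE normrN normrM ler_wpM2l//; exact: (norm_kim c (nr z)).
apply: DeriveDef.
  exact: (@derivable_under_integral R _ (measurableTypeR R) mu _ setT measurableT x _ _ xI h1 h2 _ h3 Gint h4).
rewrite -derive1E.
rewrite (@differentiation_under_integral R _ (measurableTypeR R) mu _ setT measurableT x _ _ xI h1 h2 _ h3 Gint h4).
under eq_Rintegral do rewrite pE -mulN1r.
rewrite RintegralZl//; last exact: integrable_kim.
by rewrite hd// mulr0.
Qed.

(** The limit of atan (z / y) as y decreases to 0, including the value 0 at z = 0. *)
Let S (z : R) := Num.sg z * (pi / 2).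

Let atan_cvg (z : R) : atan (z / n.+1%:R^-1) @[n --> \oo] --> S z.
Proof.
have pos (w : R) : 0 < w -> atan (w / n.+1%:R^-1) @[n --> \oo] --> pi / 2.
  move=> w0; apply: (@cvg_comp _ _ _ (fun n : nat => w / n.+1%:R^-1) (@atan R)) (@cvgy_atan R).
  apply/cvgryPge => B; near=> n; rewrite invrK -ler_pdivrMl//.
  rewrite (@le_trans _ _ n%:R) ?ler_nat//.
  by near: n; exact: nbhs_infty_ger.
rewrite /S; case: (ltgtP z 0) => z0.
- rewrite ltr0_sg// mulN1r; rewrite (_ : (fun n => _) = (fun n => - atan (- z / n.+1%:R^-1))).
    by apply: cvgN; apply: pos; rewrite oppr_gt0.
  by apply/funext => n; rewrite mulNr atanN opprK.
- by rewrite gtr0_sg// mul1r; exact: pos.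
- by rewrite z0 sgr0 mul0r; under eq_fun do rewrite mul0r atan0; exact: cvg_cst.
Unshelve. all: by end_near. Qed.

(** Let y = 1/(n+1) tend to 0 in [A_const]; the integrands are dominated by pi |d|. *)
Let int_S a b : \int[mu]_c (d c * (S (b - c) - S (a - c))) = 0.
Proof.
pose f_ n c := d c * (A n.+1%:R^-1 b c - A n.+1%:R^-1 a c).
have mf n : measurable_fun setT (fun c => (f_ n c)%:E).
  apply/measurable_EFinP; apply: measurable_funM => //.
  by apply: measurable_funB; apply: continuous_measurable_fun; exact: A_cts.
have cf c : f_ n c @[n --> \oo] --> d c * (S (b - c) - S (a - c)).
  by apply: cvgM; [exact: cvg_cst|apply: cvgB; exact: atan_cvg].
have mlim : measurable_fun setT (fun c => (d c * (S (b - c) - S (a - c)))%:E).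
  apply/measurable_EFinP; apply: (@measurable_fun_cvg _ _ _ setT f_) => [n|c _]; last exact: cf.
  by apply/measurable_EFinP; exact: (mf n).
have ib : mu.-integrable setT (fun c => (pi * `|d c|)%:E).
  by rewrite (_ : (fun c => _) = (fun c => pi%:E * (`|d c|)%:E)%E)//; exact: integrableZl.
have h3 : {ae mu, forall c, [set: R] c -> (f_ n c)%:E @[n --> \oo] --> (d c * (S (b - c) - S (a - c)))%:E}.
  by apply: aeW => c _; apply: cvg_EFin; [exact: nearW|exact: cf].
have h5 : {ae mu, forall c n, [set: R] c -> (`|(f_ n c)%:E| <= (pi * `|d c|)%:E)%E}.
  apply: aeW => c n _; rewrite lee_fin /f_ normrM mulrC ler_wpM2r//.
  rewrite (le_trans (ler_normB _ _))// (splitr pi) lerD//; exact: A_bnd.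
have [i1 _ i2] := @dominated_convergence _ (measurableTypeR R) R mu setT measurableT
  _ _ _ mf mlim h3 ib h5.
have i3 : \int[mu]_c f_ n c @[n --> \oo] --> \int[mu]_c (d c * (S (b - c) - S (a - c))).
  by apply: fine_cvg; rewrite fineK//; exact: integrable_fin_num i1.
apply: (cvg_unique (@Rhausdorff R) i3).
rewrite (_ : (fun n => _) = cst 0); first exact: cvg_cst.
by apply/funext => n; rewrite /f_ A_const// invr_gt0.
Qed.

(** Off the endpoints S (b - c) - S (a - c) is pi times the indicator of ]a, b], so [d] has zero
    integral over every such interval. Its primitive is constant, and Lebesgue differentiation
    concludes. *)
Lemma poisson_eq0 : {ae mu, forall c, d c = 0}.
Proof.
have ii (D : set (measurableTypeR R)) : measurable D -> mu.-integrable D (EFin \o d).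
  by move=> mD; apply: integrableS id_.
have itv0 a b : a <= b -> \int[mu]_(c in `]a, b]) d c = 0.
  move=> ab; apply: (@mulfI _ pi); first by rewrite gt_eqF// pi_gt0.
  rewrite mulr0 -(int_S a b) -RintegralZl//; last exact: ii.
  rewrite Rintegral_mkcond /Rintegral; congr (fine _).
  have mr : measurable_fun setT ((fun c => pi * d c) \_ `]a, b]).
    by apply/(measurable_restrictT _ _).1 => //; apply: measurable_funTS; exact: measurable_funM.
  apply: ae_eq_integral => //.
  - exact/measurable_EFinP.
  - have mS (z : R) : measurable_fun setT (fun c : R => S (z - c)).
      apply: (@measurable_fun_cvg _ _ _ setT (fun n => A n.+1%:R^-1 z)) => [n|c _].
        by apply: continuous_measurable_fun; exact: A_cts.
      exact: atan_cvg.
    apply/measurable_EFinP; apply: measurable_funM => //.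
    by apply: measurable_funB; exact: mS.
  - exists [set a; b]; split.
    + by apply: measurableU; exact: measurable_set1.
    + by apply: countable_lebesgue_measure0; exact: finite_set_countable.
    suff key (c : R) : c != a -> c != b ->
        ((fun c => pi * d c) \_ `]a, b]) c = d c * (S (b - c) - S (a - c)).
      move=> c /= h; apply: contrapT => /not_orP[/eqP ca /eqP cb]; apply: h => _.
      by rewrite key.
    move=> ca cb; rewrite patchE /S.
    have [h|h] := boolP (c \in _).
      move: h; rewrite inE/= in_itv/= => /andP[ac cb'].
      have {}cb : c < b by rewrite lt_neqAle cb.
      by rewrite gtr0_sg ?subr_gt0// ltr0_sg ?subr_lt0//; lra.
    have := h; rewrite notin_setE/= in_itv/= => /negP; rewrite negb_and -leNgt -ltNge.
    move=> /orP[ac|bc].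
      have {}ac : c < a by rewrite lt_neqAle ca.
      by rewrite !gtr0_sg ?subr_gt0//; [rewrite subrr mulr0|exact: lt_le_trans ab].
    by rewrite !ltr0_sg ?subr_lt0//; [rewrite subrr mulr0|exact: le_lt_trans bc].
have locd : locally_integrable [set: R] d.
  by apply: open_integrable_locally; [exact: openT|exact: id_].
have := FTC1Ny (fun y => ii _ (measurable_itv _)) locd => /=.
pose G y := \int[mu]_(t in `]-oo, y]) d t.
have Gc : G = cst (G 0).
  have Gle x y : x <= y -> G y = G x.
    move=> xy; apply/eqP; rewrite -subr_eq0; apply/eqP.
    have := @Rintegral_itvB _ d -oo%O (BRight y) x (ii _ (measurable_itv _)).
    by rewrite !bnd_simp => /(_ isT xy) ->; exact: itv0.
  by apply/funext => y /=; have [/Gle|/ltW/Gle] := leP 0 y.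
apply: filterS; first exact: (ae_filter_ringOfSetsType mu).
by move=> c [_ <-]; rewrite -[RHS](derive1_cst (G 0) c); congr (derive1 _ c).
Qed.

End PoissonUniqueness.

(** * The spectral shift *)

Section DiscreteTransform.
Context {R : realType}.
Local Notation mu := (@lebesgue_measure R).
Variables (s : seq R) (W : R -> R).

Definition discrete_stieltjes (u : R[i]) : R[i] :=
  \sum_(x <- s) (W x)%:C%C / (u - x%:C%C).

Lemma Re_discrete_stieltjes u :
  complex.Re (discrete_stieltjes u) = \sum_(x <- s) W x * kre u x.
Proof.
rewrite /discrete_stieltjes; elim: s => [|x l ih]; first by rewrite !big_nil.
rewrite !big_cons -ih /kre; case: (\sum_(_ <- _) _) => a b; case: (_^-1) => c e /=.
by rewrite mul0r subr0.
Qed.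

Lemma Im_discrete_stieltjes u :
  complex.Im (discrete_stieltjes u) = \sum_(x <- s) W x * kim u x.
Proof.
rewrite /discrete_stieltjes; elim: s => [|x l ih]; first by rewrite !big_nil.
rewrite !big_cons -ih /kim; case: (\sum_(_ <- _) _) => a b; case: (_^-1) => c e /=.
by rewrite mul0r addr0.
Qed.

Hypothesis W0 : forall x, x \in s -> 0 < W x.
Hypothesis W1 : \sum_(x <- s) W x = 1.

(** Each atom contributes - y Im (1 / (iy - x)) = y^2 / (x^2 + y^2) >= 1 - x^2 / y^2. This bound
    passes to the limit, where it rules out escape of mass, and it also feeds the moment bound for
    the spectral shifts. *)
Lemma discrete_stieltjes_mass y : 0 < y ->
  1 - (\sum_(x <- s) W x * x ^+ 2) / y ^+ 2 <=
  - y * complex.Im (discrete_stieltjes (iy y)).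
Proof.
move=> y0; rewrite Im_discrete_stieltjes -W1 mulr_suml -sumrB mulr_sumr.
rewrite !big_seq; apply: ler_sum => x xs; rewrite kimE.
have d0 : 0 < (0 - x) ^+ 2 + y ^+ 2 by rewrite kden_gt0// gt_eqF.
have y2 : 0 < y ^+ 2 by rewrite exprn_gt0.
rewrite -mulrA -{1}(mulr1 (W x)) -mulrBr mulrCA ler_wpM2l ?(ltW (W0 xs))//.
rewrite mulrA mulrNN -expr2 ler_pdivlMr// mulrBl mul1r.
rewrite (_ : x ^+ 2 / y ^+ 2 * _ = x ^+ 4 / y ^+ 2 + x ^+ 2); last by field; rewrite gt_eqF.
rewrite (_ : _ - _ = y ^+ 2 - x ^+ 4 / y ^+ 2); last by ring.
by rewrite lerBlDr lerDl divr_ge0 ?exprn_even_ge0// ltW.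
Qed.

Lemma discrete_stieltjes_lower_bound y : 0 < y ->
  1 - (\sum_(x <- s) W x * x ^+ 2) / y ^+ 2 <=
  complex.Re `|iy y * discrete_stieltjes (iy y)|.
Proof.
move=> y0; rewrite (le_trans (discrete_stieltjes_mass y0))//.
rewrite -lecR -[leRHS]/((complex.Re `|_|)%:C)%C.
have -> : ((complex.Re `|iy y * discrete_stieltjes (iy y)|)%:C)%C =
  `|iy y * discrete_stieltjes (iy y)| by rewrite normc_def.
apply: le_trans (normc_ge_Re _).
by rewrite lecR; case: (discrete_stieltjes _) => a b /=; rewrite mul0r sub0r mulNr ler_norm.
Qed.

End DiscreteTransform.

Section DiscreteQuantile.
Context {R : realType}.
Local Notation mu := (@lebesgue_measure R).

(** The arctangent bounds all quantile functions by pi / 2 and keeps them monotone, as Helly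
    selection requires. *)
Lemma discrete_quantile (s : seq R) (W : R -> R) : sorted <%R s ->
  (forall x, x \in s -> 0 < W x) -> \sum_(x <- s) W x = 1 ->
  exists a : R -> R, [/\ {homo a : t1 t2 / t1 <= t2}, forall t, `|a t| <= pi / 2,
    forall u, nonreal u -> \int[mu]_(t in `]0, 1]) gre u (a t) =
      complex.Re (discrete_stieltjes s W u) &
    forall u, nonreal u -> \int[mu]_(t in `]0, 1]) gim u (a t) =
      complex.Im (discrete_stieltjes s W u)].
Proof.
move=> ss W0 W1.
have [m sm] : exists m, size s = m.+1.
  case: s W1 {ss W0} => [|x l _]; last by exists (size l).
  by rewrite big_nil => /eqP; rewrite eq_sym oner_eq0.
have cos0 (x : R) : cos (atan x) != 0.
  by rewrite cos_atan invr_eq0 gt_eqF// sqrtr_gt0 ltr_pwDl// sqr_ge0.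
exists (fun t => atan (quantile s W m t)); split.
- by move=> t1 t2 t12; apply: le_atan; exact: quantile_nd.
- by move=> t; rewrite ler_norml ltW ?atan_gtNpi2// ltW// atan_ltpi2.
- move=> u u0; rewrite Re_discrete_stieltjes.
  rewrite -(Rintegral_quantile ss sm W0 W1 (measurable_kre u0) (fun c => norm_kre c u0)).
  by apply: eq_Rintegral => t _; rewrite gre_tan// atanK.
- move=> u u0; rewrite Im_discrete_stieltjes.
  rewrite -(Rintegral_quantile ss sm W0 W1 (measurable_kim u0) (fun c => norm_kim c u0)).
  by apply: eq_Rintegral => t _; rewrite gim_tan// atanK.
Qed.

End DiscreteQuantile.

Section SpectralShift.
Context {R : realType}.
Local Notation mu := (@lebesgue_measure R).
Variables (T : R[i] -> R[i]) (M : R) (s : nat -> seq R) (W : nat -> R -> R).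
Hypothesis ss : forall n, sorted <%R (s n).
Hypothesis W0 : forall n x, x \in s n -> 0 < W n x.
Hypothesis W1 : forall n, \sum_(x <- s n) W n x = 1.
Hypothesis W2 : forall n, \sum_(x <- s n) W n x * x ^+ 2 = M.
Hypothesis cvT : forall u (e : R), nonreal u -> 0 < e -> exists N, forall n, (N <= n)%N ->
  `|discrete_stieltjes (s n) (W n) u - T u| <= e%:C%C.

Let M0 : 0 <= M.
Proof.
rewrite -(W2 0) big_seq; apply: sumr_ge0 => x xs.
by rewrite mulr_ge0 ?sqr_ge0// ltW// (W0 xs).
Qed.

Let cv_re u : nonreal u ->
  complex.Re (discrete_stieltjes (s n) (W n) u) @[n --> \oo] --> complex.Re (T u).
Proof.
move=> u0; apply/cvgrPdist_le => e e0; have [N hN] := cvT u0 e0.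
exists N => // n /= /hN hn; rewrite distrC -lecR (le_trans _ hn)//.
rewrite (le_trans _ (normc_ge_Re _))// lecR.
by case: (T u) (discrete_stieltjes _ _ _) => ? ? [].
Qed.

Let cv_im u : nonreal u ->
  complex.Im (discrete_stieltjes (s n) (W n) u) @[n --> \oo] --> complex.Im (T u).
Proof.
move=> u0; apply/cvgrPdist_le => e e0; have [N hN] := cvT u0 e0.
exists N => // n /= /hN hn; rewrite distrC -lecR (le_trans _ hn)//.
rewrite (le_trans _ (normc_ge_Im _))// lecR.
by case: (T u) (discrete_stieltjes _ _ _) => ? ? [].
Qed.

Lemma stieltjes_representation : exists tau : probability (measurableTypeR R) R,
  forall u, nonreal u -> stieltjes tau u = T u.
Proof.
have [a ha] := choice (fun n => discrete_quantile (ss n) (@W0 n) (W1 n)).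
have T_mass y : 0 < y -> 1 - M / y ^+ 2 <= - y * complex.Im (T (iy y)).
  move=> y0; have iy0 : nonreal (iy y) by rewrite /nonreal/= gt_eqF.
  have h : - y * complex.Im (discrete_stieltjes (s n) (W n) (iy y)) @[n --> \oo] -->
      - y * complex.Im (T (iy y)) by apply: cvgM; [exact: cvg_cst|exact: cv_im].
  apply: (cvgr_to_ge h); apply: nearW => n; rewrite -(W2 n).
  by apply: discrete_stieltjes_mass => //; exact: W0.
apply: (@stieltjes_limit _ T M a) => //.
- by move=> n; case: (ha n).
- by move=> n; case: (ha n).
- move=> u u0; rewrite (_ : (fun n => _) = (fun n => complex.Re (discrete_stieltjes (s n) (W n) u))).
    exact: cv_re.
  by apply/funext => n; case: (ha n) => _ _ ->.
- move=> u u0; rewrite (_ : (fun n => _) = (fun n => complex.Im (discrete_stieltjes (s n) (W n) u))).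
    exact: cv_im.
  by apply/funext => n; case: (ha n) => _ _ _ ->.
Qed.

Lemma shift_representation : exists xi, [/\ mu.-integrable setT (EFin \o xi), shifted xi &
  forall u, nonreal u -> u * T u = expC (- cauchy mu xi u)].
Proof.
have [xi_ hxi] := choice (fun n => log_representation (ss n) (@W0 n) (W1 n)).
have xiE n u : nonreal u ->
    expC (- cauchy mu (xi_ n) u) = u * discrete_stieltjes (s n) (W n) u.
  move=> u0; have [_ _ h] := hxi n; rewrite /discrete_stieltjes h// mulVKf//.
  by apply: contraNneq u0 => ->.
apply: (@limit_log_representation _ (fun u => u * T u) xi_ M) => //.
- by move=> n; case: (hxi n).
- by move=> n; case: (hxi n).
- move=> n y y0; rewrite xiE; last by rewrite /nonreal/= gt_eqF.
  by rewrite -(W2 n); apply: discrete_stieltjes_lower_bound => //; exact: W0.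
- move=> u e u0 e0; have un0 : u != 0 by apply: contraNneq u0 => ->.
  pose r := complex.Re `|u|.
  have rE : `|u| = r%:C%C by rewrite /r normc_def.
  have r0 : 0 < r by rewrite -ltcR -rE normr_gt0.
  (* Passing from [T] to u T multiplies the error by |u| = r. *)
  have [N hN] := cvT u0 (divr_gt0 e0 r0); exists N => n /hN hn.
  rewrite xiE// -mulrBr normrM rE (le_trans (ler_wpM2l _ hn)) ?lecR ?(ltW r0)//.
  by rewrite -rmorphM/= mulrC divfK// gt_eqF.
Qed.

End SpectralShift.

Lemma shift_unique {R : realType} (xi1 xi2 : R -> R) :
  lebesgue_measure.-integrable setT (EFin \o xi1) ->
  lebesgue_measure.-integrable setT (EFin \o xi2) ->
  (forall u, nonreal u -> expC (- cauchy lebesgue_measure xi1 u) =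
     expC (- cauchy lebesgue_measure xi2 u)) ->
  {ae lebesgue_measure, forall c, xi1 c = xi2 c}.
Proof.
move=> i1 i2 h.
have id_ : (@lebesgue_measure R).-integrable setT (EFin \o (fun c => xi1 c - xi2 c)).
  by apply: eq_integrable (integrableB measurableT i1 i2).
have hd u : nonreal u -> expC (cauchy lebesgue_measure (fun c => xi1 c - xi2 c) u) = 1.
  by move=> u0; rewrite cauchyB// expCD -h// -expCD subrr expC0.
have := poisson_eq0 id_ (cauchy_im_eq0 id_ hd).
apply: filterS; first exact: (ae_filter_ringOfSetsType lebesgue_measure).
by move=> c /eqP; rewrite subr_eq0 => /eqP.
Qed.

Lemma spectral_discretization {R : realType} {H : completeNormedModType R[i]}
    (dot : {dot H for Num.conj}) (hdot : hilbert_dot dot)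
    (L : operator H) (psi : H) (L_sa : self_adjoint dot L) (psi1 : `|psi| = 1)
    (dpsi : forall k, dom L (iter k L psi))
    (L_esa : essentially_self_adjoint_graph dot (orbit_restriction L psi)) :
  exists (M : R) (s : nat -> seq R) (W : nat -> R -> R),
  [/\ forall n, sorted <%R (s n), forall n x, x \in s n -> 0 < W n x,
    forall n, \sum_(x <- s n) W n x = 1, forall n, \sum_(x <- s n) W n x * x ^+ 2 = M &
    forall u (e : R), nonreal u -> 0 < e -> exists N, forall n, (N <= n)%N ->
      `|discrete_stieltjes (s n) (W n) u - dot (resolvent L u psi) psi| <= e%:C%C].
Proof.
have [d [lam [w [w0 w1 w2 wT]]]] := krylov_approximation hdot L_sa dpsi psi1 L_esa.
have h n := merge_atoms (lam n) (w0 n).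
have [s hs] := choice h; have [W hW] := choice hs; clear h hs.
exists (complex.Re (`|L psi| ^+ 2)), s, W; split.
- by move=> n; case: (hW n).
- by move=> n; case: (hW n).
(* Merging atoms preserves the mass, the second moment and the Stieltjes transform, by taking for
   [phi] the constant 1, the square and the complex kernel in turn. *)
- move=> n; have [_ _ /(_ _ idfun (fun _ => 1))/= E] := hW n.
  by rewrite -(w1 n); under eq_bigr do rewrite -[W _ _]mulr1; rewrite -E; under eq_bigr do rewrite mulr1.
- by move=> n; have [_ _ /(_ _ idfun (fun x => x ^+ 2))/= E] := hW n; rewrite -(w2 n) -E.
- move=> u e u0 e0; have [N hN] := wT u e u0 e0; exists N => n /hN.
  have [_ _ /(_ _ (real_complex R) (fun x => (u - x%:C%C)^-1))/= E] := hW n.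
  by rewrite /discrete_stieltjes -E.
Qed.

Theorem proposition2p5p5 (R : realType) (H : completeNormedModType R[i])
    (dot : {dot H for Num.conj}) (hdot : hilbert_dot dot)
    (L : operator H) (psi0 : H)
    (L_sa : self_adjoint dot L)
    (psi0_unit : `|psi0| = 1)
    (psi0_cyclic : cyclic_vector L psi0)
    (L_orbit_esa :
       essentially_self_adjoint_graph dot (orbit_restriction L psi0)) :
  exists f : R -> R,
    [/\ profile f,
        T_up_is_titchmarsh_weyl dot L psi0 f,
        transition_is_spectral_measure dot L psi0 f
      & shifted_rayleigh_is_spectral_shift dot L psi0 f] /\
    forall g : R -> R,
      [/\ profile g,
          T_up_is_titchmarsh_weyl dot L psi0 g,
          transition_is_spectral_measure dot L psi0 g
        & shifted_rayleigh_is_spectral_shift dot L psi0 g] ->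
      profile_eq f g.
Proof.
have [dpsi _] := psi0_cyclic.
have dpsi0 : dom L psi0 := dpsi 0.
pose T u := dot (resolvent L u psi0) psi0.
have [M [s [W [ss W0 W1 W2 cvT]]]] :=
  spectral_discretization hdot L_sa psi0_unit dpsi L_orbit_esa.
have [xi [ixi sxi Txi]] := shift_representation ss W0 W1 W2 cvT.
have [tau tauT] := stieltjes_representation ss W0 W1 W2 cvT.
have [f [pf isf Tf]] := exists_profile ixi sxi.
have un0 u : nonreal u -> u != 0 by move=> u0; apply: contraNneq u0 => ->.
have TfE u : nonreal u -> T_up f u = T u.
  by move=> u0; rewrite Tf// -Txi// mulKf// un0.
have expf (g : R -> R) u : nonreal u -> T_up g u = T u ->
    expC (- cauchy lebesgue_measure (shifted_rayleigh g) u) = u * T u.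
  by move=> u0 <-; rewrite /T_up mulVKf// un0.
have fdet u (u0 : nonreal u) := minor_fredholm_det hdot L_sa psi0_unit dpsi0 u0.
exists f; split.
  split => //.
  - move=> u u0; split; first exact: TfE.
    by exists (u * T u); [exact: fdet|rewrite mulKf// un0].
  - by exists tau => // u u0; rewrite tauT// TfE.
  - split => //.
    + exact: embedded_minor_self_adjoint.
    + exact: minor_trace_class_difference.
    (* The exponential in the definition of [T_up] is u T(u), which is the determinant for the
       minor. *)
    + by move=> u u0; rewrite -/(cauchy _ _ u) expf ?TfE//; exact: fdet.
(* Clause (1) fixes the exponential for [g], and clause (3) supplies the integrability that the
   inversion needs. *)
move=> g [pg Tg _ [_ _ _ isg _]].
have := shift_unique isf isg (fun u u0 => etrans (expf f u u0 (TfE u u0))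
  (esym (expf g u u0 (Tg u u0).1))).
apply: filterS; first exact: (ae_filter_ringOfSetsType lebesgue_measure).
move=> c; rewrite /shifted_rayleigh /rayleigh => /addIr h.
by apply: (@addrI _ 1); apply: (@mulIf _ (2^-1)); rewrite ?invr_eq0 ?pnatr_eq0.
Qed.
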